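(* Let $f,g$ be transcendental entire functions and suppose that there exists $\alpha \in (0,1)$ such that $$M(r,g-f) \leq M(r,f)^{\alpha}, \quad\text{for all large } r.$$ Then $g$ has a multiply connected wandering domain whenever $f$ does.
   Context: For an entire function $F$ and $r>0$, $M(r,F)=\max_{|z|=r}|F(z)|$. A transcendental entire function is an entire function $f:\mathbb{C}\to\mathbb{C}$ that is not a polynomial; $f^n$ denotes its $n$-th iterate. The Fatou set $F(f)$ is the set of points of $\mathbb{C}$ having a neighbourhood on which the iterates $f^n$ form a normal family (locally uniform convergence to $\infty$ being allowed). A Fatou component is a connected component of $F(f)$. For a Fatou component $U$, $U_n$ denotes the Fatou component containing $f^n(U)$, with $U_0=U$; $U$ is a wandering domain if the sequence $(U_n)$ is not eventually periodic. A domain is multiply connected if it is not simply connected. *)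

(* Defs.v *)
From HB Require Import structures.
From mathcomp Require Import all_boot all_order all_algebra.
From mathcomp Require Import all_classical all_reals all_analysis complex.

Set Implicit Arguments.
Unset Strict Implicit.
Unset Printing Implicit Defensive.

Import Order.TTheory GRing.Theory Num.Theory.
Import numFieldNormedType.Exports.

Local Open Scope classical_set_scope.
Local Open Scope ring_scope.

(* [R[i]] receives the topology and the normed-space structure over itself that
   every [numFieldType] has; [derivable f z 1] is then complex
   differentiability at [z]. *)
HB.instance Definition _ (R : rcfType) := NormedModule.copy R[i] R[i]^o.

Section entire_functions.
Context {R : realType}.
Local Notation C := R[i].

Definition cmod : C -> R := @Normc.normc R.

Definition entire (f : C -> C) := forall z, derivable f z 1.

Definition transcendental_entire (f : C -> C) :=
  entire f /\ ~ exists p : {poly C}, forall z, f z = p.[z].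

(* For continuous [F] and [r >= 0] the supremum is attained, since the circle is
   compact. *)
Definition max_modulus (r : R) (F : C -> C) : R :=
  sup [set cmod (F z) | z in [set z | cmod z = r]].

End entire_functions.

Section normal_families.
Context {R : realType}.
Local Notation C := R[i].

Definition locally_uniform_cvg (U : set C) (u : nat -> C -> C) (g : C -> C) :=
  forall z, U z -> exists2 V, nbhs z V & {uniform V, u @ \oo --> g}.

Definition locally_uniform_cvg_infty (U : set C) (u : nat -> C -> C) :=
  forall z, U z -> exists2 V, nbhs z V &
    forall A : R, \forall n \near \oo, forall w, V w -> A < cmod (u n w).

Definition normal_family (F : set (C -> C)) (U : set C) :=
  forall u : nat -> C -> C, (forall n, F (u n)) ->
  exists2 k : nat -> nat, {homo k : m n / (m < n)%N} &
    (exists g, locally_uniform_cvg U (u \o k) g) \/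
    locally_uniform_cvg_infty U (u \o k).

End normal_families.

Section fatou.
Context {R : realType}.
Local Notation C := R[i].
Implicit Types (f : C -> C) (U : set C).

Definition fatou_set f : set C :=
  [set z | exists U,
     [/\ open U, U z & normal_family (range (fun n => iter n f)) U]].

Definition fatou_component f U :=
  exists2 z, fatou_set f z & U = connected_component (fatou_set f) z.

(* [Us n] is the component written U_n; it is determined by [U], because [U] is
   nonempty and distinct components are disjoint. *)
Definition component_orbit f U (Us : nat -> set C) :=
  Us 0%N = U /\
  forall n, fatou_component f (Us n) /\ iter n f @` U `<=` Us n.

Definition eventually_periodic (T : Type) (u : nat -> T) :=
  exists N p : nat, (0 < p)%N /\ forall n, (N <= n)%N -> u (n + p)%N = u n.

Definition wandering_domain f U :=
  fatou_component f U /\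
  exists2 Us, component_orbit f U Us & ~ eventually_periodic Us.

End fatou.

Section connectivity.
Context {R : realType}.
Local Notation C := R[i].
Implicit Types (U : set C) (gamma : R -> C).

Definition domain U := [/\ U !=set0, open U & connected U].

Definition loop_in U gamma :=
  [/\ {within `[0, 1], continuous gamma}, gamma 0 = gamma 1 &
      gamma @` `[0, 1] `<=` U].

(* In [H (s, t)], [s] is the parameter of the deformation and [t] that of the
   curve; the base point [gamma 0] stays fixed. *)
Definition null_homotopic_in U gamma :=
  exists H : R * R -> C,
    [/\ {within `[0, 1] `*` `[0, 1], continuous H},
        H @` (`[0, 1] `*` `[0, 1]) `<=` U,
        forall t, t \in `[0, 1] -> H (0, t) = gamma t /\ H (1, t) = gamma 0 &
        forall s, s \in `[0, 1] -> H (s, 0) = gamma 0 /\ H (s, 1) = gamma 0].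

(* Meant for domains: connectedness of [U] is not included. *)
Definition simply_connected U :=
  forall gamma, loop_in U gamma -> null_homotopic_in U gamma.

Definition multiply_connected U := domain U /\ ~ simply_connected U.

End connectivity.

Definition has_multiply_connected_wandering_domain (R : realType)
    (f : R[i] -> R[i]) :=
  exists2 U, wandering_domain f U & multiply_connected U.

(* Main.v *)
(* Let U_n be the components of the orbit of a multiply connected wandering domain of f.
   A loop of U_0 that does not contract surrounds a bounded open set Om with boundary in
   U_0 but not contained in U_0. By the maximum and minimum principles some iterates f^n are
   large on the boundary of Om and vanish in Om, so that the U_n surround the origin and
   tend to infinity. By the three circles theorem log|f^m| is not almost constant on such a
   U_k; since a holomorphic log f^m omitting a value would obey Harnack's inequality,
   f^m(U_k) contains a round annulus |log|w| - L| <= eta L with L arbitrarily large.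

   Write F(t) = log M(e^t, f), a convex function of superlinear growth. If U_n contains
   a(1-d) < log|z| < b(1+d) and a d^2 is large, then Harnack's inequality on circles gives
   log|f| >= (1-e) F(log|z|) there with e = 4 pi/(a d), and U_{n+1} contains the annulus
   given in the same way by a' = (1-e)F(a) - 1, b' = F(b) + 1 and d' = d/4. On
   a <= log|z| <= b the perturbation g - f is then negligible, so that g maps this annulus
   into a' <= log|z| <= b', while |g^n(0)| stays below the inner radii. Hence the Fatou
   component V of g that contains the first annulus is escaping. It is wandering, because in
   a periodic component log|g^n| would grow at most geometrically by Harnack's inequality.
   It is not simply connected, because otherwise it would contain the disc bounded by the
   annulus, and the minimum principle would contradict the smallness of g^n(0). *)
Require Import Defs.
From mathcomp Require Import all_boot all_order all_algebra.
From mathcomp Require Import all_classical all_reals all_analysis complex.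
From mathcomp Require Import ring lra zify.
Set Implicit Arguments.
Unset Strict Implicit.
Unset Printing Implicit Defensive.
Import Order.TTheory GRing.Theory Num.Theory.
Import numFieldNormedType.Exports.
Local Open Scope classical_set_scope.
Local Open Scope ring_scope.
Local Open Scope complex_scope.
Local Notation Re := complex.Re.
Local Notation Im := complex.Im.

(** * The complex modulus *)

(** Simple connectivity is defined by homotopies of loops, whereas the analysis needs a bounded open
    set with boundary in the domain. The bridge is a square grid: the loop is replaced by a walk in
    the cells near it, and these cells are filled up with the cells that they enclose. A walk
    contracts inside such a filled set, by removal of one corner cell after the other; so the loop
    contracts in U unless some enclosed cell leaves U.

    All analytic facts come from primitives. A primitive in the coordinate log(z - a) has the period
    2 pi i f(a), and this yields the maximum principle and Schwarz's lemma; Schwarz's lemma applied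
    to difference quotients shows that derivatives are holomorphic, whence logarithms and Harnack's
    inequality.

    In the iteration the margin d shrinks by the factor 4 at each step, while a grows at least by
    the factor 16. Hence a d^2 never decreases. As the Harnack loss is 4 pi / (a d), its ratio to d
    is 4 pi / (a d^2), and it stays small at all steps. *)

Section complex_modulus.
Context {R : realType}.
Local Notation C := R[i].

Implicit Types z w : C.

Lemma normE z : `|z| = (cmod z)%:C. Proof. by []. Qed.
Lemma cmod_ge0 z : 0 <= cmod z.
Proof. by have := normr_ge0 z; rewrite normE ler0c. Qed.
Lemma cmod0 : cmod (0 : C) = 0. Proof. exact: Normc.normc0. Qed.
Lemma cmod1 : cmod (1 : C) = 1. Proof. exact: Normc.normc1. Qed.
Lemma cmodM z w : cmod (z * w) = cmod z * cmod w. Proof. exact: Normc.normcM. Qed.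
Lemma cmodV z : cmod z^-1 = (cmod z)^-1. Proof. exact: Normc.normcV. Qed.
Lemma cmodN z : cmod (- z) = cmod z. Proof. exact: normcN. Qed.
Lemma cmodD z w : cmod (z + w) <= cmod z + cmod w. Proof. exact: le_normcD. Qed.
Lemma cmodB z w : cmod (z - w) = cmod (w - z).
Proof. by rewrite -cmodN opprB. Qed.
Lemma cmod_eq0 z : (cmod z == 0) = (z == 0).
Proof. by apply/eqP/eqP => [/Normc.eq0_normc//|->]; rewrite cmod0. Qed.
Lemma cmod_gt0 z : (0 < cmod z) = (z != 0).
Proof. by rewrite lt_def cmod_ge0 andbT cmod_eq0. Qed.
Lemma cmodX z n : cmod (z ^+ n) = cmod z ^+ n.
Proof. by elim: n => [|n IH]; rewrite ?cmod1 // !exprS cmodM IH. Qed.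
Lemma cmodR (x : R) : cmod x%:C = `|x|.
Proof. by rewrite /cmod /= expr0n addr0 sqrtr_sqr. Qed.
Lemma cmod_Re z : `|Re z| <= cmod z.
Proof. by have := normc_ge_Re z; rewrite normE lecR. Qed.
Lemma cmod_sqr z : cmod z ^+ 2 = Re z ^+ 2 + Im z ^+ 2.
Proof. by case: z => a b; rewrite /cmod /= sqr_sqrtr // addr_ge0 ?sqr_ge0. Qed.
Lemma cmod_Im z : `|Im z| <= cmod z.
Proof.
rewrite -(ger0_norm (cmod_ge0 z)) -ler_sqr ?nnegrE // !real_normK ?num_real //.
by rewrite cmod_sqr lerDr sqr_ge0.
Qed.
Lemma cmod_i : cmod ('i : C) = 1.
Proof. by rewrite /cmod /= expr0n add0r sqrtr_sqr normr1. Qed.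
Lemma complexE' z : z = (Re z)%:C + 'i * (Im z)%:C.
Proof. exact: complexE. Qed.
Lemma cmod_leD z : cmod z <= `|Re z| + `|Im z|.
Proof.
rewrite {1}[z]complexE' (le_trans (cmodD _ _))// cmodM cmod_i mul1r.
by rewrite !cmodR.
Qed.
Lemma cmod_distD (v z w : C) : cmod (z - w) <= cmod (z - v) + cmod (v - w).
Proof. by rewrite (_ : z - w = (z - v) + (v - w)) ?cmodD //; ring. Qed.
Lemma cmod_subl z w : cmod z - cmod w <= cmod (z - w).
Proof. by have := cmodD (z - w) w; rewrite subrK; lra. Qed.
Lemma cmod_dist z w : `|cmod z - cmod w| <= cmod (z - w).
Proof.
rewrite ler_norml; have := cmod_subl z w; have := cmod_subl w z.
rewrite (cmodB w z); lra.
Qed.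
Lemma cReD z w : Re (z + w) = Re z + Re w.
Proof. by case: z => ? ?; case: w. Qed.
Lemma cReN z : Re (- z) = - Re z. Proof. by case: z. Qed.
Lemma cImD z w : Im (z + w) = Im z + Im w.
Proof. by case: z => ? ?; case: w. Qed.
Lemma cImN z : Im (- z) = - Im z. Proof. by case: z. Qed.
Lemma cReM z w : Re (z * w) = Re z * Re w - Im z * Im w.
Proof. by case: z => ? ?; case: w. Qed.
Lemma cReMr z (x : R) : Re (z * x%:C) = Re z * x.
Proof. by case: z => a b /=; rewrite mulr0 subr0. Qed.
Lemma cImMr z (x : R) : Im (z * x%:C) = Im z * x.
Proof. by case: z => a b /=; rewrite mulr0 add0r. Qed.

(** The balls of [R[i]] have radii in [R[i]]; as a positive element is real, real radii suffice, and
    all later estimates use these. *)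
Lemma nbhs_cdiscP z (A : set C) :
  nbhs z A <-> exists2 r, 0 < r & forall w, cmod (w - z) < r -> A w.
Proof.
split.
  move=> /nbhs_ballP [e /= e0 sA].
  have /complex_realP [r er] := gtr0_real e0; subst e.
  exists r; first by rewrite -ltcR.
  move=> w wz; apply: sA; rewrite -ball_normE /= -normrN opprB normE.
  by rewrite ltcR.
move=> [r r0 sA]; apply/nbhs_ballP; exists r%:C => /=; first by rewrite ltcR.
move=> w; rewrite -ball_normE /= -normrN opprB normE ltcR => /sA; exact.
Qed.

Lemma continuous_atP (f : C -> C) z :
  {for z, continuous f} <->
  forall e, 0 < e -> exists2 d, 0 < d & forall w, cmod (w - z) < d -> cmod (f w - f z) < e.
Proof.
split.
  move=> cf e e0.
  have : nbhs (f z) [set w | cmod (w - f z) < e] by apply/nbhs_cdiscP; exists e.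
  by move=> /cf /nbhs_cdiscP [d d0 Hd]; exists d.
move=> H A /nbhs_cdiscP [e e0 He]; have [d d0 Hd] := H _ e0.
by apply/nbhs_cdiscP; exists d => // w /Hd /He.
Qed.

Lemma real_continuous_atP (f : C -> R) z :
  {for z, continuous f} <->
  forall e, 0 < e -> exists2 d, 0 < d & forall w, cmod (w - z) < d -> `|f w - f z| < e.
Proof.
split.
  move=> cf e e0.
  have : nbhs (f z) [set w | `|w - f z| < e].
    by apply/nbhs_ballP; exists e => // w; rewrite -ball_normE /= distrC.
  by move=> /cf /nbhs_cdiscP [d d0 Hd]; exists d.
move=> H A /nbhs_ballP [e /= e0 He]; have [d d0 Hd] := H _ e0.
apply/nbhs_cdiscP; exists d => // w /Hd h; apply: He.
by rewrite -ball_normE /= distrC.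
Qed.

Lemma curve_continuous_atP (f : R -> C) (t : R) :
  {for t, continuous f} <->
  forall e, 0 < e -> exists2 d, 0 < d & forall s, `|s - t| < d -> cmod (f s - f t) < e.
Proof.
split.
  move=> cf e e0.
  have : nbhs (f t) [set w | cmod (w - f t) < e] by apply/nbhs_cdiscP; exists e.
  move=> /cf /nbhs_ballP [d /= d0 Hd]; exists d => // s st.
  by apply: Hd; rewrite -ball_normE /= distrC.
move=> H A /nbhs_cdiscP [e e0 He]; have [d d0 Hd] := H _ e0.
apply/nbhs_ballP; exists d => // w; rewrite -ball_normE /= distrC => h.
by apply/He/Hd.
Qed.

Lemma continuous_cmod z : {for z, continuous (@cmod R)}.
Proof.
apply/real_continuous_atP => e e0; exists e => // w.
exact: le_lt_trans (cmod_dist _ _).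
Qed.

Lemma continuous_cmod_comp (f : C -> C) z :
  {for z, continuous f} -> {for z, continuous (fun w => cmod (f w))}.
Proof. by move=> cf; apply: continuous_comp cf (@continuous_cmod _). Qed.

Definition cdisc (a : C) (r : R) : set C := [set z | cmod (z - a) < r].

Lemma cdisc_center a r : 0 < r -> cdisc a r a.
Proof. by rewrite /cdisc /= subrr cmod0. Qed.

Lemma cdisc_cdisc a r z : cdisc a r z ->
  exists2 s, 0 < s & forall w, cmod (w - z) <= s -> cdisc a r w.
Proof.
rewrite /cdisc /= => h; exists ((r - cmod (z - a)) / 2); first lra.
by move=> w hw; have := cmod_distD z w a; lra.
Qed.

Lemma cdisc_open a r : open (cdisc a r).
Proof.
rewrite openE => z /cdisc_cdisc [s s0 H]; apply/nbhs_cdiscP.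
by exists s => // w /ltW /H.
Qed.

Lemma open_cdiscP (U : set C) : open U <->
  forall z, U z -> exists2 r, 0 < r & forall w, cmod (w - z) < r -> U w.
Proof.
rewrite openE; split => H z /H; first by move/nbhs_cdiscP.
by move=> h; apply/nbhs_cdiscP.
Qed.

Lemma closed_cdisc a r : closed [set z : C | cmod (z - a) <= r].
Proof.
rewrite -openC; apply/open_cdiscP => z /= /negP; rewrite -ltNge => h.
exists (cmod (z - a) - r); first lra.
move=> w hw /=; apply/negP; rewrite -ltNge.
by have := cmod_distD w z a; rewrite (cmodB z w); lra.
Qed.

(** A bounded set lies in the image of a compact square of [R * R] under the continuous map [h]. *)
Lemma compact_bounded_closed (K : set C) (r : R) :
  closed K -> (forall z, K z -> cmod z <= r) -> compact K.
Proof.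
move=> clK bK.
pose h (p : R * R) : C := p.1 +i* p.2.
have ch : continuous h.
  move=> p A /nbhs_cdiscP [e e0 He].
  exists (ball p.1 (e/2), ball p.2 (e/2)); first by split; apply: nbhsx_ballx; lra.
  move=> q; rewrite -!ball_normE /= => -[h1 h2].
  apply: He; apply: le_lt_trans (cmod_leD _) _.
  rewrite /h /= distrC (distrC q.2).
  by rewrite (splitr e) ltrD.
apply: (@subclosed_compact _ _ (h @` (`[-r, r] `*` `[-r, r]))) => //.
  apply: continuous_compact; first exact: continuous_subspaceT.
  by apply: compact_setX; exact: segment_compact.
move=> z /bK zr; exists (Re z, Im z); last by case: z {zr}.
have := cmod_Re z; have := cmod_Im z; rewrite !ler_norml => h1 h2.
by split; rewrite /= in_itv /=; lra.
Qed.

Lemma compact_closed_cdisc (a : C) (r : R) : compact [set z : C | cmod (z - a) <= r].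
Proof.
apply: (@compact_bounded_closed _ (r + cmod a)); first exact: closed_cdisc.
by move=> z /=; have := cmod_distD a z 0; rewrite !subr0; lra.
Qed.

Lemma compact_max_cmod (K : set C) (f : C -> R) : compact K -> K !=set0 ->
  (forall z, K z -> {for z, continuous f}) ->
  exists2 c, K c & forall z, K z -> f z <= f c.
Proof.
move=> cK K0 cf.
have : {within K, continuous f}.
  apply: continuous_in_subspaceT => z; rewrite inE; exact: cf.
move=> /(compact_EVT_max K0 cK) [c cK' H].
exists c; first by move: cK'; rewrite inE.
by move=> z Kz; apply: H; rewrite inE.
Qed.

Lemma compact_min_cmod (K : set C) (f : C -> R) : compact K -> K !=set0 ->
  (forall z, K z -> {for z, continuous f}) ->
  exists2 c, K c & forall z, K z -> f c <= f z.
Proof.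
move=> cK K0 cf.
have [|c Kc H] := compact_max_cmod (f := \- f) cK K0.
  by move=> z Kz; apply: continuousN (cf _ Kz).
by exists c => // z /H /=; rewrite lerN2.
Qed.

Lemma cauchy_complex (u : nat -> C) :
  (forall e : R, 0 < e -> exists N, forall m n, (N <= m)%N -> (N <= n)%N -> cmod (u m - u n) < e) ->
  exists l, forall e : R, 0 < e -> exists N, forall n, (N <= n)%N -> cmod (u n - l) < e.
Proof.
move=> H.
have key (g : C -> R) : (forall z w, `|g z - g w| <= cmod (z - w)) ->
    exists l, forall e : R, 0 < e -> exists N, forall n, (N <= n)%N -> `|g (u n) - l| < e.
  move=> Hg.
  have : cvgn (g \o u).
    apply: cauchy_cvg.
    apply/cauchy_exP => e e0; have [N HN] := H _ e0.
    exists (g (u N)); exists N => // n /= Nn.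
    by rewrite -ball_normE /=; apply: le_lt_trans (Hg _ _) (HN _ _ _ _).
  move=> /cvg_ex [l /cvgrPdist_lt Hl]; exists l => e /Hl [N _ HN].
  by exists N => n /HN /=; rewrite distrC.
(* The term given to [key] says that [Re] is 1-Lipschitz; the next line does the same for [Im]. *)
have [a Ha] := key (@Re R) (fun z w => le_trans (eq_ind _ (fun x => `|x| <= cmod (z - w)) (cmod_Re (z - w)) _ (etrans (cReD _ _) (congr1 _ (cReN w)))) (lexx _)).
have [b Hb] := key (@Im R) (fun z w => le_trans (eq_ind _ (fun x => `|x| <= cmod (z - w)) (cmod_Im (z - w)) _ (etrans (cImD _ _) (congr1 _ (cImN w)))) (lexx _)).
exists (a +i* b) => e e0.
have [N1 H1] := Ha (e/2) ltac:(lra); have [N2 H2] := Hb (e/2) ltac:(lra).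
exists (maxn N1 N2) => n; rewrite geq_max => /andP [/H1 h1 /H2 h2].
apply: le_lt_trans (cmod_leD _) _.
rewrite cReD cReN cImD cImN /=; lra.
Qed.

End complex_modulus.

Section real_derivative.
Context {R : realType}.

(** The form without division matches [cderivP] below, so that real and complex first-order
    estimates can be compared directly. *)
Lemma is_derive_epsP (f : R -> R) (x l : R) :
  is_derive x 1 f l <->
  forall e, 0 < e -> exists2 d, 0 < d & forall y, `|y - x| < d ->
    `|f y - f x - l * (y - x)| <= e * `|y - x|.
Proof.
split.
  move=> [dfx fxl] e e0.
  have : (fun h => h^-1 *: (f (h *: 1 + x) - f x)) @ 0^' --> l.
    by rewrite -fxl; exact: dfx.
  move=> /cvgrPdist_le /(_ _ e0); rewrite /dnbhs near_withinE.
  move=> /nbhs_ballP [d /= d0 Hd]; exists d => // y yx.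
  have [->|yx0] := eqVneq y x; first by rewrite !subrr mulr0 subr0 normr0 mulr0.
  have h0 : y - x != 0 by rewrite subr_eq0.
  have := Hd (y - x); rewrite -ball_normE /= sub0r normrN => /(_ yx h0).
  rewrite -[(y - x)%:A]/((y - x) * 1) mulr1 subrK => H.
  have -> : f y - f x - l * (y - x) = - (l - (y - x)^-1 *: (f y - f x)) * (y - x).
    rewrite -[_ *: _]/(_ * _); field; exact: h0.
  by rewrite normrM normrN ler_wpM2r.
move=> H.
have Hc : (fun h => h^-1 *: (f (h *: 1 + x) - f x)) @ 0^' --> l.
  apply/cvgrPdist_le => e e0; rewrite /dnbhs near_withinE.
  have [d d0 Hd] := H _ e0.
  apply/nbhs_ballP; exists d => // h; rewrite -ball_normE /= sub0r normrN => hd h0.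
  have := Hd (h + x); rewrite addrK => /(_ hd) Hh.
  rewrite -[h%:A]/(h * 1) mulr1 -[_ *: _]/(_ * _).
  have -> : l - h^-1 * (f (h + x) - f x) = - (f (h + x) - f x - l * h) * h^-1.
    by field; exact: h0.
  by rewrite normrM normrN normfV ler_pdivrMr // normr_gt0.
split; first by apply/cvg_ex; exists l.
exact: (cvg_lim _ Hc).
Qed.

End real_derivative.

(** * Complex derivatives *)

Section complex_derivative.
Context {R : realType}.
Local Notation C := R[i].
Implicit Types (f g : C -> C) (z w l m : C).

Record ccont f z : Prop := CCont { ccont_eps : forall e, 0 < e ->
  exists2 d, 0 < d & forall w, cmod (w - z) < d -> cmod (f w - f z) < e }.

Lemma ccont_continuous f z : ccont f z <-> {for z, continuous f}.
Proof. by rewrite continuous_atP; split=> [[]|]. Qed.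

Lemma ccont_near f g z : ccont f z -> (\forall w \near z, f w = g w) -> ccont g z.
Proof.
move=> cf /nbhs_cdiscP [r r0 Hr]; split=> e e0.
have [d d0 Hd] := ccont_eps cf e0.
exists (Num.min d r); first by rewrite lt_min d0.
move=> w; rewrite lt_min => /andP [wd wr].
by rewrite -!Hr ?subrr ?cmod0 //; exact: Hd.
Qed.

Lemma ccont_cst c z : ccont (fun=> c) z.
Proof. by split=> e e0; exists 1 => // w _; rewrite subrr cmod0. Qed.

Lemma ccont_id z : ccont id z.
Proof. by split=> e e0; exists e. Qed.

Lemma ccontD f g z : ccont f z -> ccont g z -> ccont (fun w => f w + g w) z.
Proof.
move=> [cf] [cg]; split=> e e0.
have [d d0 Hd] := cf (e/2) ltac:(lra); have [r r0 Hr] := cg (e/2) ltac:(lra).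
exists (Num.min d r); first by rewrite lt_min d0.
move=> w; rewrite lt_min => /andP [/Hd h1 /Hr h2].
rewrite (_ : _ - _ = (f w - f z) + (g w - g z)); last by ring.
by apply: le_lt_trans (cmodD _ _) _; lra.
Qed.

Lemma ccontM f g z : ccont f z -> ccont g z -> ccont (fun w => f w * g w) z.
Proof.
move=> [cf] [cg]; split=> e e0.
pose K := cmod (f z) + cmod (g z) + 1.
have := cmod_ge0 (f z); have := cmod_ge0 (g z) => g0 f0.
have K0 : 0 < K by rewrite /K; lra.
have e1 : 0 < Num.min 1 (e / (2 * K)).
  by rewrite lt_min ltr01 divr_gt0 // mulr_gt0.
have [d d0 Hd] := cf _ e1; have [r r0 Hr] := cg _ e1.
exists (Num.min d r); first by rewrite lt_min d0.
move=> w; rewrite lt_min => /andP [/Hd h1 /Hr h2].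
rewrite (_ : _ - _ = (f w - f z) * (g w - g z) + (f z * (g w - g z) + (f w - f z) * g z)); last by ring.
have m1 : Num.min 1 (e / (2 * K)) <= 1 by rewrite ge_min lexx.
have m2 : Num.min 1 (e / (2 * K)) <= e / (2 * K) by rewrite ge_min lexx orbT.
apply: le_lt_trans (cmodD _ _) _.
apply: (@le_lt_trans _ _ (cmod (f w - f z) * K + K * cmod (g w - g z))).
  apply: (@le_trans _ _ (cmod ((f w - f z) * (g w - g z)) + (cmod (f z * (g w - g z)) + cmod ((f w - f z) * g z)))).
    by rewrite lerD2l cmodD.
  rewrite !cmodM /K; have := cmod_ge0 (f w - f z); have := cmod_ge0 (g w - g z); nra.
have h3 : cmod (f w - f z) * K < e / 2.
  rewrite -ltr_pdivlMr // -mulrA -invfM; exact: lt_le_trans h1 m2.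
have h4 : cmod (g w - g z) * K < e / 2.
  rewrite -ltr_pdivlMr // -mulrA -invfM; exact: lt_le_trans h2 m2.
by rewrite [K * _]mulrC; lra.
Qed.

Lemma ccontN f z : ccont f z -> ccont (fun w => - f w) z.
Proof.
move=> [cf]; split=> e /cf [d d0 Hd]; exists d => // w /Hd.
by rewrite -opprD cmodN.
Qed.

Lemma ccontB f g z : ccont f z -> ccont g z -> ccont (fun w => f w - g w) z.
Proof. by move=> cf cg; apply: ccontD => //; exact: ccontN. Qed.

Lemma ccont_comp f g z : ccont g z -> ccont f (g z) -> ccont (fun w => f (g w)) z.
Proof.
move=> [cg] [cf]; split=> e /cf [d /cg [r r0 Hr] Hd].
by exists r => // w /Hr /Hd.
Qed.

Lemma ccont_neq0 f z : ccont f z -> f z != 0 -> \forall w \near z, f w != 0.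
Proof.
move=> [cf] fz; have [d d0 Hd] := cf _ (etrans (cmod_gt0 _) fz).
apply/nbhs_cdiscP; exists d => // w /Hd; apply: contraTneq => ->.
by rewrite sub0r cmodN ltxx.
Qed.

Lemma ccontV z : z != 0 -> ccont (fun w => w^-1) z.
Proof.
move=> z0; have zp : 0 < cmod z by rewrite cmod_gt0.
split=> e e0; exists (Num.min (cmod z / 2) (e * cmod z ^+ 2 / 2)).
  by rewrite lt_min !divr_gt0 // mulr_gt0 // exprn_gt0.
move=> w; rewrite lt_min => /andP [h1 h2].
have wp : cmod z / 2 < cmod w by have := cmod_subl z w; rewrite cmodB; lra.
have w0 : w != 0 by rewrite -cmod_gt0; apply: lt_trans wp; rewrite divr_gt0.
have -> : w^-1 - z^-1 = (z - w) / (w * z) by field; rewrite w0 z0.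
rewrite cmodM cmodV cmodM cmodB ltr_pdivrMr ?mulr_gt0 ?cmod_gt0 //.
apply: (lt_trans h2); rewrite expr2 -!mulrA ltr_pM2l //; nra.
Qed.

Lemma cdisc_open_near a r z : cdisc a r z -> \forall w \near z, cdisc a r w.
Proof. by move=> h; apply: open_nbhs_nbhs; split => //; exact: cdisc_open. Qed.

(** Carathéodory's form of differentiability: the difference quotient, completed by [l] at [z], is
    continuous there. The product and chain rules then reduce to algebraic identities. *)
Definition quot f z l w : C := if w == z then l else (f w - f z) / (w - z).
Record cderiv f z l : Prop := CDeriv { cderiv_quot : ccont (quot f z l) z }.
Variant holo f z : Prop := Holo l of cderiv f z l.

Lemma quot_center f z l : quot f z l z = l. Proof. by rewrite /quot eqxx. Qed.

Lemma quotE f z l w : f w = f z + quot f z l w * (w - z).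
Proof.
rewrite /quot; case: eqVneq => [->|wz]; first by rewrite subrr mulr0 addr0.
by rewrite divfK ?subr_eq0 // addrC subrK.
Qed.

(** Any continuous [q] that factors the increment near [z] is the difference quotient; each rule
    below only has to exhibit one. *)
Lemma cderivI (q : C -> C) f z l : q z = l -> ccont q z ->
  (\forall w \near z, f w = f z + q w * (w - z)) -> cderiv f z l.
Proof.
move=> <- cq H; split; apply: (ccont_near cq).
near=> w; rewrite /quot; case: eqVneq => [->//|wz].
have -> : f w = f z + q w * (w - z) by near: w.
by rewrite addrAC subrr add0r mulfK // subr_eq0.
Unshelve. all: by end_near. Qed.

Lemma cderiv_ccont f z l : cderiv f z l -> ccont f z.
Proof.
move=> [cf].
have -> : f = (fun w => f z + quot f z l w * (w - z)) by apply/funext => w; exact: quotE.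
apply: ccontD; first exact: ccont_cst.
apply: ccontM => //; apply: ccontB; [exact: ccont_id|exact: ccont_cst].
Qed.

Lemma holo_ccont f z : holo f z -> ccont f z.
Proof. by move=> [l /cderiv_ccont]. Qed.

Lemma cderiv_near f g z l : cderiv f z l -> (\forall w \near z, f w = g w) -> cderiv g z l.
Proof.
move=> [cf] H; apply: (cderivI (quot_center f z l)) => //.
have gz := nbhs_singleton H; near=> w.
have <- : f w = g w by near: w.
by rewrite -gz -quotE.
Unshelve. all: by end_near. Qed.

Lemma holo_near f g z : holo f z -> (\forall w \near z, f w = g w) -> holo g z.
Proof. by move=> [l H] fg; exists l; exact: cderiv_near H fg. Qed.

Lemma cderivP f z l : cderiv f z l <->
  forall e, 0 < e -> exists2 d, 0 < d & forall w, cmod (w - z) < d ->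
    cmod (f w - f z - l * (w - z)) <= e * cmod (w - z).
Proof.
split=> [[[cf]] e e0|H].
  have [d d0 Hd] := cf _ e0; exists d => // w /Hd; rewrite quot_center => h.
  rewrite [in X in cmod X](quotE f z l w).
  have -> : f z + quot f z l w * (w - z) - f z - l * (w - z) =
     (quot f z l w - l) * (w - z) by ring.
  by rewrite cmodM ler_wpM2r ?cmod_ge0 // ltW.
split; split=> e e0; have [d d0 Hd] := H (e/2) ltac:(lra).
exists d => // w wd; rewrite quot_center.
have [->|wz] := eqVneq w z; first by rewrite quot_center subrr cmod0.
have h0 : w - z != 0 by rewrite subr_eq0.
have -> : quot f z l w - l = (f w - f z - l * (w - z)) / (w - z).
  by rewrite /quot (negbTE wz); field.
rewrite cmodM cmodV ltr_pdivrMr ?cmod_gt0 //.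
apply: le_lt_trans (Hd _ wd) _; rewrite ltr_pM2r ?cmod_gt0 //; lra.
Qed.

Lemma cderiv_cst c z : cderiv (fun=> c) z 0.
Proof.
apply: (@cderivI (fun=> 0)) => //; first exact: ccont_cst.
by near=> w; rewrite mul0r addr0.
Unshelve. all: by end_near. Qed.

Lemma cderiv_id z : cderiv id z 1.
Proof.
apply: (@cderivI (fun=> 1)) => //; first exact: ccont_cst.
by near=> w; rewrite mul1r addrC subrK.
Unshelve. all: by end_near. Qed.

Lemma cderivD f g z l m : cderiv f z l -> cderiv g z m -> cderiv (fun w => f w + g w) z (l + m).
Proof.
move=> cf cg; have [qf] := cf; have [qg] := cg; apply: (@cderivI (fun w => quot f z l w + quot g z m w)); [by rewrite !quot_center|exact: ccontD|].
by near=> w; rewrite {1}(quotE f z l w) {1}(quotE g z m w); ring.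
Unshelve. all: by end_near. Qed.

Lemma cderivM f g z l m : cderiv f z l -> cderiv g z m ->
  cderiv (fun w => f w * g w) z (l * g z + f z * m).
Proof.
move=> cf cg; have [qf] := cf; have [qg] := cg; apply: (@cderivI (fun w => quot f z l w * g w + f z * quot g z m w)); first by rewrite !quot_center.
  apply: ccontD; apply: ccontM => //; last exact: ccont_cst.
  exact: cderiv_ccont cg.
by near=> w; rewrite {1}(quotE f z l w) {1 2}(quotE g z m w); ring.
Unshelve. all: by end_near. Qed.

Lemma cderiv_comp f g z l m : cderiv g z m -> cderiv f (g z) l ->
  cderiv (fun w => f (g w)) z (l * m).
Proof.
move=> cg cf; have [qf] := cf; have [qg] := cg; apply: (@cderivI (fun w => quot f (g z) l (g w) * quot g z m w)); first by rewrite !quot_center.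
  apply: ccontM => //.
  by apply: ccont_comp => //; exact: cderiv_ccont cg.
near=> w; rewrite {1}(quotE f (g z) l (g w)) -mulrA; congr (_ + _ * _).
by rewrite {1}(quotE g z m w); ring.
Unshelve. all: by end_near. Qed.

Lemma cderivV z : z != 0 -> cderiv (fun w => w^-1) z (- z^-2).
Proof.
move=> z0; apply: (@cderivI (fun w => - (w^-1 * z^-1))); first by rewrite expr2 invfM.
  by apply: ccontN; apply: ccontM; [exact: ccontV|exact: ccont_cst].
apply/nbhs_cdiscP; exists (cmod z); first by rewrite cmod_gt0.
move=> w wz; have w0 : w != 0.
  by apply: contraTneq wz => ->; rewrite sub0r cmodN ltxx.
by field; rewrite z0 w0.
Qed.

Lemma cderivZ c f z l : cderiv f z l -> cderiv (fun w => c * f w) z (c * l).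
Proof. by move=> /(cderivM (cderiv_cst c z)); rewrite mul0r add0r. Qed.
Lemma cderivB f g z l m : cderiv f z l -> cderiv g z m -> cderiv (fun w => f w - g w) z (l - m).
Proof.
move=> cf /(cderivZ (-1)) /(cderivD cf); rewrite mulN1r => h.
by apply: cderiv_near h _; near=> w; rewrite mulN1r.
Unshelve. all: by end_near. Qed.

Lemma holo_cst c z : holo (fun=> c) z.
Proof. by exists 0; exact: cderiv_cst. Qed.
Lemma holo_id z : holo id z.
Proof. by exists 1; exact: cderiv_id. Qed.
Lemma holoD f g z : holo f z -> holo g z -> holo (fun w => f w + g w) z.
Proof. by move=> [l Hl] [m Hm]; exists (l + m); exact: cderivD. Qed.
Lemma holoM f g z : holo f z -> holo g z -> holo (fun w => f w * g w) z.
Proof. by move=> [l Hl] [m Hm]; exists (l * g z + f z * m); exact: cderivM. Qed.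
Lemma holo_comp f g z : holo g z -> holo f (g z) -> holo (fun w => f (g w)) z.
Proof. by move=> [l Hl] [m Hm]; exists (m * l); exact: cderiv_comp. Qed.
Lemma holoV f z : holo f z -> f z != 0 -> holo (fun w => (f w)^-1) z.
Proof.
move=> hf fz; apply: (@holo_comp (fun w => w^-1)) => //.
by exists (- (f z)^-2); exact: cderivV.
Qed.
Lemma holoZ c f z : holo f z -> holo (fun w => c * f w) z.
Proof. by apply: holoM; exact: holo_cst. Qed.
Lemma holoN f z : holo f z -> holo (fun w => - f w) z.
Proof.
by move=> /(holoZ (-1)) h; apply: holo_near h _; near=> w; rewrite mulN1r.
Unshelve. all: by end_near. Qed.
Lemma holoB f g z : holo f z -> holo g z -> holo (fun w => f w - g w) z.
Proof. by move=> hf hg; apply: holoD => //; exact: holoN. Qed.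
Lemma holoX f n z : holo f z -> holo (fun w => f w ^+ n) z.
Proof.
move=> hf; elim: n => [|n IH]; first exact: (holo_cst 1).
by apply: holo_near (holoM hf IH) _; near=> w; rewrite exprS.
Unshelve. all: by end_near. Qed.
Lemma holo_iter f n z : (forall w, holo f w) -> holo (iter n f) z.
Proof.
move=> hf; elim: n => [|n IH]; first exact: holo_id.
by apply: (@holo_comp f (iter n f)).
Qed.

Lemma entire_holo f z : entire f -> holo f z.
Proof.
move=> /(_ z) /cvg_ex [l Hl]; exists l; apply/cderivP => e e0.
have e0' : 0 < e%:C by rewrite ltcR.
move: Hl => /cvgrPdist_le /(_ _ e0'); rewrite /dnbhs near_withinE.
move=> /nbhs_cdiscP [d d0 Hd]; exists d => // w wz.
have [->|wz0] := eqVneq w z; first by rewrite !subrr mulr0 subr0 cmod0 mulr0.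
have h0 : w - z != 0 by rewrite subr_eq0.
have := Hd (w - z); rewrite subr0 => /(_ wz h0).
rewrite /= -[(w - z)%:A]/((w - z) * 1) mulr1 subrK normE lecR => H.
have -> : f w - f z - l * (w - z) = - (l - (w - z)^-1 *: (f w - f z)) * (w - z).
  by rewrite -[_ *: _]/(_ * _); field.
by rewrite cmodM cmodN ler_wpM2r ?cmod_ge0.
Qed.

(** Projection makes the real mean value theorem available on a segment; the factor [c] selects the
    direction of projection. *)
Lemma is_derive_Re_path f (p v c l : C) (t : R) : cderiv f (p + t%:C * v) l ->
  is_derive t 1 (fun s : R => Re (c * f (p + s%:C * v))) (Re (c * (l * v))).
Proof.
move=> /cderivP H; apply/is_derive_epsP => e e0.
pose K := cmod c * cmod v + 1.
have K0 : 0 < K by rewrite ltr_wpDl // mulr_ge0 ?cmod_ge0.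
have [d d0 Hd] := H (e / K) ltac:(exact: divr_gt0).
pose k := cmod v + 1.
have k0 : 0 < k by rewrite ltr_wpDl // cmod_ge0.
exists (d / k); first exact: divr_gt0.
move=> s; rewrite ltr_pdivlMr // => hs.
pose z := p + t%:C * v; pose w := p + s%:C * v.
have wz : w - z = (s - t)%:C * v by rewrite /w /z rmorphB /=; ring.
have cwz : cmod (w - z) = `|s - t| * cmod v by rewrite wz cmodM cmodR.
have h1 : cmod (w - z) < d.
  by rewrite cwz; apply: le_lt_trans hs; rewrite ler_wpM2l // lerDl.
have := Hd _ h1; rewrite cwz => h2.
have -> : Re (c * f (p + s%:C * v)) - Re (c * f (p + t%:C * v)) - Re (c * (l * v)) * (s - t)
   = Re (c * (f w - f z - l * (w - z))).
  rewrite wz -/w -/z.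
  have -> : Re (c * (l * v)) * (s - t) = Re (c * (l * ((s - t)%:C * v))).
    have -> : c * (l * ((s - t)%:C * v)) = (c * (l * v)) * (s - t)%:C by ring.
    by rewrite cReMr.
  by rewrite -!cReN -!cReD; congr (Re _); ring.
apply: le_trans (cmod_Re _) _; rewrite cmodM.
apply: (le_trans (ler_wpM2l (cmod_ge0 _) h2)).
have -> : cmod c * (e / K * (`|s - t| * cmod v)) =
   e * `|s - t| * ((cmod c * cmod v) / K) by ring.
have h3 : cmod c * cmod v / K <= 1 by rewrite ler_pdivrMr // mul1r /K lerDl.
by rewrite -[leRHS]mulr1 ler_wpM2l // mulr_ge0 // ltW.
Qed.

(** The increment is projected on its own direction: with [c] its conjugate, the real increment of
    [h] is the square of its modulus, and the real mean value theorem applies. *)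
Lemma mean_value_le f (p q : C) (K : R) (df : C -> C) :
  (forall t, 0 <= t <= 1 -> cderiv f (p + t%:C * (q - p)) (df (p + t%:C * (q - p)))) ->
  (forall t, 0 <= t <= 1 -> cmod (df (p + t%:C * (q - p))) <= K) ->
  cmod (f q - f p) <= K * cmod (q - p).
Proof.
move=> Hd HK.
have [->|fqp] := eqVneq (f q - f p) 0.
  rewrite cmod0 mulr_ge0 ?cmod_ge0 //; apply: le_trans (HK 0 _); last by rewrite lexx ler01.
  exact: cmod_ge0.
pose c := (f q - f p)^*.
have cc : cmod c = cmod (f q - f p).
  have := normcJ (f q - f p); rewrite !normE => /eqP.
  by rewrite (inj_eq (@complexI _)) => /eqP.
pose h (s : R) := Re (c * f (p + s%:C * (q - p))).
pose dh (s : R) := Re (c * (df (p + s%:C * (q - p)) * (q - p))).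
have hd (t : R) : 0 <= t <= 1 -> is_derive t 1 h (dh t).
  by move=> /Hd /(is_derive_Re_path c).
have [|s|s|x] := @MVT R h dh 0 1; first exact: ltr01.
- by rewrite in_itv /= => /andP [s0 s1]; apply: hd; rewrite !ltW.
- apply: continuous_in_subspaceT => t; rewrite inE /= in_itv /= => /hd [hs _].
  exact/differentiable_continuous/derivable1_diffP.
rewrite in_itv /= => /andP [x0 x1].
have -> : h 1 - h 0 = cmod (f q - f p) ^+ 2.
  rewrite /h rmorph1 rmorph0 mul1r mul0r addr0 [p + _]addrC subrK.
  rewrite -cReN -cReD -mulrBr /c mulrC.
  have := sqr_normc (f q - f p); rewrite normE -rmorphXn /= => <- //.
rewrite subr0 mulr1 /dh => E.
have : cmod (f q - f p) ^+ 2 <= cmod (f q - f p) * (K * cmod (q - p)).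
  rewrite E; apply: le_trans (ler_norm _) _; apply: le_trans (cmod_Re _) _.
  rewrite !cmodM cc ler_wpM2l ?cmod_ge0 // ler_wpM2r ?cmod_ge0 //.
  by apply: HK; rewrite !ltW.
by rewrite expr2 ler_pM2l // cmod_gt0.
Qed.

End complex_derivative.

(** * The complex exponential and the choice of logarithms *)

Section exponential.
Context {R : realType}.
Local Notation C := R[i].
Implicit Types (z w : C).

Definition cexp z : C := (expR (Re z))%:C * (cos (Im z) +i* sin (Im z)).

Lemma cexpD z w : cexp (z + w) = cexp z * cexp w.
Proof.
rewrite /cexp cReD cImD expRD cosD sinD; apply/eqP.
by rewrite eq_complex /=; apply/andP; split; apply/eqP; ring.
Qed.

Lemma cmod_cis (t : R) : cmod (cos t +i* sin t) = 1.
Proof. by rewrite /cmod /= cos2Dsin2 sqrtr1. Qed.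

Lemma cmod_cexp z : cmod (cexp z) = expR (Re z).
Proof. by rewrite cmodM cmod_cis mulr1 cmodR ger0_norm // expR_ge0. Qed.

Lemma cexp_neq0 z : cexp z != 0.
Proof. by rewrite -cmod_gt0 cmod_cexp expR_gt0. Qed.

Lemma cexp0 : cexp 0 = 1.
Proof. by rewrite /cexp /= expR0 cos0 sin0 mul1r. Qed.

Lemma cexpN z : cexp (- z) = (cexp z)^-1.
Proof.
by apply: (mulfI (cexp_neq0 z)); rewrite -cexpD subrr cexp0 divff ?cexp_neq0.
Qed.

Lemma cexp_2pi z : cexp (z + 'i * (2 * pi)%:C) = cexp z.
Proof.
rewrite /cexp cReD cImD [_ * (2 * pi)%:C]mulrC [_ * 'i]mulrC cReMr cImMr /= mul0r mul1r addr0.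
have e2 : 2 * pi = pi *+ 2 :> R by rewrite mulr_natl.
by rewrite e2 cosD2pi sinD2pi mulrC.
Qed.

Lemma cderiv_cexp0 : cderiv cexp 0 1.
Proof.
apply/cderivP => e e0.
(* The errors in [R1] and [R2] add up to at most [7 * e1 * cmod h]; the bound [1 / 4] keeps [expR x]
   below 2. *)
have [e1 [e10 e18 e14]] : exists e1, [/\ 0 < e1, e1 <= e / 8 & e1 <= 1 / 4].
  exists (Num.min (e / 8) (1 / 4)); rewrite lt_min !ge_min !lexx orbT; split=> //.
  by apply/andP; split; lra.
have /is_derive_epsP/(_ _ e10) [d1 d10 H1] := is_derive_expR (0 : R).
have /is_derive_epsP/(_ _ e10) [d2 d20 H2] := is_derive_cos (0 : R).
have /is_derive_epsP/(_ _ e10) [d3 d30 H3] := is_derive_sin (0 : R).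
exists (Num.min (Num.min d1 d2) (Num.min d3 e1)).
  by rewrite !lt_min d10 d20 d30 e10.
move=> h; rewrite subr0 !lt_min => /andP [/andP [h1 h2] /andP [h3 h5]].
have hx := cmod_Re h; have hy := cmod_Im h.
have := H1 (Re h); have := H2 (Im h); have := H3 (Im h).
rewrite !subr0 expR0 cos0 sin0 oppr0 !mul0r !subr0 !mul1r.
move=> /(_ (le_lt_trans hy h3)) S3 /(_ (le_lt_trans hy h2)) S2 /(_ (le_lt_trans hx h1)) S1.
rewrite cexp0; set x := Re h in S1 hx *; set y := Im h in S2 S3 hy *.
have x1 : `|x| <= e1 by exact: ltW (le_lt_trans hx h5).
have y0 := normr_ge0 y; have x0 := normr_ge0 x.
have E1 : `|expR x - 1| <= 2 * `|x|.
  rewrite (_ : expR x - 1 = (expR x - 1 - x) + x); last by ring.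
  apply: le_trans (ler_normD _ _) _; have := ler_wpM2r x0 e14; have := S1; have := x0; clear; lra.
have E2 : `|expR x| <= 2.
  rewrite (_ : expR x = (expR x - 1) + 1); last by ring.
  by apply: le_trans (ler_normD _ _) _; rewrite normr1; move: E1 x1 e14; clear; lra.
have Rc : Re (cexp h) = expR x * cos y by rewrite /cexp mulrC cReMr mulrC.
have Ic : Im (cexp h) = expR x * sin y by rewrite /cexp mulrC cImMr mulrC.
have R1 : `|Re (cexp h - 1 - h)| <= e1 * `|x| + 2 * e1 * `|y|.
  rewrite !cReD !cReN Rc -/x /=.
  rewrite (_ : _ - _ - _ = (expR x - 1 - x) + expR x * (cos y - 1)); last by ring.
  apply: le_trans (ler_normD _ _) _; rewrite normrM.
  by apply: lerD => //; rewrite -mulrA; exact: ler_pM.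
have R2 : `|Im (cexp h - 1 - h)| <= 4 * e1 * `|y|.
  rewrite !cImD !cImN Ic -/y /= oppr0 addr0.
  rewrite (_ : _ - _ = expR x * (sin y - y) + (expR x - 1) * y); last by ring.
  apply: le_trans (ler_normD _ _) _; rewrite !normrM.
  apply: (@le_trans _ _ (2 * (e1 * `|y|) + 2 * `|x| * `|y|)); last first.
    by have := ler_wpM2r y0 x1; clear; lra.
  by apply: lerD; apply: ler_pM => //; move: S3; rewrite addr0.
apply: le_trans (cmod_leD _) (le_trans (lerD R1 R2) _).
have := mulr_ge0 (ltW e0) (cmod_ge0 h); have := ler_wpM2r (cmod_ge0 h) e18.
have := ler_wpM2l (ltW e10) hx; have := ler_wpM2l (ltW e10) hy; clear; lra.
Qed.

Lemma cderiv_cexp z : cderiv cexp z (cexp z).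
Proof.
apply/cderivP => e e0; have K0 : 0 < expR (Re z) := expR_gt0 _.
have /cderivP/(_ (e / expR (Re z))) := cderiv_cexp0.
case; first exact: divr_gt0.
move=> d d0 Hd; exists d => // w wz; have := Hd (w - z); rewrite !subr0 => /(_ wz).
have cw : cexp w = cexp z * cexp (w - z) by rewrite -cexpD addrC subrK.
rewrite cexp0 mul1r cw.
rewrite (_ : cexp z * _ - _ - _ = cexp z * (cexp (w - z) - 1 - (w - z))); last by ring.
rewrite cmodM cmod_cexp => h; rewrite mulrC -ler_pdivlMr //.
by rewrite mulrAC.
Qed.

Lemma holo_cexp z : holo cexp z.
Proof. by exists (cexp z); exact: cderiv_cexp. Qed.

Lemma cexp_surj_pi w : w != 0 -> exists2 z, cexp z = w & `|Im z| <= pi.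
Proof.
move=> w0; have wp : 0 < cmod w by rewrite cmod_gt0.
pose x := Re w / cmod w; pose y := Im w / cmod w.
have xy : x ^+ 2 + y ^+ 2 = 1.
  by rewrite /x /y !exprMn -mulrDl -cmod_sqr exprVn divff // expf_neq0 // gt_eqF.
have wE : w = (cmod w)%:C * (x +i* y).
  rewrite mulrC; apply/eqP; rewrite eq_complex cReMr cImMr /= /x /y.
  by rewrite !divfK ?eqxx // gt_eqF.
have x1 : -1 <= x <= 1 by nra.
pose t := if 0 <= y then acos x else - acos x.
have ct : cos t = x by rewrite /t; case: ifP => _; rewrite ?cosN acosK // in_itv.
have st : sin t = y.
  have hs : sin (acos x) = `|y|.
    by rewrite sin_acos // -sqrtr_sqr; congr Num.sqrt; lra.
  rewrite /t; case: ifPn => [y0|]; rewrite ?sinN hs; first by rewrite ger0_norm.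
  by rewrite -ltNge => y0; rewrite ltr0_norm // opprK.
exists (ln (cmod w) +i* t).
  by rewrite {2}wE /cexp /= lnK ?posrE // ct st.
have := acos_ge0 x1; have := acos_lepi x1.
by rewrite /= /t; case: ifP => _ h1 h2; rewrite ?normrN ger0_norm.
Qed.

(** Rotating [w] by the angle [- s] reduces this to [s = 0]; it selects the logarithm that is
    closest to a prescribed one. *)
Lemma cexp_surj_near w (s : R) : w != 0 -> exists2 z, cexp z = w & `|Im z - s| <= pi.
Proof.
move=> w0; have h : w * cexp (- ('i * s%:C)) != 0 by rewrite mulf_neq0 ?cexp_neq0.
have [z zE zpi] := cexp_surj_pi h; exists (z + 'i * s%:C).
  by rewrite cexpD zE -mulrA -cexpD addNr cexp0 mulr1.
by rewrite cImD cImMr /= mul1r addrK.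
Qed.

(** The strict bound [pi / 2] matters: a combination of four such logarithms has imaginary part
    below [2 * pi], which is what the winding number needs. *)
Lemma cexp_surj_right w : 0 < Re w -> exists2 z, cexp z = w & `|Im z| < pi / 2.
Proof.
move=> rw; have wp : 0 < cmod w.
  by apply: lt_le_trans rw _; apply: le_trans (ler_norm _) (cmod_Re _).
pose x := Re w / cmod w; pose y := Im w / cmod w.
have xy : x ^+ 2 + y ^+ 2 = 1.
  by rewrite /x /y !exprMn -mulrDl -cmod_sqr exprVn divff // expf_neq0 // gt_eqF.
have wE : w = (cmod w)%:C * (x +i* y).
  rewrite mulrC; apply/eqP; rewrite eq_complex cReMr cImMr /= /x /y.
  by rewrite !divfK ?eqxx // gt_eqF.
have x0 : 0 < x by exact: divr_gt0.
have y1 : -1 < y < 1 by nra.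
have y1' : -1 <= y <= 1 by lra.
exists (ln (cmod w) +i* asin y).
  rewrite {2}wE /cexp /= lnK ?posrE // asinK ?in_itv // cos_asin //.
  congr (_ * (_ +i* _)); rewrite -[RHS]ger0_norm ?ltW // -sqrtr_sqr; congr Num.sqrt; lra.
rewrite /= ltr_norml asin_gtNpi2 ?asin_ltpi2 //; lra.
Qed.

(** Otherwise half of [|Im z|] has a positive sine, and the double-angle formula makes the cosine of
    [Im z] less than 1. *)
Lemma cexp_eq1 z : cexp z = 1 -> `|Im z| < 2 * pi -> z = 0.
Proof.
move=> z1 hz; have r0 : Re z = 0.
  by apply: expR_inj; rewrite expR0 -cmod_cexp z1 cmod1.
move: z1; rewrite /cexp r0 expR0 mul1r => -[c1 _].
apply/eqP; rewrite eq_complex r0 eqxx /=; apply/negPn/negP => i0.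
have h : `|Im z| / 2 \in `]0, pi[ by rewrite in_itv /= divr_gt0 ?normr_gt0 //=; lra.
have /sin_gt0_pi s0 : 0 < `|Im z| / 2 < pi by move: h; rewrite in_itv.
have := cos_mulr2n (`|Im z| / 2); rewrite -[_ *+ 2]mulr_natr divfK ?pnatr_eq0 //.
rewrite cos_norm c1 cos2sin2; have := s0; nra.
Qed.

End exponential.

(** * Goursat's theorem *)

Section bisection.
Context {R : realType}.
Local Notation C := R[i].

Lemma half_geometric_small (K : R) : 0 <= K -> forall e, 0 < e ->
  exists N, forall n, (N <= n)%N -> K / 2 ^+ n < e.
Proof.
move=> K0 e e0; have h : 0 <= K / e by rewrite divr_ge0 // ltW.
exists (Num.bound (K / e)) => n Nn.
rewrite ltr_pdivrMr ?exprn_gt0 // mulrC -ltr_pdivrMr //.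
apply: lt_le_trans (archi_boundP h) _; rewrite -natrX ler_nat.
exact: leq_trans Nn (ltnW (ltn_expl _ _)).
Qed.

(** A failing piece has a failing half, so that failures shrink to a point [z], where the local
    hypothesis excludes them. [pt] locates a piece and [rad] bounds its size. The local hypothesis
    receives [z] as a limit of pieces, so that [z] can be placed in a closed set. *)
Lemma nested_bisection (S : Type) (Q Inv : S -> Prop) (pt : S -> C) (rad : S -> R) (s0 : S) :
  Inv s0 -> (forall s, 0 <= rad s) ->
  (forall s, Inv s -> ~ Q s -> exists s', [/\ Inv s', ~ Q s', rad s' <= rad s / 2 &
     cmod (pt s' - pt s) <= rad s]) ->
  (forall z, (forall e, 0 < e -> exists2 s, Inv s & cmod (pt s - z) < e) ->
    exists2 e, 0 < e & forall s, Inv s -> cmod (pt s - z) <= 2 * rad s -> rad s < e -> Q s) ->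
  Q s0.
Proof.
move=> I0 rad0 step loc; apply: contrapT => nQ0.
pose T := {s | Inv s /\ ~ Q s}.
have next (t : T) : {t' : T | rad (sval t') <= rad (sval t) / 2 /\
    cmod (pt (sval t') - pt (sval t)) <= rad (sval t)}.
  apply: cid; case: t => s [Is nQs] /=.
  by have [s' [h1 h2 h3 h4]] := step _ Is nQs; exists (exist _ s' (conj h1 h2)).
pose u n := iter n (fun t => sval (next t)) (exist _ s0 (conj I0 nQ0)).
pose v n := sval (u n).
have v_inv n : Inv (v n) by have := proj2_sig (u n); tauto.
have v_nQ n : ~ Q (v n) by have := proj2_sig (u n); tauto.
have vS n : rad (v n.+1) <= rad (v n) / 2 /\ cmod (pt (v n.+1) - pt (v n)) <= rad (v n).
  exact: (svalP (next (u n))).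
have rad_le n : rad (v n) <= rad (v 0%N) / 2 ^+ n.
  elim: n => [|n IH]; first by rewrite expr0 divr1.
  have [h _] := vS n; apply: le_trans h _.
  by rewrite exprSr invfM mulrA ler_pM2r // invr_gt0.
(* As each radius is at most half of the preceding one, a displacement by [rad (v n)] is at most
   twice the decrease of the radius, and these decreases telescope. *)
have dist n m : cmod (pt (v (n + m)%N) - pt (v n)) <= 2 * (rad (v n) - rad (v (n + m)%N)).
  elim: m => [|m IH]; first by rewrite addn0 !subrr cmod0 mulr0.
  rewrite addnS; have [h1 h2] := vS (n + m)%N.
  by have := cmod_distD (pt (v (n + m)%N)) (pt (v (n + m).+1)) (pt (v n)); lra.
have rad_small e : 0 < e -> exists N, forall n, (N <= n)%N -> rad (v n) < e.
  move=> /(half_geometric_small (rad0 (v 0%N))) [N HN]; exists N => n /HN.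
  exact: le_lt_trans.
have v_anti n m : rad (v (n + m)%N) <= rad (v n).
  elim: m => [|m IH]; first by rewrite addn0.
  by rewrite addnS; have [h _] := vS (n + m)%N; have := rad0 (v (n + m)%N); lra.
have [z Hz] : exists z, forall e, 0 < e -> exists N, forall n, (N <= n)%N -> cmod (pt (v n) - z) < e.
  apply: cauchy_complex => e e0; have [N HN] := rad_small (e / 4) ltac:(lra).
  have H k : (N <= k)%N -> cmod (pt (v k) - pt (v N)) < e / 2.
    move=> /subnKC <-; apply: le_lt_trans (dist _ _) _.
    have := HN N (leqnn N); have := rad0 (v (N + (k - N))%N); lra.
  exists N => m n /H hm /H hn; have := cmod_distD (pt (v N)) (pt (v m)) (pt (v n)).
  by rewrite (cmodB (pt (v N))); lra.
have dz n : cmod (pt (v n) - z) <= 2 * rad (v n).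
  apply/ler_addgt0Pr => e /Hz [N HN].
  have := HN (n + N)%N (leq_addl _ _); have := dist n N.
  have := cmod_distD (pt (v (n + N)%N)) (pt (v n)) z.
  by rewrite (cmodB (pt (v n)) (pt (v (n + N)%N))); have := rad0 (v (n + N)%N); lra.
have [|e e0 He] := loc z.
  by move=> e /Hz [N HN]; exists (v N) => //; exact: HN.
have [N HN] := rad_small e e0.
by apply: (v_nQ N); apply: He => //; exact: HN.
Qed.

End bisection.

(** * Integrals along segments, Goursat's theorem and primitives *)

Section line_integral.
Context {R : realType}.
Local Notation C := R[i].
Implicit Types (f : C -> C) (p q z w : C) (S : set C).

Definition midp p q : C := (p + q) / 2.
Definition onseg p q z := exists2 t : R, 0 <= t <= 1 & z = p + t%:C * (q - p).

Lemma onseg_left p q : onseg p q p.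
Proof. by exists 0; [rewrite lexx ler01 | rewrite mul0r addr0]. Qed.

Lemma onseg_right p q : onseg p q q.
Proof. by exists 1; [rewrite lexx ler01 | rewrite mul1r addrC subrK]. Qed.

Lemma onseg_midp p q : onseg p q (midp p q).
Proof. by exists 2^-1; [lra | rewrite /midp fmorphV rmorph_nat; field]. Qed.

Lemma onseg_sym p q z : onseg p q z -> onseg q p z.
Proof.
by move=> [t t01 ->]; exists (1 - t); [lra | rewrite rmorphB rmorph1; ring].
Qed.

Lemma onseg_half p q z : onseg p (midp p q) z -> onseg p q z.
Proof.
move=> [t t01 ->]; exists (t / 2); first lra.
by rewrite /midp rmorphM fmorphV rmorph_nat; field.
Qed.

Lemma onseg_half' p q z : onseg (midp p q) q z -> onseg p q z.
Proof.
move=> [t t01 ->]; exists ((1 + t) / 2); first lra.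
by rewrite /midp rmorphM rmorphD rmorph1 fmorphV rmorph_nat; field.
Qed.

Lemma onseg_dist p q z : onseg p q z -> cmod (z - p) <= cmod (q - p).
Proof.
move=> [t /andP [t0 t1] ->]; rewrite addrAC subrr add0r cmodM cmodR ger0_norm //.
by rewrite ler_piMl ?cmod_ge0.
Qed.

Lemma cmod2 : cmod (2 : C) = 2.
Proof. by rewrite -[2 in LHS](rmorph_nat (@real_complex R)) cmodR ger0_norm. Qed.

Lemma midp_subl p q : cmod (midp p q - p) = cmod (q - p) / 2.
Proof.
rewrite (_ : midp p q - p = (q - p) / 2); first by rewrite cmodM cmodV cmod2.
by rewrite /midp; field.
Qed.

Lemma midp_subr p q : cmod (q - midp p q) = cmod (q - p) / 2.
Proof.
rewrite (_ : q - midp p q = (q - p) / 2); first by rewrite cmodM cmodV cmod2.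
by rewrite /midp; field.
Qed.

(** The trapezoidal sum over [2 ^ n] equal pieces; the recursion by midpoints fits the bisection
    argument. *)
Fixpoint trap f n p q : C :=
  if n is n'.+1 then trap f n' p (midp p q) + trap f n' (midp p q) q
  else (q - p) * ((f p + f q) / 2).

(** The trapezoidal rule is exact on affine functions, so that only the deviation counts. The case
    [b = 0] serves for convergence, general [b] for Goursat's theorem. *)
Lemma trap_affine f n p q (a b : C) (e : R) :
  (forall z, onseg p q z -> cmod (f z - (a + b * z)) <= e) ->
  cmod (trap f n p q - (q - p) * (a + b * midp p q)) <= e * cmod (q - p).
Proof.
elim: n p q => [|n IH] p q H.
  rewrite /= (_ : _ - _ = (q - p) * (((f p - (a + b * p)) + (f q - (a + b * q))) / 2)); last first.
    by rewrite /midp; field.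
  rewrite mulrC !cmodM cmodV cmod2 ler_wpM2r ?cmod_ge0 //.
  have := H _ (onseg_left _ _); have := H _ (onseg_right _ _).
  by have := cmodD (f p - (a + b * p)) (f q - (a + b * q)); lra.
have := IH p (midp p q) (fun z h => H z (onseg_half h)).
have := IH (midp p q) q (fun z h => H z (onseg_half' h)).
rewrite midp_subl midp_subr => h1 h2 /=.
set x := trap f n p (midp p q) in h2 *; set y := trap f n (midp p q) q in h1 *.
rewrite (_ : _ - _ = (x - (midp p q - p) * (a + b * midp p (midp p q))) +
   (y - (q - midp p q) * (a + b * midp (midp p q) q))).
  by apply: le_trans (cmodD _ _) _; lra.
by rewrite /midp; field.
Qed.

Lemma trap_sym f n p q : trap f n q p = - trap f n p q.
Proof.
elim: n p q => [|n IH] p q /=; first by ring.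
by rewrite (_ : midp q p = midp p q) ?opprD -?IH 1?addrC // /midp addrC.
Qed.

Definition cconvex S := forall p q z, S p -> S q -> onseg p q z -> S z.

(* For a convex open set such as a disc or a half-plane, three points lie in a
   closed convex subset, where the bisections below take place. *)
Definition exhausted S := forall p q r, S p -> S q -> S r ->
  exists2 K, [/\ closed K, K `<=` S & cconvex K] & [/\ K p, K q & K r].

Lemma closed_limit (K : set C) z : closed K ->
  (forall e : R, 0 < e -> exists2 w, K w & cmod (w - z) < e) -> K z.
Proof.
move=> cK H; apply: contrapT => nK.
have /open_cdiscP/(_ z nK) [r r0 Hr] := closed_openC cK.
by have [w Kw /Hr] := H _ r0.
Qed.

(** The error bound is proportional to the length of the segment, hence adds up over the two halves,
    and bisection reduces to short segments, on which [f] is almost constant. *)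
Lemma trap_cauchy f S p q : exhausted S -> (forall z, S z -> ccont f z) -> S p -> S q ->
  forall e : R, 0 < e -> exists N, forall m n, (N <= m)%N -> (N <= n)%N ->
    cmod (trap f m p q - trap f n p q) <= e * cmod (q - p).
Proof.
move=> xS cf Sp Sq e e0; have [K [cK KS convK] [Kp Kq _]] := xS _ _ _ Sp Sq Sq.
pose Inv (s : C * C) := K s.1 /\ K s.2.
pose Q (s : C * C) := exists N, forall m n, (N <= m)%N -> (N <= n)%N ->
    cmod (trap f m s.1 s.2 - trap f n s.1 s.2) <= e * cmod (s.2 - s.1).
apply: (@nested_bisection _ _ Q Inv (fun s => s.1) (fun s => cmod (s.2 - s.1)) (p, q)) => //.
- by move=> s; exact: cmod_ge0.
- move=> [a b] [/= Ka Kb] nQ.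
  have Km : K (midp a b) by apply: convK Ka Kb (onseg_midp _ _).
  have [Q1|nQ1] := pselect (Q (a, midp a b)); last first.
    by exists (a, midp a b); split=> //=; rewrite ?midp_subl // subrr cmod0 cmod_ge0.
  have [Q2|nQ2] := pselect (Q (midp a b, b)); last first.
    exists (midp a b, b); split=> //=; rewrite ?midp_subr ?midp_subl //.
    by have := cmod_ge0 (b - a); lra.
  case: nQ; have [N1 H1] := Q1; have [N2 H2] := Q2; exists (maxn N1 N2).+1.
  move=> [//|m] [//|n]; rewrite !ltnS !geq_max => /andP [m1 m2] /andP [n1 n2] /=.
  have := H1 _ _ m1 n1; have := H2 _ _ m2 n2; rewrite /= midp_subl midp_subr => h1 h2.
  rewrite opprD addrACA; apply: le_trans (cmodD _ _) _; lra.
move=> z Hz; have Kz : K z.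
  by apply: closed_limit cK _ => d /Hz [[a b] [/= Ka _] h]; exists a.
have [d d0 Hd] := ccont_eps (cf _ (KS _ Kz)) (ltac:(lra) : 0 < e / 2).
exists (d / 3); first lra.
move=> [a b] [/= Ka Kb] h1 h2; exists 0%N => m n _ _ /=.
have h x : onseg a b x -> cmod (f x - (f z + 0 * x)) <= e / 2.
  move=> /onseg_dist hx; rewrite mul0r addr0; apply/ltW/Hd.
  by have := cmod_distD a x z; lra.
have := trap_affine m h; have := trap_affine n h.
set c := (b - a) * _ => t1 t2.
by have := cmod_distD c (trap f m a b) (trap f n a b); rewrite (cmodB c); lra.
Qed.

(** The integral of [f] along the segment from [p] to [q], with the default value 0 in case of
    divergence. *)
Definition cint f p q : C := xget 0 [set l | forall e : R, 0 < e -> exists N, forall n,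
  (N <= n)%N -> cmod (trap f n p q - l) < e].

Section continuous_integrand.
Variables (f : C -> C) (S : set C).
Hypotheses (xS : exhausted S) (cf : forall z, S z -> ccont f z).

Lemma cintP p q : S p -> S q -> forall e : R, 0 < e -> exists N, forall n,
  (N <= n)%N -> cmod (trap f n p q - cint f p q) < e.
Proof.
move=> Sp Sq; apply: (@xgetPex _ 0 [set l | forall e : R, 0 < e -> exists N, forall n,
  (N <= n)%N -> cmod (trap f n p q - l) < e]).
apply: cauchy_complex => e e0; have k0 : 0 < cmod (q - p) + 1 by have := cmod_ge0 (q - p); lra.
have [|N HN] := trap_cauchy xS cf Sp Sq (e := e / (cmod (q - p) + 1)).
  exact: divr_gt0.
exists N => m n hm hn; apply: le_lt_trans (HN _ _ hm hn) _.
by rewrite mulrAC ltr_pdivrMr // ltr_pM2l //; lra.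
Qed.

Lemma cint_eq p q l : S p -> S q -> (forall e : R, 0 < e -> exists N, forall n,
  (N <= n)%N -> cmod (trap f n p q - l) < e) -> cint f p q = l.
Proof.
move=> Sp Sq H; apply/eqP; rewrite -subr_eq0 -cmod_eq0 eq_le cmod_ge0 andbT.
apply/ler_addgt0Pr => e e0; have [N1 H1] := H (e/2) ltac:(lra).
have [N2 H2] := cintP Sp Sq (ltac:(lra) : 0 < e / 2).
have := H1 _ (leq_maxl N1 N2); have := H2 _ (leq_maxr N1 N2).
set x := trap _ _ _ _; have := cmod_distD x (cint f p q) l.
by rewrite (cmodB _ x); lra.
Qed.

Lemma cint_sym p q : S p -> S q -> cint f q p = - cint f p q.
Proof.
move=> Sp Sq; apply: cint_eq => // e e0; have [N HN] := cintP Sp Sq e0.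
exists N => n /HN; rewrite trap_sym -[X in X < e]cmodN.
by congr (cmod _ < e); ring.
Qed.

Lemma cint_midp p q : S p -> S q -> S (midp p q) ->
  cint f p q = cint f p (midp p q) + cint f (midp p q) q.
Proof.
move=> Sp Sq Sm; apply: cint_eq => // e e0.
have [N1 H1] := cintP Sp Sm (ltac:(lra) : 0 < e / 2).
have [N2 H2] := cintP Sm Sq (ltac:(lra) : 0 < e / 2).
exists (maxn N1 N2).+1 => -[//|n]; rewrite ltnS geq_max => /andP [/H1 h1 /H2 h2] /=.
by rewrite opprD addrACA; apply: le_lt_trans (cmodD _ _) _; lra.
Qed.

Lemma cint_affine p q (a b : C) (e : R) : S p -> S q ->
  (forall z, onseg p q z -> cmod (f z - (a + b * z)) <= e) ->
  cmod (cint f p q - (q - p) * (a + b * midp p q)) <= e * cmod (q - p).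
Proof.
move=> Sp Sq H; apply/ler_addgt0Pr => d d0; have [N HN] := cintP Sp Sq d0.
have := HN _ (leqnn N); have := trap_affine N H; set x := trap _ _ _ _; set y := _ * _.
by have := cmod_distD x (cint f p q) y; rewrite (cmodB _ x); lra.
Qed.

End continuous_integrand.

Definition triangle_int f a b c := cint f a b + cint f b c + cint f c a.

(** The bound [e * per ^ 2] is inherited from the four triangles cut out by the midpoints, each of
    half the perimeter. On a small triangle [f] is affine up to a small error, and the midpoint
    values of an affine function sum to 0 around a triangle. *)
Theorem goursat f S a b c : exhausted S -> (forall z, S z -> holo f z) ->
  S a -> S b -> S c -> triangle_int f a b c = 0.
Proof.
move=> xS hf Sa Sb Sc; have cf z : S z -> ccont f z by move=> /hf /holo_ccont.
have [K [cK KS convK] [Ka Kb Kc]] := xS _ _ _ Sa Sb Sc.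
pose per (s : C * C * C) := cmod (s.1.2 - s.1.1) + cmod (s.2 - s.1.2) + cmod (s.1.1 - s.2).
suff H : forall e : R, 0 < e -> cmod (triangle_int f a b c) <= e * per (a, b, c) ^+ 2.
  apply/eqP; rewrite -cmod_eq0 eq_le cmod_ge0 andbT; apply/ler_addgt0Pr => e e0.
  have k0 : 0 < per (a, b, c) ^+ 2 + 1 by have := sqr_ge0 (per (a, b, c)); lra.
  apply: le_trans (H (e / (per (a, b, c) ^+ 2 + 1)) _) _; first exact: divr_gt0.
  by rewrite add0r mulrAC ler_pdivrMr // ler_pM2l //; lra.
move=> e e0.
have per0 s : 0 <= per s by rewrite /per !addr_ge0 ?cmod_ge0.
pose Inv (s : C * C * C) := [/\ K s.1.1, K s.1.2 & K s.2].
pose Q (s : C * C * C) := cmod (triangle_int f s.1.1 s.1.2 s.2) <= e * per s ^+ 2.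
apply: (@nested_bisection _ _ Q Inv (fun s => s.1.1) per (a, b, c)) => // {a b c Sa Sb Sc Ka Kb Kc}.
  move=> [[a b] c] [/= Ka Kb Kc] nQ.
  have Kmid x y : K x -> K y -> K (midp x y).
    by move=> Kx Ky; apply: convK Kx Ky (onseg_midp _ _).
  have halfsub x y z : cmod (midp x y - midp x z) = cmod (y - z) / 2.
    rewrite (_ : midp x y - midp x z = (y - z) / 2); first by rewrite cmodM cmodV cmod2.
    by rewrite /midp; field.
  have midC x y : midp x y = midp y x by rewrite /midp addrC.
  pose x := midp a b; pose y := midp b c; pose z := midp c a.
  have [Kx Ky Kz] : [/\ K x, K y & K z] by split; exact: Kmid.
  have p1 : per (a, x, z) = per (a, b, c) / 2.
    rewrite /per /= /x /z midp_subl (midC a b) (midC c a) [midp b a]midC halfsub -(midC c a).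
    by rewrite midp_subr (cmodB c b); lra.
  have p2 : per (x, b, y) = per (a, b, c) / 2.
    rewrite /per /= /x /y midp_subl midp_subr (midC a b) halfsub (cmodB a c); lra.
  have p3 : per (z, y, c) = per (a, b, c) / 2.
    rewrite /per /= /y /z midp_subr midp_subl (midC b c) halfsub.
    by rewrite (cmodB b a); lra.
  have p4 : per (x, y, z) = per (a, b, c) / 2.
    rewrite /per /= /x /y /z (midC a b) halfsub (midC b c) halfsub (midC c a) (midC b a) halfsub.
    by rewrite (cmodB c a) (cmodB a b) (cmodB b c); lra.
  have tri : triangle_int f a b c = triangle_int f a x z + triangle_int f x b y +
      (triangle_int f z y c + triangle_int f x y z).
    rewrite /triangle_int.
    rewrite (cint_midp xS cf (KS _ Ka) (KS _ Kb) (KS _ Kx)) (cint_midp xS cf (KS _ Kb) (KS _ Kc) (KS _ Ky)).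
    rewrite (cint_midp xS cf (KS _ Kc) (KS _ Ka) (KS _ Kz)) -/x -/y -/z.
    rewrite (cint_sym xS cf (KS _ Kx) (KS _ Kz)) (cint_sym xS cf (KS _ Kx) (KS _ Ky)).
    by rewrite (cint_sym xS cf (KS _ Ky) (KS _ Kz)); ring.
  have [Q1|nQ1] := pselect (Q (a, x, z)); last first.
    by exists (a, x, z); split=> //; rewrite ?p1 //= subrr cmod0.
  have [Q2|nQ2] := pselect (Q (x, b, y)); last first.
    exists (x, b, y); split=> //; rewrite ?p2 //= midp_subl /per /=.
    by have := cmod_ge0 (b - a); have := cmod_ge0 (c - b); have := cmod_ge0 (a - c); lra.
  have [Q3|nQ3] := pselect (Q (z, y, c)); last first.
    exists (z, y, c); split=> //; rewrite ?p3 //= /z midC midp_subl /per /= (cmodB c a).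
    by have := cmod_ge0 (b - a); have := cmod_ge0 (c - b); have := cmod_ge0 (a - c); lra.
  have [Q4|nQ4] := pselect (Q (x, y, z)); last first.
    exists (x, y, z); split=> //; rewrite ?p4 //= midp_subl /per /=.
    by have := cmod_ge0 (b - a); have := cmod_ge0 (c - b); have := cmod_ge0 (a - c); lra.
  case: nQ; rewrite /Q /= tri.
  move: Q1 Q2 Q3 Q4; rewrite /Q p1 p2 p3 p4 /=.
  set t1 := triangle_int _ _ _ _; set t2 := triangle_int _ _ _ _.
  set t3 := triangle_int _ _ _ _; set t4 := triangle_int _ _ _ _ => Q1 Q2 Q3 Q4.
  have := cmodD (t1 + t2) (t3 + t4); have := cmodD t1 t2; have := cmodD t3 t4.
  move: Q1 Q2 Q3 Q4; rewrite !expr_div_n; lra.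
move=> z Hz; have Kz : K z.
  by apply: closed_limit cK _ => d /Hz [[[a b] c] [/= Ka _] _ h]; exists a.
(* Both thirds come from the fact that a point of the triangle lies within [3 * P] of [z]: [2 * P]
   to the vertex [a] and [P] from there. *)
have [l /cderivP/(_ (e / 3) (ltac:(lra))) [d d0 Hd]] := hf _ (KS _ Kz).
exists (d / 3); first lra.
move=> [[a b] c] [/= Ka Kb Kc] h1 h2; rewrite /Q /=.
set P := per _ in h1 h2 *.
have hP x : cmod (x - a) <= P -> cmod (f x - ((f z - l * z) + l * x)) <= e * P.
  move=> hx; have h : cmod (x - z) <= 3 * P by have := cmod_distD a x z; lra.
  have hxd : cmod (x - z) < d by apply: le_lt_trans h _; lra.
  rewrite (_ : _ - _ = f x - f z - l * (x - z)); last by ring.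
  by apply: le_trans (Hd _ hxd) _; have := cmod_ge0 (x - z); nra.
have [d1 d2 d3] : [/\ 0 <= cmod (b - a), 0 <= cmod (c - b) & 0 <= cmod (a - c)].
  by split; exact: cmod_ge0.
have PE : P = cmod (b - a) + cmod (c - b) + cmod (a - c) by [].
have s1 x : onseg a b x -> cmod (x - a) <= P by move=> /onseg_dist; lra.
have s2 x : onseg b c x -> cmod (x - a) <= P.
  by move=> /onseg_dist; have := cmod_distD b x a; lra.
have s3 x : onseg c a x -> cmod (x - a) <= P.
  by move=> /onseg_sym /onseg_dist; rewrite (cmodB c a); lra.
have := cint_affine xS cf (KS _ Ka) (KS _ Kb) (fun x h => hP x (s1 x h)).
have := cint_affine xS cf (KS _ Kb) (KS _ Kc) (fun x h => hP x (s2 x h)).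
have := cint_affine xS cf (KS _ Kc) (KS _ Ka) (fun x h => hP x (s3 x h)).
set A := cint f a b; set B := cint f b c; set D := cint f c a.
set A' := (b - a) * _; set B' := (c - b) * _; set D' := (a - c) * _ => i3 i2 i1.
have cyc : A' + B' + D' = 0 by rewrite /A' /B' /D' /midp; field.
rewrite /triangle_int -/A -/B -/D.
have -> : A + B + D = (A - A') + (B - B') + (D - D') by rewrite -[LHS]subr0 -cyc; ring.
have := cmodD (A - A' + (B - B')) (D - D'); have := cmodD (A - A') (B - B').
by rewrite expr2; nra.
Qed.

Lemma exhausted_cdisc a (r : R) : exhausted (cdisc a r).
Proof.
move=> p q s; rewrite /cdisc /= => pr qr sr.
pose m := Num.max (cmod (p - a)) (Num.max (cmod (q - a)) (cmod (s - a))).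
exists [set z | cmod (z - a) <= m]; last by split; rewrite /= /m !le_max lexx ?orbT.
split; first exact: closed_cdisc.
  by move=> z /= /le_lt_trans; apply; rewrite !gt_max pr qr sr.
move=> x y z /= hx hy [t /andP [t0 t1] ->].
rewrite (_ : _ - a = (1 - t)%:C * (x - a) + t%:C * (y - a)); last first.
  by rewrite rmorphB rmorph1; ring.
apply: le_trans (cmodD _ _) _; rewrite !cmodM !cmodR !ger0_norm ?subr_ge0 //.
by nra.
Qed.

Lemma exhausted_halfplane (b : R) : exhausted [set z : C | Re z < b].
Proof.
move=> p q s /= pb qb sb.
pose m := Num.max (Re p) (Num.max (Re q) (Re s)).
exists [set z : C | Re z <= m]; last by split; rewrite /= /m !le_max lexx ?orbT.
split.
- rewrite -openC; apply/open_cdiscP => z /= /negP; rewrite -ltNge => h.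
  exists (Re z - m); first lra.
  move=> w hw /=; apply/negP; rewrite -ltNge.
  by have := cmod_Re (w - z); rewrite cReD cReN ler_norml; lra.
- by move=> z /= /le_lt_trans; apply; rewrite !gt_max pb qb sb.
move=> x y z /= hx hy [t /andP [t0 t1] ->].
by rewrite cReD mulrC cReMr cReD cReN; nra.
Qed.

Theorem primitive_exists f S : open S -> exhausted S -> (forall z, S z -> holo f z) ->
  exists F, forall z, S z -> cderiv F z (f z).
Proof.
move=> oS xS hf; have cf z : S z -> ccont f z by move=> /hf /holo_ccont.
have [[a Sa]|nS] := pselect (S !=set0); last by exists f => z Sz; case: nS; exists z.
exists (cint f a) => z Sz; apply/cderivP => e e0.
have [d1 d10 H1] := ccont_eps (cf _ Sz) e0.
have /open_cdiscP/(_ _ Sz) [d2 d20 H2] := oS.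
exists (Num.min d1 d2); first by rewrite lt_min d10.
move=> w; rewrite lt_min => /andP [w1 w2]; have Sw := H2 _ w2.
have /eqP := goursat xS hf Sa Sz Sw; rewrite /triangle_int (cint_sym xS cf Sa Sw) subr_eq0 => /eqP <-.
rewrite [_ + _ - cint f a z]addrAC subrr add0r.
have h x : onseg z w x -> cmod (f x - (f z + 0 * x)) <= e.
  by move=> /onseg_dist hx; rewrite mul0r addr0; apply/ltW/H1; exact: le_lt_trans hx w1.
by have := cint_affine xS cf Sz Sw h; rewrite mul0r addr0 mulrC.
Qed.

End line_integral.

(** * The maximum principle *)

Section maximum_principle.
Context {R : realType}.
Local Notation C := R[i].
Implicit Types (f : C -> C) (z w a b : C).

(** The exponential turns the punctured disc into a half-plane, which is convex. The period of a
    primitive there does not depend on [z], and far to the left, where [f] is close to [f a], it is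
    seen to be [2 pi i] times [f a]: this is the mean value property. *)
Lemma circle_primitive f a (r : R) : 0 < r -> (forall z, cdisc a r z -> holo f z) ->
  exists G : C -> C, forall z, Re z < ln r ->
    cderiv G z (f (a + cexp z)) /\ G (z + 'i * (2 * pi)%:C) - G z = 'i * (2 * pi)%:C * f a.
Proof.
move=> r0 hf; pose S := [set z : C | Re z < ln r].
have Sdisc z : S z -> cdisc a r (a + cexp z).
  by rewrite /S /cdisc /= addrAC subrr add0r cmod_cexp -{2}(lnK r0) ltr_expR.
have oS : open S.
  apply/open_cdiscP => z /= zr; exists (ln r - Re z); first by rewrite subr_gt0.
  move=> w wz; rewrite /S /=; have : Re z < ln r := zr; have := cmod_Re (w - z); rewrite cReD cReN ler_norml; lra.
have hF z : S z -> holo (fun w => f (a + cexp w)) z.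
  move=> /Sdisc /hf h; apply: (@holo_comp _ f) => //.
  by apply: holoD; [exact: holo_cst|exact: holo_cexp].
have [G dG] := primitive_exists oS (@exhausted_halfplane R (ln r)) hF.
exists G => z Sz; split; first exact: dG.
pose p : C := 'i * (2 * pi)%:C.
have Rp w : Re (w + p) = Re w by rewrite cReD cReMr /= mul0r addr0.
have pn : cmod p = 2 * pi.
  by rewrite cmodM cmod_i mul1r cmodR ger0_norm // mulr_ge0 // pi_ge0.
apply/eqP; rewrite -subr_eq0 -cmod_eq0 eq_le cmod_ge0 andbT.
apply/ler_addgt0Pr => e e0; rewrite add0r.
have fa := hf _ (cdisc_center a r0).
have [d d0 Hd] := ccont_eps (holo_ccont fa) (ltac:(by rewrite divr_gt0 // mulr_gt0 // pi_gt0) : 0 < e / (2 * pi)).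
(* [w] is [z] moved to the left until the circle of radius [exp x] lies where [f] is within
   [e / (2 * pi)] of [f a]. *)
pose x := Num.min (Re z) (ln d - 1).
pose w : C := z - (Re z - x)%:C.
have wRe : Re w = x by rewrite cReD cReN /=; ring.
have xz : x <= Re z by rewrite ge_min lexx.
have xd : x < ln d by rewrite /x; have : Num.min (Re z) (ln d - 1) <= ln d - 1 by [rewrite ge_min lexx orbT]; lra.
have const : G (z + p) - G z = G (w + p) - G w.
  pose D u := G (u + p) - G u.
  have : cmod (D w - D z) <= 0 * cmod (w - z).
    apply: (@mean_value_le _ D z w 0 (fun=> 0)) => t /andP [t0 t1]; last by rewrite cmod0.
    have Su : S (z + t%:C * (w - z)).
      by rewrite /S /= cReD mulrC cReMr cReD cReN wRe; have := Sz; rewrite /S /=; nra.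
    rewrite -(subrr (f (a + cexp (z + t%:C * (w - z))))).
    have h1 : cderiv (fun u => G (u + p)) (z + t%:C * (w - z)) (f (a + cexp (z + t%:C * (w - z)))).
      rewrite -[f _]mulr1; apply: (@cderiv_comp _ G (fun u => u + p)).
        by rewrite -[1]addr0; apply: cderivD; [exact: cderiv_id|exact: cderiv_cst].
      by rewrite -(cexp_2pi (z + _)); apply: dG; rewrite /S /= Rp; exact: Su.
    exact: cderivB h1 (dG _ Su).
  rewrite mul0r => h; apply/eqP; rewrite eq_sym -subr_eq0 -cmod_eq0.
  by rewrite eq_le cmod_ge0 andbT.
rewrite -/p const.
pose H u := G u - u * f a.
have -> : G (w + p) - G w - p * f a = H (w + p) - H w by rewrite /H; ring.
have wpw : w + p - w = p by rewrite addrAC subrr add0r.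
have : cmod (H (w + p) - H w) <= e / (2 * pi) * cmod (w + p - w).
  apply: (@mean_value_le _ H w (w + p) _ (fun u => f (a + cexp u) - f a)) => t t01.
    rewrite wpw; set u := w + _.
    have Su : S u.
      by rewrite /S /= cReD mulrC cReMr -[p]add0r Rp mul0r addr0 wRe; apply: le_lt_trans xz Sz.
    apply: cderivB; first exact: dG.
    suff : cderiv (fun v => v * f a) u (1 * f a + u * 0) by rewrite mul1r mulr0 addr0.
    exact: cderivM (cderiv_id u) (cderiv_cst (f a) u).
  rewrite wpw; apply/ltW/Hd.
  rewrite addrAC subrr add0r cmod_cexp cReD mulrC cReMr -[p]add0r Rp mul0r addr0 wRe.
  by rewrite -(lnK d0) ltr_expR.
rewrite wpw pn divfK //.
by rewrite mulf_neq0 // gt_eqF // pi_gt0.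
Qed.

Lemma circle_point a z : z != a -> exists2 u, z = a + cexp u & Re u = ln (cmod (z - a)).
Proof.
rewrite -subr_eq0 => /cexp_surj_pi [u uz _]; exists u; first by rewrite uz addrC subrK.
by rewrite -uz cmod_cexp expRK.
Qed.

(** The slope of [h] is at most [A] and its increase over a full turn is [2 * pi * A]. A slope below
    [A] at the start would have to be made up by a slope above [A] later on. *)
Lemma max_modulus_circle f a (r s : R) : 0 < s < r -> (forall z, cdisc a r z -> holo f z) ->
  (forall z, cmod (z - a) = s -> cmod (f z) <= cmod (f a)) ->
  forall z, cmod (z - a) = s -> cmod (f z) = cmod (f a).
Proof.
move=> /andP [s0 sr] hf H z zs; apply/eqP; rewrite eq_le H //= leNgt; apply/negP => fz.
have r0 := lt_trans s0 sr.
have za : z != a by rewrite -subr_eq0 -cmod_gt0 zs.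
have [u uz uRe] := circle_point za; rewrite zs in uRe.
have [G HG] := circle_primitive r0 hf.
have lsr : ln s < ln r by rewrite ltr_ln.
(* With this factor the slope of [h] along the vertical line is the real part of [fa * f], which is
   at most [cmod (f a) ^+ 2]. *)
pose fa := (f a)^*; pose c : C := - 'i * fa.
have cfa : cmod fa = cmod (f a).
  by have := normcJ (f a); rewrite !normE => /eqP; rewrite (inj_eq (@complexI _)) => /eqP.
have faf : f a * fa = (cmod (f a) ^+ 2)%:C.
  by have := sqr_normc (f a); rewrite normE -rmorphXn /= => <-.
set A := cmod (f a) ^+ 2.
pose h (t : R) := Re (c * G (u + t%:C * 'i)).
pose dh (t : R) := Re (fa * f (a + cexp (u + t%:C * 'i))).
have Ru (t : R) : Re (u + t%:C * 'i) = ln s.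
  by rewrite cReD mulrC cReMr /= mul0r addr0.
have hd (t : R) : is_derive t 1 h (dh t).
  have [dG _] : _ := HG (u + t%:C * 'i) ltac:(by rewrite Ru).
  have := is_derive_Re_path c dG.
  congr is_derive; rewrite /dh; congr Re; rewrite /c; set X := f _.
  transitivity (- ('i ^+ 2) * (fa * X)); first by ring.
  by rewrite sqr_i opprK mul1r.
have on t : cmod (a + cexp (u + t%:C * 'i) - a) = s.
  by rewrite addrAC subrr add0r cmod_cexp Ru lnK.
have dhle t : dh t <= A.
  apply: le_trans (ler_norm _) _; apply: le_trans (cmod_Re _) _.
  by rewrite cmodM cfa /A expr2 ler_wpM2l ?cmod_ge0 // H // on.
have dh0 : dh 0 < A.
  apply: le_lt_trans (ler_norm _) _; apply: le_lt_trans (cmod_Re _) _.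
  rewrite cmodM cfa /A expr2 mul0r addr0 -uz ltr_pM2l //.
  exact: le_lt_trans (cmod_ge0 _) fz.
have pi0 : 0 < 2 * pi :> R by rewrite mulr_gt0 // pi_gt0.
have hper : h (2 * pi) - h 0 = 2 * pi * A.
  rewrite /h mul0r addr0 -cReN -cReD -mulrN -mulrDr [(2 * pi)%:C * 'i]mulrC.
  have [_ ->] := HG u ltac:(by rewrite uRe).
  have -> : c * ('i * (2 * pi)%:C * f a) = - ('i ^+ 2) * (f a * fa) * (2 * pi)%:C.
    by rewrite /c; ring.
  by rewrite sqr_i opprK mul1r faf cReMr mulrC.
have [d d0 Hd] := (is_derive_epsP h 0 (dh 0)).1 (hd 0) ((A - dh 0) / 2) (ltac:(lra)).
pose t := Num.min (d / 2) pi.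
have t0 : 0 < t by rewrite lt_min pi_gt0 divr_gt0.
have td : t < d by apply: le_lt_trans (_ : t <= d / 2) _; [rewrite ge_min lexx|lra].
have tpi : t < 2 * pi.
  by apply: le_lt_trans (_ : t <= pi) _; [rewrite ge_min lexx orbT|have := @pi_gt0 R; lra].
have h1 : h t - h 0 < A * t.
  have := Hd t; rewrite subr0 gtr0_norm // => /(_ td); rewrite ler_norml.
  have : (A - dh 0) * t > 0 by rewrite mulr_gt0 // subr_gt0.
  by move: (h t) (h 0) (dh 0) => x y w; clear; lra.
have [//||x _ h2] := @MVT R h dh t (2 * pi).
  apply: continuous_in_subspaceT => y _; have [hy _] := hd y.
  exact/differentiable_continuous/derivable1_diffP.
have tp : 0 <= 2 * pi - t by rewrite subr_ge0 ltW.
have := ler_wpM2r tp (dhle x); move: h1 h2 hper; clear; lra.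
Qed.

(** Among the points where the maximum is attained, take one with the largest real part. If it were
    interior, the maximum would also be attained on a whole circle about it, hence further to the
    right. *)
Lemma maximum_principle (K : set C) f (B M : R) : closed K -> (forall z, K z -> cmod z <= B) ->
  (forall z, K z -> ccont f z) ->
  (forall z, K z -> cmod (f z) <= M \/
     exists2 r : R, 0 < r & forall w, cmod (w - z) < r -> K w /\ holo f w) ->
  forall z, K z -> cmod (f z) <= M.
Proof.
move=> cK bK cf H z Kz.
have ccm w : K w -> {for w, continuous (fun x => cmod (f x))}.
  by move=> /cf /ccont_continuous; exact: continuous_cmod_comp.
have [c Kc cmax] := compact_max_cmod (compact_bounded_closed cK bK) (ex_intro _ z Kz) ccm.
suff : cmod (f c) <= M by apply: le_trans; exact: cmax.
pose E := [set w | K w /\ cmod (f w) = cmod (f c)].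
have cE : closed E.
  rewrite -openC; apply/open_cdiscP => w nE.
  have [Kw|nK] := pselect (K w); last first.
    have /open_cdiscP/(_ w nK) [r r0 Hr] := closed_openC cK.
    by exists r => // v /Hr nKv [Kv _].
  have lt : cmod (f w) < cmod (f c).
    by rewrite lt_neqAle cmax // andbT; apply/eqP => e; apply: nE.
  have [d d0 Hd] := ccont_eps (cf _ Kw) (ltac:(lra) : 0 < cmod (f c) - cmod (f w)).
  exists d => // v /Hd hv [_ ev]; have := cmod_subl (f v) (f w); lra.
have bE w : E w -> cmod w <= B by move=> [/bK].
have cRe w : {for w, continuous (@complex.Re R)}.
  apply/real_continuous_atP => e e0; exists e => // v.
  apply: le_lt_trans; rewrite -cReN -cReD; exact: cmod_Re.
have [m [Km fm] mmax] := compact_max_cmod (compact_bounded_closed cE bE)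
  (ex_intro _ c (conj Kc erefl)) (fun w _ => cRe w).
rewrite -fm; have [//|[r r0 Hr]] := H _ Km.
have Hm w : cmod (w - m) = r / 2 -> cmod (f w) <= cmod (f m).
  by move=> hw; rewrite fm; apply: cmax; apply: (Hr w _).1; rewrite hw; lra.
pose w : C := m + (r / 2)%:C.
have wm : cmod (w - m) = r / 2 by rewrite addrAC subrr add0r cmodR ger0_norm; lra.
have := @max_modulus_circle f m r (r / 2) ltac:(lra) (fun v hv => (Hr v hv).2) Hm w wm.
move=> fw; have := mmax w; rewrite /E /= fw fm => /(_ (conj (Hr w _).1 erefl)).
by rewrite wm => h; have := h ltac:(lra); rewrite cReD /=; lra.
Qed.

(** By Bernoulli's inequality the powers of [x / M] would outgrow the constant [B / c] if [x]
    exceeded [M]. *)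
Lemma power_compare (c x B M : R) : 0 < c -> 0 <= x -> 0 <= M ->
  (forall n, c * x ^+ n <= B * M ^+ n) -> x <= M.
Proof.
move=> c0 x0 M0 H; rewrite leNgt; apply/negP => Mx.
have [M0'|Mn0] := eqVneq M 0.
  by have := H 1%N; rewrite M0' !expr1 mulr0; rewrite M0' in Mx; nra.
have Mp : 0 < M by rewrite lt_def Mn0.
pose q := x / M - 1.
have q0 : 0 < q by rewrite subr_gt0 ltr_pdivlMr // mul1r.
have bern n : 1 + n%:R * q <= (1 + q) ^+ n.
  elim: n => [|n IH]; first by rewrite mul0r addr0 expr0.
  rewrite exprS -natr1; have : 0 <= n%:R :> R by [].
  by nra.
have Hq n : (1 + q) ^+ n <= B / c.
  rewrite ler_pdivlMr // mulrC -(ler_pM2r (exprn_gt0 n Mp)) -mulrA -exprMn.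
  by rewrite (_ : (1 + q) * M = x) // /q addrC subrK divfK.
have B0 : 0 <= B / c by apply: le_trans (Hq 0%N); rewrite expr0.
have h : 0 <= (B / c) / q by rewrite divr_ge0 // ltW.
have := archi_boundP h; rewrite ltr_pdivrMr //.
set n := Num.bound _ => hn; have := bern n; have := Hq n; lra.
Qed.

(** Mere continuity at [b] is enough because [(w - b) * f w ^+ n] is differentiable at [b]. The
    factor [w - b] disappears when all [n] are compared, and the value at [b] itself follows by
    continuity. *)
Lemma maximum_principle_punctured (K : set C) f b (B M : R) : closed K ->
  (forall z, K z -> cmod z <= B) -> 0 <= M -> (forall z, K z -> ccont f z) ->
  (forall z, K z -> cmod (f z) <= M \/
     exists2 r : R, 0 < r & forall w, cmod (w - z) < r -> K w /\ (w = b \/ holo f w)) ->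
  forall z, K z -> cmod (f z) <= M.
Proof.
move=> cK bK M0 cf H.
have key z : K z -> z != b -> cmod (f z) <= M.
  move=> Kz zb; apply: (@power_compare (cmod (z - b)) _ (B + cmod b)) => //.
  - by rewrite cmod_gt0 subr_eq0.
  - exact: cmod_ge0.
  move=> n; rewrite -cmodX -cmodM.
  have hX w : ccont f w -> ccont (fun v => f v ^+ n) w.
    move=> c; elim: n => [|n IH]; first exact: (ccont_cst 1).
    have -> : (fun v => f v ^+ n.+1) = (fun v => f v * f v ^+ n).
      by apply/funext => v; rewrite exprS.
    exact: ccontM.
  apply: (@maximum_principle K (fun w => (w - b) * f w ^+ n) B) => //.
    move=> w Kw; apply: ccontM; last exact/hX/cf.
    by apply: ccontB; [exact: ccont_id|exact: ccont_cst].
  move=> w Kw; have [h|[r r0 Hr]] := H _ Kw.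
    left; rewrite cmodM cmodX ler_pM ?cmod_ge0 ?exprn_ge0 ?cmod_ge0 //.
      by have := bK _ Kw; have := cmodD w (- b); rewrite cmodN; lra.
    by rewrite lerXn2r ?nnegrE ?cmod_ge0.
  right; exists r => // v /Hr [Kv hv]; split=> //.
  case: hv => [vb|hv'].
    rewrite vb in Kv *; exists (f b ^+ n); apply: (@cderivI _ (fun v => f v ^+ n)) => //.
      by apply/hX/cf.
    by near=> x; rewrite subrr mul0r add0r mulrC.
  apply: holoM; last exact: holoX.
  by apply: holoB; [exact: holo_id|exact: holo_cst].
move=> z Kz; have [zb|/key] := eqVneq z b; last exact.
rewrite leNgt; apply/negP => h.
have [h'|[r r0 Hr]] := H _ Kz; first by move: h'; rewrite leNgt h.
have [d d0 Hd] := ccont_eps (cf _ Kz) (ltac:(lra) : 0 < cmod (f z) - M).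
pose e := Num.min r d / 2.
have e0 : 0 < e by rewrite divr_gt0 // lt_min r0.
have em : e < Num.min r d by rewrite /e; have := e0; rewrite /e; lra.
move: em; rewrite lt_min => /andP [er ed].
pose w : C := z + e%:C.
have wz : cmod (w - z) = e by rewrite addrAC subrr add0r cmodR gtr0_norm.
have wb : w != b by rewrite -zb -subr_eq0 -cmod_gt0 wz.
have := key w (Hr w (ltac:(by rewrite wz))).1 wb.
have := Hd w (ltac:(by rewrite wz)); have := cmod_subl (f z) (f w).
by rewrite (cmodB (f z)); lra.
Unshelve. all: by end_near. Qed.

Lemma schwarz f a (r M : R) : 0 < r -> 0 <= M -> (forall z, cdisc a r z -> holo f z) ->
  (forall z, cdisc a r z -> cmod (f z - f a) <= M) ->
  forall z, cdisc a r z -> cmod (f z - f a) <= M / r * cmod (z - a).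
Proof.
move=> r0 M0 hf H z; rewrite /cdisc /= => zr.
have [->|za] := eqVneq z a; first by rewrite !subrr cmod0 mulr0.
have za0 : 0 < cmod (z - a) by rewrite cmod_gt0 subr_eq0.
have [l dl] := hf _ (cdisc_center a r0).
have key (s : R) : cmod (z - a) <= s -> s < r -> cmod (f z - f a) * s <= M * cmod (z - a).
  move=> zs sr; have s0 : 0 < s by apply: lt_le_trans zs.
  have Ms0 : 0 <= M / s by rewrite divr_ge0 // ltW.
  suff : cmod (quot f a l z) <= M / s.
    by rewrite /quot (negbTE za) cmodM cmodV ler_pdivrMr // mulrAC ler_pdivlMr.
  have hq w : cmod (w - a) < r -> w != a -> holo (quot f a l) w.
    move=> wr wa; apply: (@holo_near _ (fun v => (f v - f a) / (v - a))).
      apply: holoM; first by apply: holoB; [exact: hf|exact: holo_cst].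
      apply: holoV; last by rewrite subr_eq0.
      by apply: holoB; [exact: holo_id|exact: holo_cst].
    apply/nbhs_cdiscP; exists (cmod (w - a)); first by rewrite cmod_gt0 subr_eq0.
    move=> v; rewrite /quot; case: eqVneq => // ->; by rewrite cmodB ltxx.
  apply: (@maximum_principle_punctured [set w | cmod (w - a) <= s] _ a (s + cmod a)) => //=.
  - exact: closed_cdisc.
  - by move=> w ws; have := cmodD (w - a) a; rewrite subrK; lra.
  - move=> w ws; have [->|wa] := eqVneq w a; first by case: dl.
    by apply/holo_ccont/hq => //; exact: le_lt_trans ws sr.
  move=> w; rewrite le_eqVlt => /orP [/eqP ws|ws].
    left; have wa : w != a by rewrite -subr_eq0 -cmod_gt0 ws.
    rewrite /quot (negbTE wa) cmodM cmodV ws ler_pM2r ?invr_gt0 //.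
    by apply: H; rewrite /cdisc /= ws.
  right; exists (s - cmod (w - a)); first lra.
  move=> v hv; have vs : cmod (v - a) < s by have := cmod_distD w v a; lra.
  split; first exact: ltW.
  by have [->|va] := eqVneq v a; [left|right; apply: hq => //; exact: lt_trans sr].
rewrite mulrAC ler_pdivlMr //; apply/ler_addgt0Pr => e e0.
pose d := cmod (f z - f a); have d0 : 0 <= d := cmod_ge0 _.
(* So close to [r] that [d * (r - s)] is at most [e]. *)
pose s := Num.max (cmod (z - a)) (r - e / (d + 1)).
have sr : s < r by rewrite gt_max zr ltrBlDr ltrDl divr_gt0 // ltr_wpDl.
have := key s ltac:(by rewrite le_max lexx) sr; rewrite -/d => h.
apply: (@le_trans _ _ (d * (s + e / (d + 1)))).
  rewrite ler_wpM2l // -lerBlDr le_max lexx orbT //.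
rewrite mulrDr; apply: lerD => //.
rewrite mulrA ler_pdivrMr ?ltr_wpDl //; nra.
Qed.

End maximum_principle.

(** * Derivatives of holomorphic functions, removable quotients, logarithms *)

Section derivatives_are_holomorphic.
Context {R : realType}.
Local Notation C := R[i].
Implicit Types (f df : C -> C) (z w a b : C).

(** The slope may depend on the accuracy: two slopes of accuracies [e] and [e'] differ by at most
    [e + e'], so that they converge to the derivative. *)
Lemma holo_of_approx f a :
  (forall e : R, 0 < e -> exists l, exists2 d : R, 0 < d & forall w, cmod (w - a) < d ->
     cmod (f w - f a - l * (w - a)) <= e * cmod (w - a)) -> holo f a.
Proof.
move=> H; have Hn n : {l | exists2 d : R, 0 < d & forall w, cmod (w - a) < d ->
     cmod (f w - f a - l * (w - a)) <= 1 / 2 ^+ n * cmod (w - a)}.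
  by apply/cid/H; rewrite divr_gt0 // exprn_gt0.
pose l n := sval (Hn n).
have ll m n : cmod (l m - l n) <= 1 / 2 ^+ m + 1 / 2 ^+ n.
  have [d1 d10 H1] := svalP (Hn m); have [d2 d20 H2] := svalP (Hn n).
  pose t := Num.min d1 d2 / 2.
  have t0 : 0 < t by rewrite divr_gt0 // lt_min d10.
  have : t < Num.min d1 d2 by rewrite /t; have := t0; rewrite /t; lra.
  rewrite lt_min => /andP [t1 t2].
  pose w := a + t%:C.
  have wa : w - a = t%:C by rewrite addrAC subrr add0r.
  have cw : cmod (w - a) = t by rewrite wa cmodR gtr0_norm.
  have := H1 w; rewrite cw => /(_ t1) h1; have := H2 w; rewrite cw => /(_ t2) h2.
  rewrite -(ler_pM2r t0) -{1}cw -cmodM.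
  rewrite (_ : _ * _ = (f w - f a - l n * (w - a)) - (f w - f a - l m * (w - a))); last by ring.
  by apply: le_trans (cmodD _ _) _; rewrite cmodN mulrDl addrC lerD.
have small (e : R) : 0 < e -> exists N, forall n, (N <= n)%N -> 1 / 2 ^+ n < e.
  exact: half_geometric_small.
have [l0 Hl] : exists l0, forall e : R, 0 < e -> exists N, forall n, (N <= n)%N -> cmod (l n - l0) < e.
  apply: cauchy_complex => e e0; have [N HN] := small (e / 2) ltac:(lra).
  by exists N => m n /HN hm /HN hn; have := ll m n; lra.
exists l0; apply/cderivP => e e0.
have [N1 H1] := Hl (e / 2) ltac:(lra); have [N2 H2] := small (e / 2) ltac:(lra).
pose n := maxn N1 N2; have h1 := H1 n (leq_maxl _ _); have h2 := H2 n (leq_maxr _ _).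
have [d d0 Hd] := svalP (Hn n); exists d => // w wd.
rewrite (_ : _ - _ = (f w - f a - l n * (w - a)) + (l n - l0) * (w - a)); last by ring.
apply: le_trans (cmodD _ _) _; rewrite cmodM.
have := Hd w wd; rewrite -/(l n); have := cmod_ge0 (w - a); nra.
Qed.

Lemma holo_on_deriv f (S : set C) : (forall z, S z -> holo f z) ->
  exists df, forall z, S z -> cderiv f z (df z).
Proof.
move=> hf; exists (fun z => xget 0 [set l | cderiv f z l]) => z /hf [l fl].
exact: (xgetPex 0 (ex_intro [set l | cderiv f z l] l fl)).
Qed.

(** Schwarz's lemma is applied twice, to [f] for the step [h], then to the difference [g] for the
    step [k]. This takes the place of a bound on the second derivative. *)
Lemma second_difference f a (r : R) : 0 < r -> (forall z, cdisc a (4 * r) z -> holo f z) ->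
  exists2 M : R, 0 <= M & forall z h k, cmod (z - a) <= r -> cmod h < r -> cmod k < r ->
    cmod (f (z + h + k) - f (z + h) - (f (z + k) - f z)) <= M * cmod h * cmod k.
Proof.
move=> r0 hf; pose K := [set z | cmod (z - a) <= 3 * r].
have Kh z : K z -> holo f z by move=> h; apply: hf; rewrite /cdisc /=; rewrite /K /= in h; lra.
have Ka : K a by rewrite /K /= subrr cmod0; lra.
have K0 : K !=set0 by exists a.
have [c Kc cmax] := compact_max_cmod (@compact_closed_cdisc R a (3 * r)) K0
  (fun z Kz => continuous_cmod_comp ((ccont_continuous _ _).1 (holo_ccont (Kh z Kz)))).
pose M := cmod (f c); have M0 : 0 <= M := cmod_ge0 _.
have fst z h : cmod (z - a) <= 2 * r -> cmod h < r -> cmod (f (z + h) - f z) <= (2 * M) / r * cmod h.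
  move=> zr hr; have hd w : cdisc z r w -> K w.
    by rewrite /cdisc /K /= => wz; have := cmod_distD z w a; lra.
  have := @schwarz R f z r (2 * M) r0 ltac:(lra) (fun w h => Kh w (hd w h)).
  move=> /(_ _ (z + h)); rewrite /cdisc /= addrAC subrr add0r; apply=> // w wz.
  apply: le_trans (cmodD _ _) _; rewrite cmodN; have := cmax w (hd w wz).
  by have := cmax z (hd z (cdisc_center z r0)); rewrite /M; lra.
have rV0 : 0 <= r^-1 by rewrite invr_ge0 ltW.
exists (2 * (2 * M / r) / r); first by rewrite !mulr_ge0.
move=> z h k zr hr kr; pose g w := f (w + h) - f w.
have -> : f (z + h + k) - f (z + h) - (f (z + k) - f z) = g (z + k) - g z.
  by rewrite /g [z + k + h]addrAC; ring.
have gh w : cdisc z r w -> holo g w.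
  rewrite /cdisc /= => wz; have wa : cmod (w - a) < 2 * r by have := cmod_distD z w a; lra.
  have wha : cmod (w + h - a) < 3 * r.
    by rewrite addrAC; apply: le_lt_trans (cmodD _ _) _; lra.
  apply: holoB; last by apply: Kh; rewrite /K /=; lra.
  apply: (@holo_comp _ f (fun w => w + h)); last by apply: Kh; rewrite /K /=; lra.
  by apply: holoD; [exact: holo_id|exact: holo_cst].
have C0 : 0 <= 2 * M / r * cmod h by rewrite !mulr_ge0 ?cmod_ge0.
have := @schwarz R g z r (2 * (2 * M / r * cmod h)) r0 ltac:(lra) gh.
move=> /(_ _ (z + k)); rewrite /cdisc /= [z + k - z]addrAC subrr add0r => H.
have -> : 2 * (2 * M / r) / r * cmod h * cmod k = 2 * (2 * M / r * cmod h) / r * cmod k.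
  by field; rewrite gt_eqF.
apply: H => // w wz; apply: le_trans (cmodD _ _) _; rewrite cmodN.
have h1 : cmod (w - a) <= 2 * r by have := cmod_distD z w a; lra.
have := fst w h h1 hr; have := fst z h ltac:(lra) hr; rewrite /g; lra.
Qed.

Lemma half_ltr (x : R) : 0 < x -> x / 2 < x.
Proof. lra. Qed.

(** [df] is compared with the difference quotient [q] of a fixed step [t], which is holomorphic. The
    error [q - df] is the limit of [q] minus quotients of steps [u] tending to 0, whose increments
    Schwarz's lemma bounds by a multiple of [t + u]. So [df] is approximated to first order at [a]
    with any accuracy. *)
Theorem holo_derivative f df a (r : R) : 0 < r -> (forall z, cdisc a r z -> cderiv f z (df z)) ->
  holo df a.
Proof.
move=> r0' hdf; pose r' := r / 4; have r0 : 0 < r' by rewrite divr_gt0.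
have r4 : 4 * r' = r by rewrite /r'; lra.
have hf z : cdisc a (4 * r') z -> holo f z by rewrite r4 => /hdf h; exists (df z).
have [M M0 HM] := second_difference r0 hf.
have dlip z k : cmod (z - a) <= r' -> cmod k < r' -> cmod (df (z + k) - df z) <= M * cmod k.
  move=> zr kr; apply/ler_addgt0Pr => e e0.
  have dz : cderiv f z (df z) by apply: hdf; rewrite /cdisc /=; lra.
  have dzk : cderiv f (z + k) (df (z + k)).
    apply: hdf; rewrite /cdisc /= addrAC; apply: le_lt_trans (cmodD _ _) _; lra.
  have [d1 d10 H1] := (cderivP _ _ _).1 dz _ (divr_gt0 e0 (ltr0Sn _ 1)).
  have [d2 d20 H2] := (cderivP _ _ _).1 dzk _ (divr_gt0 e0 (ltr0Sn _ 1)).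
  pose t := Num.min (Num.min d1 d2) r' / 2.
  have m0 : 0 < Num.min (Num.min d1 d2) r' by rewrite !lt_min d10 d20.
  have t0 : 0 < t by exact: divr_gt0.
  have : t < Num.min (Num.min d1 d2) r' by exact: half_ltr.
  rewrite !lt_min => /andP [/andP [t1 t2] t3].
  have ct : cmod (t%:C : C) = t by rewrite cmodR gtr0_norm.
  have := H1 (z + t%:C); have := H2 (z + k + t%:C).
  rewrite ![_ + t%:C - _]addrAC !subrr !add0r ct => /(_ t2) h2 /(_ t1) h1.
  have := HM z t%:C k zr; rewrite ct => /(_ t3 kr) h3.
  rewrite -(ler_pM2r t0) -{1}ct -cmodM.
  rewrite (_ : _ * _ = (f (z + t%:C + k) - f (z + t%:C) - (f (z + k) - f z))
     - (f (z + k + t%:C) - f (z + k) - df (z + k) * t%:C) + (f (z + t%:C) - f z - df z * t%:C)); last first.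
    by rewrite [z + k + _]addrAC; ring.
  apply: le_trans (cmodD _ _) _; apply: le_trans (lerD (cmodD _ _) (lexx _)) _.
  by rewrite cmodN; move: h1 h2 h3; clear; lra.
have dq z h : cmod (z - a) < r' / 2 -> cmod h < r' / 2 ->
    cmod (f (z + h) - f z - df z * h) <= M * cmod h * cmod h.
  move=> zr hr; have := @mean_value_le R (fun w => f w - df z * w) z (z + h) (M * cmod h) (fun w => df w - df z).
  rewrite [z + h - z]addrAC subrr add0r (_ : _ - _ = f (z + h) - f z - df z * h); last by ring.
  have st t : 0 <= t <= 1 -> cmod (t%:C * h) <= cmod h.
    by move=> /andP [t0 t1]; rewrite cmodM cmodR ger0_norm // ler_piMl ?cmod_ge0.
  apply=> t t01; have hs := st _ t01.
    apply: cderivB; last by rewrite -{2}[df z]mulr1; apply: cderivZ; exact: cderiv_id.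
    apply: hdf; rewrite /cdisc /= addrAC; apply: le_lt_trans (cmodD _ _) _; lra.
  apply: le_trans (dlip _ _ _ _) _; [lra|lra|].
  by rewrite ler_wpM2l.
apply: holo_of_approx => e e0.
pose s := r' / 2; have s0 : 0 < s by rewrite divr_gt0.
(* Chosen so that [t < e / (2 * B)] makes the slope [2 * (M * t) / s] of the error at most
   [e / 2]. *)
pose B := 4 * (M + 1) / s.
have B0 : 0 < B by rewrite divr_gt0 // mulr_gt0 // ltr_wpDl.
pose t := Num.min s (e / (2 * B)) / 2.
have m0 : 0 < Num.min s (e / (2 * B)) by rewrite lt_min s0 divr_gt0 // mulr_gt0.
have t0 : 0 < t by exact: divr_gt0.
have : t < Num.min s (e / (2 * B)) by exact: half_ltr.
rewrite lt_min => /andP [ts tB].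
pose q z := (f (z + t%:C) - f z) / t%:C.
have tC : t%:C != 0 :> C by rewrite -cmod_gt0 cmodR gtr0_norm.
have ct : cmod (t%:C : C) = t by rewrite cmodR gtr0_norm.
have key (u : R) : 0 < u < s -> forall z, cdisc a s z ->
   cmod ((q z - (f (z + u%:C) - f z) / u%:C) - (q a - (f (a + u%:C) - f a) / u%:C)) <=
     2 * (M * (t + u)) / s * cmod (z - a).
  move=> /andP [u0 us].
  have uC : u%:C != 0 :> C by rewrite -cmod_gt0 cmodR gtr0_norm.
  have cu : cmod (u%:C : C) = u by rewrite cmodR gtr0_norm.
  pose phi z := q z - (f (z + u%:C) - f z) / u%:C.
  have qh (v : R) : 0 < v < s -> forall z, cdisc a s z -> holo (fun z => (f (z + v%:C) - f z) / v%:C) z.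
    move=> /andP [v0 vs] z; rewrite /cdisc /= => zs; apply: holoM; last exact: holo_cst.
    apply: holoB; last by apply: hf; rewrite /cdisc /=; rewrite /s in zs; lra.
    apply: (@holo_comp _ f (fun w => w + v%:C)).
      by apply: holoD; [exact: holo_id|exact: holo_cst].
    apply: hf; rewrite /cdisc /= addrAC; apply: le_lt_trans (cmodD _ _) _.
    by rewrite cmodR gtr0_norm //; rewrite /s in zs vs; lra.
  have qb (v : R) z : 0 < v < s -> cdisc a s z -> cmod ((f (z + v%:C) - f z) / v%:C - df z) <= M * v.
    move=> /andP [v0 vs] zs; have cv : cmod (v%:C : C) = v by rewrite cmodR gtr0_norm.
    have vC : v%:C != 0 :> C by rewrite -cmod_gt0 cv.
    have := dq z v%:C zs; rewrite cv => /(_ vs) h.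
    rewrite (_ : _ - _ = (f (z + v%:C) - f z - df z * v%:C) / v%:C); last by field.
    by rewrite cmodM cmodV cv ler_pdivrMr.
  have phib z : cdisc a s z -> cmod (phi z) <= M * (t + u).
    move=> zs; have := qb t z ltac:(by rewrite t0 ts) zs; have := qb u z ltac:(by rewrite u0 us) zs.
    rewrite /phi -/(q z) => h1 h2; have := cmod_distD (df z) (q z) ((f (z + u%:C) - f z) / u%:C).
    by rewrite (cmodB (df z)); lra.
  move=> z zs; apply: (@schwarz R phi a s) => //.
  - by rewrite mulr_ge0 // mulr_ge0 // addr_ge0 // ltW.
  - by move=> w ws; apply: holoB; apply: qh => //; rewrite ?t0 ?ts ?u0 ?us.
  move=> w ws; apply: le_trans (cmodD _ _) _; rewrite cmodN.
  by have := phib w ws; have := phib a (cdisc_center a s0); lra.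
have qh : holo q a.
  apply: holoM; last exact: holo_cst.
  apply: holoB; last by apply: hf; rewrite /cdisc /= subrr cmod0; lra.
  apply: (@holo_comp _ f (fun w => w + t%:C)).
    by apply: holoD; [exact: holo_id|exact: holo_cst].
  by apply: hf; rewrite /cdisc /= addrAC subrr add0r ct; rewrite /s in ts; lra.
have [l /cderivP/(_ _ (divr_gt0 e0 (ltr0Sn _ 1))) [d d0 Hd]] := qh.
exists l, (Num.min d s); first by rewrite lt_min d0.
move=> z; rewrite lt_min => /andP [zd zs].
(* The bound [key] in the limit of small [u]; the slack [x] is split into three parts, one for each
   difference quotient and one for the term in [u]. *)
have main : cmod ((q z - df z) - (q a - df a)) <= 2 * (M * t) / s * cmod (z - a).
  apply/ler_addgt0Pr => x x0; have x30 : 0 < x / 3 by exact: divr_gt0.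
  have dz : cderiv f z (df z).
    by apply: hdf; apply: lt_trans zs (lt_trans (half_ltr r0) _); rewrite -r4 ltr_pMl ?ltr1n.
  have da : cderiv f a (df a) by apply: hdf; rewrite /cdisc /= subrr cmod0.
  have [d1 d10 H1] := (cderivP _ _ _).1 dz _ x30.
  have [d2 d20 H2] := (cderivP _ _ _).1 da _ x30.
  pose D := 6 * (M + 1) / s * (cmod (z - a) + 1).
  have D0 : 0 < D.
    apply: mulr_gt0; last exact: ltr_wpDl (cmod_ge0 _) ltr01.
    by apply: divr_gt0 => //; apply: mulr_gt0 => //; exact: ltr_wpDl M0 ltr01.
  pose u := Num.min (Num.min d1 d2) (Num.min s (x / D)) / 2.
  have m0' : 0 < Num.min (Num.min d1 d2) (Num.min s (x / D)) by rewrite !lt_min d10 d20 s0 divr_gt0.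
  have u0 : 0 < u by exact: divr_gt0.
  have : u < Num.min (Num.min d1 d2) (Num.min s (x / D)) by exact: half_ltr.
  rewrite !lt_min => /andP [/andP [u1 u2] /andP [u3 u4]].
  have cu : cmod (u%:C : C) = u by rewrite cmodR gtr0_norm.
  have uC : u%:C != 0 :> C by rewrite -cmod_gt0 cu.
  have := H1 (z + u%:C); have := H2 (a + u%:C).
  rewrite ![_ + u%:C - _]addrAC !subrr !add0r cu => /(_ u2) h2 /(_ u1) h1.
  have h3 := key u ltac:(by rewrite u0 u3) z zs.
  set A := _ - _ in h3.
  have q1 : cmod ((f (z + u%:C) - f z) / u%:C - df z) <= x / 3.
    rewrite (_ : _ - _ = (f (z + u%:C) - f z - df z * u%:C) / u%:C); last by field.
    by rewrite cmodM cmodV cu ler_pdivrMr.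
  have q2 : cmod ((f (a + u%:C) - f a) / u%:C - df a) <= x / 3.
    rewrite (_ : _ - _ = (f (a + u%:C) - f a - df a * u%:C) / u%:C); last by field.
    by rewrite cmodM cmodV cu ler_pdivrMr.
  rewrite (_ : q z - df z - _ = A + ((f (z + u%:C) - f z) / u%:C - df z) -
     ((f (a + u%:C) - f a) / u%:C - df a)); last by rewrite /A; ring.
  apply: le_trans (cmodD _ _) _; apply: le_trans (lerD (cmodD _ _) (lexx _)) _.
  have h5 : 2 * (M * u) / s * cmod (z - a) <= x / 3.
    have : u * D <= x by rewrite -ler_pdivlMr // ltW.
    rewrite /D => h6; have c0 := cmod_ge0 (z - a).
    have : 6 * M / s * cmod (z - a) <= 6 * (M + 1) / s * (cmod (z - a) + 1).
      rewrite -subr_ge0 (_ : _ - _ = 6 / s * (M + cmod (z - a) + 1)); last by ring.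
      by apply: mulr_ge0; [rewrite divr_ge0 // ltW|rewrite !addr_ge0].
    move=> /(ler_wpM2l (ltW u0)) /le_trans /(_ h6) h7.
    rewrite (_ : 2 * _ / s * _ = u * (6 * M / s * cmod (z - a)) / 3); last by field; exact: lt0r_neq0.
    by rewrite ler_pM2r ?invr_gt0.
  rewrite cmodN; move: h3; rewrite (_ : 2 * (M * (t + u)) / s * cmod (z - a) =
     2 * (M * t) / s * cmod (z - a) + 2 * (M * u) / s * cmod (z - a)); last by ring.
  by move: h5 q1 q2; clear; lra.
rewrite (_ : df z - _ - _ = (q z - q a - l * (z - a)) - ((q z - df z) - (q a - df a))); last by ring.
apply: le_trans (cmodD _ _) _; rewrite cmodN.
have h1 := Hd z zd.
have h2 : 2 * (M * t) / s <= e / 2.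
  have : t * (2 * B) < e by rewrite -ltr_pdivlMr // mulr_gt0.
  rewrite (_ : t * (2 * B) = 4 * (2 * (M * t) / s) + 8 * (t / s)); last by rewrite /B; ring.
  have : 0 < t / s by exact: divr_gt0.
  have t0' := ltW t0; have sV0 : 0 <= s^-1 by rewrite invr_ge0 ltW.
  have : 0 <= 2 * (M * t) / s.
    by apply: mulr_ge0 => //; apply: mulr_ge0 => //; exact: mulr_ge0.
  by clear; lra.
by apply: le_trans (lerD h1 (le_trans main (ler_wpM2r (cmod_ge0 _) h2))) _; rewrite -mulrDl -splitr.
Qed.

(** With [m] the derivative of [df] at [a], the Taylor remainder
    [f w - df a * w - m / 2 * (w - a) ^+ 2] has derivative [o(w - a)], and the mean value inequality
    gives the quotient the derivative [m / 2]. *)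
Lemma holo_quot f df a (r : R) : 0 < r -> (forall z, cdisc a r z -> cderiv f z (df z)) ->
  holo (quot f a (df a)) a.
Proof.
move=> r0 hdf; have [m /cderivP Hm] := holo_derivative r0 hdf.
exists (m / 2); apply/cderivP => e e0; have [d d0 Hd] := Hm e e0.
exists (Num.min d r); first by rewrite lt_min d0.
move=> z; rewrite lt_min => /andP [zd zr]; rewrite quot_center.
have [->|za] := eqVneq z a; first by rewrite quot_center !subrr mulr0 subrr cmod0 mulr0.
have za0 : z - a != 0 by rewrite subr_eq0.
rewrite /quot (negbTE za).
rewrite (_ : _ - _ - _ = ((f z - df a * z - m / 2 * (z - a) ^+ 2) -
   (f a - df a * a - m / 2 * (a - a) ^+ 2)) / (z - a)); last by field.
rewrite cmodM cmodV ler_pdivrMr ?cmod_gt0 //.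
apply: (@mean_value_le R (fun w => f w - df a * w - m / 2 * (w - a) ^+ 2) a z _
  (fun w => df w - df a - m * (w - a))) => t /andP [t0 t1].
  set w := a + _; have wr : cdisc a r w.
    rewrite /cdisc /w /= addrAC subrr add0r cmodM cmodR ger0_norm //.
    by apply: le_lt_trans zr; rewrite ler_piMl ?cmod_ge0.
  apply: cderivB; first apply: cderivB.
  - exact: hdf.
  - by rewrite -{2}[df a]mulr1; apply: cderivZ; exact: cderiv_id.
  have -> : m * (w - a) = m / 2 * ((1 - 0) * (w - a) + (w - a) * (1 - 0)) by field.
  apply: (@cderivZ _ (m / 2)); apply: (@cderivM _ (fun w => w - a) (fun w => w - a));
    by apply: cderivB; [exact: cderiv_id|exact: cderiv_cst].
set w := a + _; have wz : cmod (w - a) <= cmod (z - a).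
  by rewrite /w addrAC subrr add0r cmodM cmodR ger0_norm // ler_piMl ?cmod_ge0.
apply: le_trans (Hd _ (le_lt_trans wz zd)) _.
by rewrite ler_wpM2l // ltW.
Qed.

Lemma holo_log f a (r : R) : 0 < r -> (forall z, cdisc a r z -> holo f z) ->
  (forall z, cdisc a r z -> f z != 0) ->
  exists phi, forall z, cdisc a r z -> holo phi z /\ cexp (phi z) = f z.
Proof.
move=> r0 hf f0; have [df Hdf] := holo_on_deriv hf.
have hdf z : cdisc a r z -> holo df z.
  move=> /cdisc_cdisc [s s0 Hs]; apply: (@holo_derivative f df z s s0) => w ws.
  by apply/Hdf/Hs/ltW.
have hq z : cdisc a r z -> holo (fun w => df w * (f w)^-1) z.
  by move=> zr; apply: holoM; [exact: hdf|apply: holoV; [exact: hf|exact: f0]].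
have [F dF] := primitive_exists (@cdisc_open R a r) (@exhausted_cdisc R a r) hq.
have ca := cdisc_center a r0.
have [c cE _] := cexp_surj_pi (mulf_neq0 (f0 a ca) (cexp_neq0 (- F a))).
exists (fun z => c + F z) => z zr; split.
  by apply: holoD; [exact: holo_cst|exists (df z * (f z)^-1); exact: dF].
pose g w := f w * cexp (- F w).
have dg w : cdisc a r w -> cderiv g w 0.
  move=> wr; have -> : 0 = df w * cexp (- F w) + f w * (cexp (- F w) * (- 1 * (df w * (f w)^-1))).
    by field; exact: f0.
  apply: cderivM; first exact: Hdf.
  apply: (@cderiv_comp _ cexp (fun w => - F w)); last exact: cderiv_cexp.
  have -> : (fun w => - F w) = (fun w => -1 * F w) by apply/funext => v; rewrite mulN1r.
  exact: cderivZ (dF _ wr).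
have : cmod (g z - g a) <= 0 * cmod (z - a).
  apply: (@mean_value_le R g a z 0 (fun=> 0)) => t /andP [t0 t1]; last by rewrite cmod0.
  apply: dg; rewrite /cdisc /= addrAC subrr add0r cmodM cmodR ger0_norm //.
  by apply: le_lt_trans zr; rewrite ler_piMl ?cmod_ge0.
rewrite mul0r => h; have /eqP : g z - g a == 0 by rewrite -cmod_eq0 eq_le h cmod_ge0.
move=> /subr0_eq; rewrite /g -cE cexpN => gE.
rewrite cexpD -gE divfK //; exact: cexp_neq0.
Qed.

End derivatives_are_holomorphic.

(** * Harnack's inequality *)

Section harnack_inequality.
Context {R : realType}.
Local Notation C := R[i].
Implicit Types (f h phi : C -> C) (z w a b : C).

Lemma reflect_quotient_lt1 (p q : C) : 0 < Re p -> 0 < Re q ->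
  cmod (p - q) < cmod (p + q^*).
Proof.
move=> p0 q0; rewrite -ltr_sqr ?nnegrE ?cmod_ge0 // !cmod_sqr.
by case: p p0 => x y; case: q q0 => u v /= *; nra.
Qed.

Lemma harnack_log phi a (r t : R) z : 0 < r -> (forall w, cdisc a r w -> holo phi w) ->
  (forall w, cdisc a r w -> 0 < Re (phi w)) -> 0 <= t < 1 -> cmod (z - a) <= t * r ->
  cmod (phi z - phi a) <= t * cmod (phi z + (phi a)^*).
Proof.
move=> r0 hphi Rphi /andP [t0 t1] zt; have ca := cdisc_center a r0.
have den w : cdisc a r w -> phi w + (phi a)^* != 0.
  move=> wr; rewrite -cmod_gt0; apply: le_lt_trans (reflect_quotient_lt1 (Rphi _ wr) (Rphi _ ca)).
  exact: cmod_ge0.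
pose psi w := (phi w - phi a) / (phi w + (phi a)^*).
have psia : psi a = 0 by rewrite /psi subrr mul0r.
have zr : cdisc a r z.
  by rewrite /cdisc /=; apply: le_lt_trans zt _; rewrite gtr_pMl.
have := @schwarz R psi a r 1 r0 ler01; rewrite psia => H.
have := H _ _ z zr; rewrite subr0 => H'.
have : cmod (psi z) <= t.
  apply: le_trans (H' _ _) _.
  - move=> w wr; apply: holoM; first by apply: holoB; [exact: hphi|exact: holo_cst].
    apply: holoV; last exact: den.
    by apply: holoD; [exact: hphi|exact: holo_cst].
  - move=> w wr; rewrite subr0 /psi cmodM cmodV ler_pdivrMr ?mul1r ?cmod_gt0 ?den //.
    by apply/ltW/reflect_quotient_lt1; exact: Rphi.
  by rewrite mul1r mulrC ler_pdivrMr.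
by rewrite /psi cmodM cmodV ler_pdivrMr // cmod_gt0 den.
Qed.

Lemma log_of_large h a (r : R) : 0 < r -> (forall w, cdisc a r w -> holo h w) ->
  (forall w, cdisc a r w -> 1 < cmod (h w)) ->
  exists phi, [/\ forall w, cdisc a r w -> holo phi w, forall w, cdisc a r w -> cexp (phi w) = h w,
    forall w, cdisc a r w -> Re (phi w) = ln (cmod (h w)) &
    forall w, cdisc a r w -> 0 < Re (phi w)].
Proof.
move=> r0 hh h1; have [w wr|phi Hphi] := holo_log r0 hh.
  by rewrite -cmod_gt0; apply: lt_trans (h1 _ wr).
have E w : cdisc a r w -> Re (phi w) = ln (cmod (h w)).
  by move=> /Hphi [_ <-]; rewrite cmod_cexp expRK.
exists phi; split=> // w wr; [by case: (Hphi _ wr)..|].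
by rewrite E // ln_gt0 // h1.
Qed.

Lemma harnack h a (r t : R) z : 0 < r -> (forall w, cdisc a r w -> holo h w) ->
  (forall w, cdisc a r w -> 1 < cmod (h w)) -> 0 <= t < 1 -> cmod (z - a) <= t * r ->
  (1 - t) * ln (cmod (h z)) <= (1 + t) * ln (cmod (h a)) /\
  (1 - t) * ln (cmod (h a)) <= (1 + t) * ln (cmod (h z)).
Proof.
move=> r0 hh h1 t01 zt; have [phi [hphi _ E P]] := log_of_large r0 hh h1.
have [t0 t1] := andP t01.
have zr : cdisc a r z by rewrite /cdisc /=; apply: le_lt_trans zt _; rewrite gtr_pMl.
have ca := cdisc_center a r0.
have := harnack_log r0 hphi P t01 zt; rewrite -(E _ zr) -(E _ ca).
rewrite -ler_sqr ?nnegrE ?mulr_ge0 ?cmod_ge0 // exprMn !cmod_sqr.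
have := P _ zr; have := P _ ca.
case: (phi z) => x y; case: (phi a) => u v /= u0 x0 H.
have h2 : (x - u) ^+ 2 <= (t * (x + u)) ^+ 2.
  have : 0 <= (1 - t ^+ 2) * (y - v) ^+ 2.
    by rewrite mulr_ge0 ?sqr_ge0 // subr_ge0 expr_le1 // ltW.
  by rewrite exprMn; nra.
have h3 : `|x - u| <= t * (x + u).
  have : 0 <= t * (x + u) by rewrite mulr_ge0 // addr_ge0 // ltW.
  move: h2; set S := t * _; set d := x - u => h2 S0.
  by rewrite ler_norml; apply/andP; split; nra.
by move: h3; rewrite ler_norml; lra.
Qed.

(* A holomorphic logarithm of [h] that omitted a value close to [L] would give, by a
   second application of Harnack's inequality, a bound forcing it to stay within
   [k * L] of its value at the centre. *)
Lemma annulus_cover h a b (r k L : R) : 0 < r -> (forall w, cdisc a r w -> holo h w) ->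
  (forall w, cdisc a r w -> 1 < cmod (h w)) -> L = ln (cmod (h a)) -> 0 < k <= 1 ->
  cmod (b - a) <= r / 4 -> k * L <= `|ln (cmod (h b)) - L| ->
  2 * pi <= (k / 10) ^+ 3 * L ->
  forall w, w != 0 -> `|ln (cmod w) - L| <= (k / 10) ^+ 3 / 2 * L -> exists2 z, cdisc a r z & h z = w.
Proof.
move=> r0 hh h1 LE /andP [k0 k1] br kL piL w w0 wL.
have [phi [hphi phiE E P]] := log_of_large r0 hh h1.
have ca := cdisc_center a r0.
have L0 : 0 < L by rewrite LE -E // P.
set eta := (k / 10) ^+ 3 in piL wL.
have k10 : 0 < k / 10 by lra.
have eta0 : 0 < eta by exact: exprn_gt0.
have etak : eta <= k / 10.
  have : 0 <= (k / 10) ^+ 2 <= 1 by rewrite sqr_ge0 expr_le1 //=; lra.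
  by rewrite /eta exprS; nra.
(* The logarithm of [w] nearest in height to [phi a]: the imaginary parts differ by at most [pi],
   which is at most [eta / 2 * L]. *)
have [om omE omI] := cexp_surj_near (Im (phi a)) w0.
have omL : cmod (om - phi a) <= eta * L.
  apply: le_trans (cmod_leD _) _; rewrite cReD cReN cImD cImN.
  have <- : ln (cmod w) = Re om by rewrite -omE cmod_cexp expRK.
  by rewrite E // -LE; move: wL omI piL; lra.
have r20 : 0 < r / 2 by rewrite divr_gt0.
have sub z : cdisc a (r / 2) z -> cdisc a r z by rewrite /cdisc /=; lra.
apply: contrapT => omit.
have nom z : cdisc a r z -> phi z != om.
  by move=> zr; apply/eqP => e; apply: omit; exists z => //; rewrite -phiE // e.
have bound z : cdisc a (r / 2) z -> cmod (phi z - phi a) <= 3 * L.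
  move=> z2; have zr := sub _ z2.
  have zt : cmod (z - a) <= 2^-1 * r by move: z2; rewrite /cdisc /=; lra.
  have t01 : 0 <= (2^-1 : R) < 1 by lra.
  have [u1 _] := harnack r0 hh h1 t01 zt; rewrite -LE -(E _ zr) in u1.
  have := harnack_log r0 hphi P t01 zt.
  have Ra : Re (phi a) = L by rewrite E.
  rewrite -(@ler_sqr R) ?nnegrE ?mulr_ge0 ?cmod_ge0 // exprMn !cmod_sqr.
  move=> HH; have L3 : 0 <= 3 * L by lra.
  rewrite -(@ler_sqr R) ?nnegrE ?cmod_ge0 // cmod_sqr; move: HH.
  have := P _ zr; move: u1 Ra; case: (phi z) => x y; case: (phi a) => u v /= u1 -> x0.
  have x3 : x <= 3 * L by lra.
  by nra.
have etas : eta <= 1 / 10 by lra.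
(* The factor [5 * L] makes [H] larger than 1 in modulus, as [phi z] is within [3 * L] and [om]
   within [eta * L] of [phi a]. *)
pose H z := (5 * L)%:C / (phi z - om).
have hH z : cdisc a (r / 2) z -> holo H z.
  move=> /sub zr; apply: holoM; first exact: holo_cst.
  apply: holoV; last by rewrite subr_eq0 nom.
  by apply: holoB; [exact: hphi|exact: holo_cst].
have L5 : 0 < 5 * L by lra.
have HE z : cmod (H z) = 5 * L / cmod (phi z - om).
  by rewrite cmodM cmodV cmodR gtr0_norm.
have dom z : cdisc a r z -> 0 < cmod (phi z - om) by move=> zr; rewrite cmod_gt0 subr_eq0 nom.
have H1 z : cdisc a (r / 2) z -> 1 < cmod (H z).
  move=> z2; have := dom _ (sub _ z2) => d0; rewrite HE ltr_pdivlMr // mul1r.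
  have := cmod_distD (phi a) (phi z) om; have := bound _ z2.
  by rewrite (cmodB (phi a)); nra.
have bt : cmod (b - a) <= 2^-1 * (r / 2) by lra.
have b2 : cdisc a (r / 2) b by rewrite /cdisc /=; lra.
have t01 : 0 <= (2^-1 : R) < 1 by lra.
have [_ Hb] := harnack r20 hH H1 t01 bt.
have Ha : 5 / eta <= cmod (H a).
  rewrite HE ler_pdivrMr // mulrAC ler_pdivlMr ?dom // cmodB.
  by rewrite -mulrA ler_pM2l // mulrC.
have br' : cdisc a r b := sub _ b2.
have db := dom _ br'.
have kb : k / 2 * L <= cmod (phi b - om).
  have := cmod_Re (phi b - phi a); rewrite cReD cReN (E _ br') (E _ ca) -LE => h2.
  have := cmod_distD om (phi b) (phi a); nra.
have Hb' : cmod (H b) <= 10 / k.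
  rewrite HE ler_pdivrMr // mulrAC ler_pdivlMr //; nra.
have lna : ln (5 / eta) <= ln (cmod (H a)).
  by rewrite ler_ln ?posrE ?divr_gt0 //; apply: lt_trans (H1 _ (cdisc_center a r20)).
have lnb : ln (cmod (H b)) <= ln (10 / k).
  by rewrite ler_ln ?posrE ?divr_gt0 //; apply: lt_trans (H1 _ b2).
(* For [t = 1 / 2] the constant of Harnack's inequality is 3, whence the cube in [eta]: the
   inequality says that [5 / eta] is at most [1 / eta]. *)
have : ln (5 / eta) <= 3 * ln (10 / k) by move: lna lnb Hb; clear; lra.
have -> : 3 * ln (10 / k) = ln ((10 / k) ^+ 3).
  by rewrite lnXn ?divr_gt0 // mulr_natl.
have -> : (10 / k) ^+ 3 = eta^-1 by rewrite -exprVn invf_div.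
rewrite ler_ln ?posrE ?invr_gt0 ?divr_gt0 // -[leRHS]mul1r ler_pM2r ?invr_gt0 //; lra.
Qed.

End harnack_inequality.

(** * Zeros, open mapping and polynomial growth of entire functions *)

Section entire_function_theory.
Context {R : realType}.
Local Notation C := R[i].
Implicit Types (f g : C -> C) (z w a b : C).

Definition hol f := forall z, holo f z.

Lemma hol_continuous_cmod f z : hol f -> {for z, continuous (fun w => cmod (f w))}.
Proof. by move=> hf; apply/continuous_cmod_comp/ccont_continuous/holo_ccont. Qed.

Lemma closed_circle a (r : R) : closed [set z : C | cmod (z - a) = r].
Proof.
rewrite -openC; apply/open_cdiscP => z /= zr.
have h : 0 < `|cmod (z - a) - r| by rewrite normr_gt0 subr_eq0; apply/eqP.
exists `|cmod (z - a) - r| => // w wz wr.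
have := cmod_dist (w - a) (z - a); rewrite wr (_ : w - a - (z - a) = w - z); last by ring.
by rewrite distrC => /le_lt_trans /(_ wz); rewrite ltxx.
Qed.

Lemma compact_circle a (r : R) : compact [set z : C | cmod (z - a) = r].
Proof.
apply: (@compact_bounded_closed _ _ (r + cmod a)); first exact: closed_circle.
by move=> z /= zr; have := cmodD (z - a) a; rewrite subrK zr.
Qed.

Lemma circle_nonempty a (r : R) : 0 <= r -> [set z : C | cmod (z - a) = r] !=set0.
Proof.
by move=> r0; exists (a + r%:C); rewrite /= addrAC subrr add0r cmodR ger0_norm.
Qed.

Lemma maximum_principle_disc f a (r M : R) : hol f ->
  (forall z, cmod (z - a) = r -> cmod (f z) <= M) ->
  forall z, cmod (z - a) <= r -> cmod (f z) <= M.
Proof.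
move=> hf H; apply: (@maximum_principle R [set z | cmod (z - a) <= r] f (r + cmod a)).
- exact: closed_cdisc.
- by move=> z /= zr; have := cmodD (z - a) a; rewrite subrK; lra.
- by move=> z _; exact: holo_ccont.
move=> z /=; rewrite le_eqVlt => /orP [/eqP /H|zr]; first by left.
right; exists (r - cmod (z - a)); first lra.
by move=> w wz; split=> //=; have := cmod_distD z w a; lra.
Qed.

Lemma minimum_principle (K : set C) f (B m : R) : closed K -> (forall z, K z -> cmod z <= B) ->
  hol f -> 0 < m -> (forall z, K z -> f z != 0) ->
  (forall z, K z -> m <= cmod (f z) \/ exists2 r : R, 0 < r & forall w, cmod (w - z) < r -> K w) ->
  forall z, K z -> m <= cmod (f z).
Proof.
move=> cK bK hf m0 f0 H z Kz.
have inv w : K w -> holo (fun w => (f w)^-1) w by move=> Kw; apply: holoV => //; exact: f0.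
have fp w : K w -> 0 < cmod (f w) by move=> Kw; rewrite cmod_gt0 f0.
have := @maximum_principle R K (fun w => (f w)^-1) B m^-1 cK bK.
move=> /(_ (fun w Kw => holo_ccont (inv w Kw))).
move=> P; have : cmod (f z)^-1 <= m^-1.
  apply: P Kz => w Kw; have [h|[r r0 Hr]] := H _ Kw.
    by left; rewrite cmodV lef_pV2 ?posrE ?fp.
  by right; exists r => // v /Hr Kv; split=> //; exact: inv.
by rewrite cmodV lef_pV2 ?posrE ?fp.
Qed.

Lemma minimum_principle_disc f a (r m : R) : hol f -> 0 < m ->
  (forall z, cmod (z - a) <= r -> f z != 0) ->
  (forall z, cmod (z - a) = r -> m <= cmod (f z)) ->
  forall z, cmod (z - a) <= r -> m <= cmod (f z).
Proof.
move=> hf m0 f0 H; apply: (@minimum_principle [set z | cmod (z - a) <= r] f (r + cmod a)) => //.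
- exact: closed_cdisc.
- by move=> z /= zr; have := cmodD (z - a) a; rewrite subrK; lra.
move=> z /=; rewrite le_eqVlt => /orP [/eqP /H|zr]; first by left.
right; exists (r - cmod (z - a)); first lra.
by move=> w wz /=; have := cmod_distD z w a; lra.
Qed.

Lemma hol_factor f a : hol f -> f a = 0 -> exists2 g, hol g & forall z, f z = (z - a) * g z.
Proof.
move=> hf fa; have [df Hdf] := @holo_on_deriv R f setT (fun z _ => hf z).
exists (quot f a (df a)) => [z|z]; last by rewrite {1}(quotE f a (df a) z) fa add0r mulrC.
have [->|za] := eqVneq z a.
  by apply: (@holo_quot R f df a 1 ltr01) => w _; exact: Hdf.
apply: (@holo_near _ (fun v => (f v - f a) / (v - a))).
  apply: holoM; first by apply: holoB; [exact: hf|exact: holo_cst].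
  apply: holoV; last by rewrite subr_eq0.
  by apply: holoB; [exact: holo_id|exact: holo_cst].
apply/nbhs_cdiscP; exists (cmod (z - a)); first by rewrite cmod_gt0 subr_eq0.
by move=> v; rewrite /quot; case: eqVneq => // ->; rewrite cmodB ltxx.
Qed.

Lemma hol_bounded_disc f a (r : R) : hol f -> exists2 M : R, 0 <= M & forall z, cmod (z - a) <= r -> cmod (f z) <= M.
Proof.
move=> hf; have [r0|r0] := leP 0 r; last first.
  by exists 0 => // z zr; have := cmod_ge0 (z - a); lra.
have K0 : [set z : C | cmod (z - a) <= r] !=set0 by exists a; rewrite /= subrr cmod0.
have [c _ cmax] := compact_max_cmod (@compact_closed_cdisc R a r) K0
  (fun z _ => hol_continuous_cmod (z := z) hf).
by exists (cmod (f c)); [exact: cmod_ge0|move=> z zr; exact: cmax].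
Qed.

(** If all small circles about [a] contained zeros, powers of [z - a] of any order [k] could be
    factored out. The radius [s] is at least twice the distance of [z0] from [a], so that the
    maximum principle bounds [f z0] by [M / 2 ^+ k]. *)
Lemma isolated_zeros f a : hol f -> (exists z, f z != 0) -> forall r : R, 0 < r ->
  exists2 s : R, 0 < s < r & forall z, cmod (z - a) = s -> f z != 0.
Proof.
move=> hf [z0 fz0] r r0; apply: contrapT => nH.
have zeros (s : R) : 0 < s < r -> exists2 z, cmod (z - a) = s & f z = 0.
  move=> sr; apply: contrapT => ns; apply: nH; exists s => // z zs.
  by apply/eqP => fz; apply: ns; exists z.
have fac k : exists2 g, hol g & forall z, f z = (z - a) ^+ k * g z.
  elim: k => [|k [g hg fg]]; first by exists f => // z; rewrite expr0 mul1r.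
  have ga : g a = 0.
    apply/eqP; apply: contraT => /(ccont_neq0 (holo_ccont (hg a))) /nbhs_cdiscP [d d0 Hd].
    pose s := Num.min d r / 2.
    have s0 : 0 < s by rewrite divr_gt0 // lt_min d0.
    have : s < Num.min d r by rewrite /s; have := s0; rewrite /s; lra.
    rewrite lt_min => /andP [sd sr].
    have [|z zs fz] := zeros s; first by rewrite s0.
    have := Hd z; rewrite zs => /(_ sd); move: fz; rewrite fg => /eqP.
    have za : z - a != 0 by rewrite -cmod_gt0 zs.
    by rewrite mulf_eq0 expf_eq0 (negbTE za) andbF /= => ->.
  have [h hh gh] := hol_factor hg ga; exists h => // z.
  by rewrite fg gh exprSr mulrA.
pose s := 2 * (cmod (z0 - a) + 1).
have s0 : 0 < s by rewrite mulr_gt0 // ltr_wpDl // cmod_ge0.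
have [M M0 HM] := hol_bounded_disc a s hf.
have key k : cmod (f z0) <= M / 2 ^+ k.
  have [g hg fg] := fac k; rewrite fg cmodM cmodX.
  have gz : cmod (g z0) <= M / s ^+ k.
    apply: (@maximum_principle_disc g a s) => //; last by rewrite /s; have := cmod_ge0 (z0 - a); lra.
    move=> z zs; rewrite ler_pdivlMr ?exprn_gt0 // mulrC -zs -cmodX -cmodM -fg.
    by apply: HM; rewrite zs.
  apply: (@le_trans _ _ (cmod (z0 - a) ^+ k * (M / s ^+ k))).
    by rewrite ler_wpM2l ?exprn_ge0 ?cmod_ge0.
  rewrite mulrCA ler_wpM2l // ler_pdivrMr ?exprn_gt0 // /s exprMn mulKf ?expf_neq0 //.
  by rewrite lerXn2r ?nnegrE ?addr_ge0 ?cmod_ge0 // lerDl.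
have fp : 0 < cmod (f z0) by rewrite cmod_gt0.
have [N HN] := half_geometric_small M0 fp.
by have := HN N (leqnn N); rewrite ltNge key.
Qed.

(** If [w] were omitted, [f - w] would have no zero in the disc, and being smaller at the centre
    than on the circle it would violate the minimum principle. *)
Theorem open_mapping f : hol f -> (exists z w, f z != f w) -> forall a (r : R), 0 < r ->
  exists2 d : R, 0 < d & forall w, cmod (w - f a) < d -> exists2 z, cmod (z - a) < r & f z = w.
Proof.
move=> hf [z1 [z2 z12]] a r r0.
have hB c : hol (fun z => f z - c) by move=> z; apply: holoB => //; exact: holo_cst.
have nz : exists z, f z - f a != 0.
  by have [e|] := eqVneq (f z1) (f a); [exists z2|exists z1]; rewrite subr_eq0 // -e eq_sym.
have [s /andP [s0 sr] Hs] := isolated_zeros a (hB (f a)) nz r0.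
have [c cs cmin] := compact_min_cmod (@compact_circle a s) (circle_nonempty a (ltW s0))
  (fun z _ => hol_continuous_cmod (z := z) (hB (f a))).
set m := cmod (f c - f a) in cmin.
have m0 : 0 < m by rewrite cmod_gt0 Hs.
exists (m / 2); first by rewrite divr_gt0.
move=> w wd; apply: contrapT => omit.
have om z : cmod (z - a) <= s -> f z - w != 0.
  move=> zs; rewrite subr_eq0; apply/eqP => e; apply: omit; exists z => //.
  exact: le_lt_trans zs sr.
have := @minimum_principle_disc (fun z => f z - w) a s (m / 2) (hB w) ltac:(lra) om.
move=> /(_ _ a); rewrite subrr cmod0 => H.
suff : m / 2 <= cmod (f a - w) by rewrite cmodB; lra.
apply: H => [z zs|]; last exact: ltW.
by have := cmin z zs; have := cmod_distD w (f z) (f a); rewrite -/m; lra.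
Qed.

(** Bounds are assumed on arbitrarily large circles only, which is what the negation of fast growth
    provides. Dividing [f - f 0] by [z] lowers the exponent. *)
Lemma hol_polynomial_growth f (K : R) k : hol f -> 0 <= K ->
  (forall r0 : R, exists2 r, r0 <= r & forall z, cmod z = r -> cmod (f z) <= K * r ^+ k) ->
  exists p : {poly C}, forall z, f z = p.[z].
Proof.
elim: k f K => [|k IH] f K hf K0 H.
  have hB : hol (fun z => f z - f 0) by move=> z; apply: holoB => //; exact: holo_cst.
  have [g hg fg] := hol_factor hB (subrr (f 0)).
  have g0 z : g z = 0.
    apply/eqP; rewrite -cmod_eq0 eq_le cmod_ge0 andbT; apply/ler_addgt0Pr => e e0.
    rewrite add0r; have B0 : 0 <= K + cmod (f 0) by rewrite addr_ge0 ?cmod_ge0.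
    have [r r0 Hr] := H (Num.max (cmod z) (Num.max 1 ((K + cmod (f 0)) / e))).
    move: r0; rewrite !ge_max => /and3P [zr r1 rK].
    have rp : 0 < r by lra.
    apply: (@maximum_principle_disc g 0 r) => //; last by rewrite subr0.
    move=> w; rewrite subr0 => wr.
    have wr' : 0 < cmod w by rewrite wr.
    rewrite -(ler_pM2l wr') -cmodM -[w in w * _]subr0 -fg wr.
    apply: le_trans (cmodD _ _) _; rewrite cmodN; have := Hr w wr.
    by move: rK; rewrite ler_pdivrMr // expr0 mulr1; lra.
  exists (f 0)%:P => z; rewrite hornerC.
  by apply/eqP; rewrite -subr_eq0 fg g0 mulr0.
have hB : hol (fun z => f z - f 0) by move=> z; apply: holoB => //; exact: holo_cst.
have [g hg fg] := hol_factor hB (subrr (f 0)).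
have B0 : 0 <= K + cmod (f 0) by rewrite addr_ge0 ?cmod_ge0.
have [|p Hp] := IH g _ hg B0.
  move=> r0; have [r r0r Hr] := H (Num.max 1 r0); move: r0r; rewrite ge_max => /andP [r1 r0r].
  exists r => // w wr; have wr' : 0 < cmod w by rewrite wr; lra.
  rewrite -(ler_pM2l wr') -cmodM -[w in w * _]subr0 -fg wr.
  apply: le_trans (cmodD _ _) _; rewrite cmodN mulrCA -exprS mulrDl.
  by rewrite lerD ?Hr // ler_peMr ?cmod_ge0 // exprn_ege1.
exists ((f 0)%:P + 'X * p) => z.
rewrite hornerD hornerC hornerM hornerX -Hp -[z in z * _]subr0 -fg.
by rewrite addrC subrK.
Qed.

End entire_function_theory.

(** * Growth of entire functions *)

Section growth.
Context {R : realType}.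
Local Notation C := R[i].
Implicit Types (f g : C -> C) (z w a b : C).

Lemma max_modulus_attained f (r : R) : hol f -> 0 <= r ->
  exists2 z, cmod z = r & cmod (f z) = max_modulus r f.
Proof.
move=> hf r0.
have cK : compact [set z : C | cmod z = r].
  by have := @compact_circle R 0 r; under eq_set do rewrite subr0.
have K0 : [set z : C | cmod z = r] !=set0.
  by have := @circle_nonempty R 0 r r0; under eq_set do rewrite subr0.
have [c cr cmax] := compact_max_cmod cK K0 (fun z _ => hol_continuous_cmod (z := z) hf).
exists c => //.
have mem : [set cmod (f z) | z in [set z | cmod z = r]] (cmod (f c)) by exists c.
apply/eqP; rewrite eq_le; apply/andP; split.
  apply: (@ub_le_sup _ [set cmod (f z) | z in [set z | cmod z = r]]) => //.
  by exists (cmod (f c)) => _ [z zr <-]; exact: cmax.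
by apply: ge_sup; [exists (cmod (f c))|move=> _ [z zr <-]; exact: cmax].
Qed.

Lemma le_max_modulus_circle f z : hol f -> cmod (f z) <= max_modulus (cmod z) f.
Proof.
move=> hf; have [M _ HM] := hol_bounded_disc 0 (cmod z) hf.
apply: (@ub_le_sup _ [set cmod (f w) | w in [set w | cmod w = cmod z]]); last by exists z.
by exists M => _ [w /= wz <-]; apply: HM; rewrite subr0 wz.
Qed.

Lemma le_max_modulus f z (r : R) : hol f -> cmod z <= r -> cmod (f z) <= max_modulus r f.
Proof.
move=> hf zr; apply: (@maximum_principle_disc R f 0 r) => //; last by rewrite subr0.
by move=> w; rewrite subr0 => <-; exact: le_max_modulus_circle.
Qed.

Lemma max_modulus_mono f (r s : R) : hol f -> 0 <= r -> r <= s ->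
  max_modulus r f <= max_modulus s f.
Proof.
move=> hf r0 rs; have [z zr <-] := max_modulus_attained hf r0.
by apply: le_max_modulus => //; rewrite zr.
Qed.

(* The factor [exp (e * z ^ 2)], followed by [e -> 0], makes up for the strip being
   unbounded. *)
Lemma three_lines f (t1 t2 al be S : R) : hol f -> t1 < t2 ->
  (forall z, t1 <= Re z <= t2 -> cmod (f z) <= S) ->
  (forall z, Re z = t1 \/ Re z = t2 -> cmod (f z) <= expR (al + be * Re z)) ->
  forall z, t1 <= Re z <= t2 -> cmod (f z) <= expR (al + be * Re z).
Proof.
move=> hf t12 HS Hb z0 z0t.
have [->|fz0] := eqVneq (f z0) 0; first by rewrite cmod0 expR_ge0.
have fp : 0 < cmod (f z0) by rewrite cmod_gt0.
rewrite -[leLHS]lnK ?posrE // ler_expR.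
have S0 : 0 <= S by apply: le_trans (HS _ z0t); exact: cmod_ge0.
pose X := `|t1| + `|t2|; pose T := `|al| + `|be| * X + S.
have X0 : 0 <= X by rewrite addr_ge0.
have T0 : 0 <= T by rewrite !addr_ge0 // mulr_ge0.
have xX (x : R) : t1 <= x <= t2 -> `|x| <= X.
  move=> h; rewrite ler_norml /X; have := ler_norm t2; have := ler_norm (- t1).
  have := normr_ge0 t1; have := normr_ge0 t2; rewrite normrN; lra.
apply/ler_addgt0Pr => d d0.
(* At [z0] the correcting factor costs at most [e * Q = d] in the exponent. The height [N] is such
   that [e * N ^+ 2] exceeds [T], which bounds all other terms on the horizontal sides. *)
pose Q := X ^+ 2 + Im z0 ^+ 2 + 1.
have Q0 : 0 < Q by rewrite ltr_wpDl // addr_ge0 ?sqr_ge0.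
pose e := d / Q; have e0 : 0 < e by exact: divr_gt0.
pose N := `|Im z0| + (T / e + 1).
have Te : 0 <= T / e by rewrite divr_ge0 // ltW.
have N1 : 1 <= N by rewrite /N; have := normr_ge0 (Im z0); lra.
have NT : T <= e * N ^+ 2.
  have : T / e <= N ^+ 2 by rewrite expr2; have := normr_ge0 (Im z0); rewrite /N in N1 *; nra.
  by rewrite ler_pdivrMr // mulrC.
pose q z : C := e%:C * (z ^+ 2 - (X ^+ 2)%:C) - (al%:C + be%:C * z).
have hq z : holo q z.
  apply: holoB; [apply: holoZ; apply: holoB; [apply: holoX; exact: holo_id|exact: holo_cst]|].
  by apply: holoD; [exact: holo_cst|apply: holoZ; exact: holo_id].
have Rq z : Re (q z) = e * (Re z ^+ 2 - Im z ^+ 2 - X ^+ 2) - (al + be * Re z).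
  rewrite /q cReD cReN cReD [_%:C * (_ - _)]mulrC [_%:C * z]mulrC !cReMr cReD cReN expr2 cReM /=.
  by rewrite !expr2; ring.
pose G z := cexp (q z) * f z.
have hG : hol G by move=> z; apply: holoM => //; apply: (@holo_comp _ cexp) => //; exact: holo_cexp.
pose K := [set z : C | (t1 <= Re z <= t2) /\ `|Im z| <= N].
have GE z : cmod (G z) = expR (Re (q z)) * cmod (f z) by rewrite cmodM cmod_cexp.
have sqx z : t1 <= Re z <= t2 -> Re z ^+ 2 <= X ^+ 2.
  by move=> /xX h; rewrite -[X in X <= _]real_normK ?num_real // ler_sqr ?nnegrE.
have clK : closed K.
  rewrite -openC; apply/open_cdiscP => z nK.
  have : 0 < Num.max (Num.max (t1 - Re z) (Re z - t2)) (`|Im z| - N).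
    rewrite ltNge !ge_max; apply/negP => /andP [/andP [h1 h2] h3].
    by apply: nK; split; move: h1 h2 h3; clear; lra.
  set m := Num.max _ _ => m0; exists m => // w wz [/andP [w1 w2] w3].
  have h1 := cmod_Re (w - z); have h2 := cmod_Im (w - z).
  rewrite cReD cReN ler_norml in h1; rewrite cImD cImN in h2.
  have h3 : `|Im z| <= `|Im w| + `|Im w - Im z|.
    by rewrite [X in `|X| <= _](_ : _ = Im w - (Im w - Im z)) ?ler_normB //; ring.
  move: wz; rewrite /m !lt_max.
  by case/orP => [/orP [|]|]; move: w1 w2 w3 h1 h2 h3; clear; lra.
have : cmod (G z0) <= 1.
  apply: (@maximum_principle R K G (X + N)) => //.
  - move=> z [zt zN]; apply: le_trans (cmod_leD _) _.
    by rewrite lerD // xX.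
  - by move=> z _; exact: holo_ccont.
  - move=> z [zt zN]; have sx := sqx z zt.
    have [side|nside] := pselect (Re z = t1 \/ Re z = t2).
      left; rewrite GE; have := Hb z side => h.
      apply: (@le_trans _ _ (expR (Re (q z)) * expR (al + be * Re z))).
        by rewrite ler_wpM2l ?expR_ge0.
      rewrite -expRD -[leRHS]expR0 ler_expR Rq subrK.
      by apply: mulr_ge0_le0 (ltW e0) _; have := sqr_ge0 (Im z); move: sx; clear; lra.
    have [top|ntop] := eqVneq `|Im z| N.
      left; rewrite GE; apply: (@le_trans _ _ (expR (Re (q z)) * expR S)).
        rewrite ler_wpM2l ?expR_ge0 //; apply: le_trans (HS _ zt) _.
        by apply: le_trans (expR_ge1Dx _); lra.
      rewrite -expRD -[leRHS]expR0 ler_expR Rq.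
      have : Im z ^+ 2 = N ^+ 2 by rewrite -top real_normK ?num_real.
      move=> ->; have hx := xX _ zt.
      have : - (al + be * Re z) <= `|al| + `|be| * X.
        apply: le_trans (ler_norm _) _; rewrite normrN; apply: le_trans (ler_normD _ _) _.
        by rewrite lerD2l normrM ler_wpM2l.
      move=> hb; have := ler_wpM2l (ltW e0) sx; move: NT hb; rewrite /T; clear; lra.
    right; pose m := Num.min (Num.min (Re z - t1) (t2 - Re z)) (N - `|Im z|).
    have [s1 s2] : Re z <> t1 /\ Re z <> t2 by tauto.
    exists m.
      by rewrite !lt_min !subr_gt0 !lt_neqAle ntop zN eq_sym !andbT; move/andP: zt => [-> ->];
         rewrite !andbT; apply/andP; split; apply/eqP.
    move=> w; rewrite !lt_min => /andP [/andP [w1 w2] w3]; split; last exact: hG.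
    have := cmod_Re (w - z); have := cmod_Im (w - z).
    rewrite cReD cReN cImD cImN !ler_norml => h1 h2.
    split; first by move: h2 w1 w2; clear; lra.
    have := ler_norm (Im z); have := ler_norm (- Im z); rewrite normrN ler_norml.
    by move: h1 w3; clear; lra.
  split=> //; rewrite /N; lra.
rewrite GE => H.
have : expR (Re (q z0)) * expR (ln (cmod (f z0))) <= expR 0 by rewrite expR0 lnK ?posrE.
rewrite -expRD ler_expR Rq.
have : e * Q = d by rewrite /e divfK // gt_eqF.
by rewrite /Q; have := sqr_ge0 (Re z0); nra.
Qed.

Lemma three_circles f (t1 t2 A B : R) : hol f -> t1 < t2 ->
  (forall z, cmod z = expR t1 -> cmod (f z) <= expR A) ->
  (forall z, cmod z = expR t2 -> cmod (f z) <= expR B) ->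
  forall z, z != 0 -> t1 <= ln (cmod z) <= t2 ->
  cmod (f z) <= expR (((t2 - ln (cmod z)) * A + (ln (cmod z) - t1) * B) / (t2 - t1)).
Proof.
move=> hf t12 HA HB z z0 zt.
have [u uz _] := cexp_surj_pi z0.
have uR : Re u = ln (cmod z) by rewrite -uz cmod_cexp expRK.
pose be := (B - A) / (t2 - t1); pose al := A - be * t1.
have t0 : t2 - t1 != 0 by rewrite subr_eq0 gt_eqF.
have [M _ HM] := hol_bounded_disc 0 (expR t2) hf.
have := @three_lines (fun w => f (cexp w)) t1 t2 al be M.
have hfe : hol (fun w => f (cexp w)) by move=> w; apply: holo_comp => //; exact: holo_cexp.
move=> /(_ hfe t12) H; have := H _ _ u; rewrite uz uR.
have -> : al + be * ln (cmod z) = ((t2 - ln (cmod z)) * A + (ln (cmod z) - t1) * B) / (t2 - t1).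
  by rewrite /al /be; field.
apply=> //.
  by move=> w /andP [_ wt]; apply: HM; rewrite subr0 cmod_cexp ler_expR.
move=> w [wt|wt]; rewrite wt.
  by rewrite (_ : al + be * t1 = A); [apply: HA; rewrite cmod_cexp wt|rewrite /al; ring].
by rewrite (_ : al + be * t2 = B); [apply: HB; rewrite cmod_cexp wt|rewrite /al /be; field].
Qed.

(** The function F of the overview, meaningful where the maximum modulus is positive. *)
Definition lmm f (t : R) := ln (max_modulus (expR t) f).

Section transcendental.
Variable f : C -> C.
Hypotheses (hf : hol f) (npoly : ~ exists p : {poly C}, forall z, f z = p.[z]).

Lemma transcendental_growth (n : nat) : exists2 r0 : R, 1 <= r0 & forall r, r0 <= r -> r ^+ n <= max_modulus r f.
Proof.
apply: contrapT => H; apply: npoly; apply: (@hol_polynomial_growth R f 1 n hf ler01) => r0.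
apply: contrapT => H'; apply: H; exists (Num.max 1 r0); first by rewrite le_max lexx.
move=> r; rewrite ge_max => /andP [r1 r0r]; rewrite leNgt; apply/negP => h.
apply: H'; exists r => // z zr; rewrite mul1r; apply: le_trans (ltW h).
by rewrite -zr; exact: le_max_modulus_circle.
Qed.

Lemma transcendental_nonconstant : exists z w, f z != f w.
Proof.
apply: contrapT => H; apply: npoly; exists (f 0)%:P => z; rewrite hornerC.
by apply/eqP/negPn/negP => h; apply: H; exists z, 0.
Qed.

Lemma lmm_superlinear (k : R) : exists2 t0 : R, 1 <= t0 & forall t, t0 <= t ->
  0 < max_modulus (expR t) f /\ k * t <= lmm f t.
Proof.
have [r0 r01 H] := transcendental_growth (Num.bound `|k|).
exists (Num.max 1 (ln r0)); first by rewrite le_max lexx.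
move=> t; rewrite ge_max => /andP [t1 tr].
have rp : 0 < r0 by lra.
have := H (expR t); rewrite -[r0]lnK ?posrE // ler_expR => /(_ tr) h.
have Mp : 0 < max_modulus (expR t) f by apply: lt_le_trans h; rewrite exprn_gt0 ?expR_gt0.
split=> //; apply: (@le_trans _ _ ((Num.bound `|k|)%:R * t)).
  have := archi_boundP (normr_ge0 k); have := ler_norm k; nra.
by rewrite /lmm -ler_expR lnK ?posrE // mulrC expRM_natr.
Qed.

Lemma lmm_convex (t1 t t2 : R) : 0 < max_modulus (expR t1) f -> t1 < t2 -> t1 <= t <= t2 ->
  (t2 - t1) * lmm f t <= (t2 - t) * lmm f t1 + (t - t1) * lmm f t2.
Proof.
move=> M1 t12 tt; have t0 : 0 < t2 - t1 by rewrite subr_gt0.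
have mono (s : R) : t1 <= s -> 0 < max_modulus (expR s) f.
  by move=> h; apply: lt_le_trans M1 _; apply: max_modulus_mono; rewrite ?expR_ge0 ?ler_expR.
have [z zr zM] := max_modulus_attained hf (expR_ge0 t).
have z0 : z != 0 by rewrite -cmod_gt0 zr expR_gt0.
have lz : ln (cmod z) = t by rewrite zr expRK.
have E (s : R) : t1 <= s -> forall w, cmod w = expR s -> cmod (f w) <= expR (lmm f s).
  move=> ts w ws; rewrite /lmm lnK ?posrE ?mono // -ws; exact: le_max_modulus_circle.
have := three_circles hf t12 (E t1 (lexx _)) (E t2 (ltW t12)) z0.
rewrite lz => /(_ tt); rewrite zM -{1}[max_modulus _ _]lnK ?posrE ?mono //; last by case/andP: tt.
by rewrite ler_expR ler_pdivlMr // mulrC.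
Qed.

(** Convexity bounds [lmm f s] by the chord over [tb] and [t]. Once [t] is so large that
    [lmm f t / t] exceeds [lmm f tb / tb], this chord lies below the line through the origin and the
    point over [t]. *)
Lemma lmm_ratio_mono : exists2 t0 : R, 1 <= t0 & forall s t, t0 <= s -> s <= t ->
  t * lmm f s <= s * lmm f t.
Proof.
have [tb tb1 Hb] := lmm_superlinear 1; have [Mb Fb] := Hb tb (lexx _).
have tb0 : 0 < tb by lra.
have [t0 t01 H0] := lmm_superlinear (lmm f tb / tb).
exists (Num.max tb t0); first by rewrite le_max tb1.
move=> s t; rewrite ge_max => /andP [sb s0] st.
have [_ Ht] := H0 t (le_trans s0 st).
have tbt : tb <= t by lra.
move: tbt; rewrite le_eqVlt => /orP [/eqP tbt|tbt].
  by have -> : s = t by lra.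
have := lmm_convex Mb tbt (ltac:(lra) : tb <= s <= t).
set Fs := lmm f s; set Ft := lmm f t in Ht *; set F0 := lmm f tb in Fb Ht * => h.
have Ft0 : F0 * t <= tb * Ft.
  have := ler_wpM2l (ltW tb0) Ht.
  by rewrite (_ : tb * (F0 / tb * t) = F0 * t) //; field; rewrite gt_eqF.
have d0 : 0 < t - tb by rewrite subr_gt0.
rewrite -(ler_pM2l d0).
have : t * ((t - tb) * Fs) <= t * ((t - s) * F0 + (s - tb) * Ft) by rewrite ler_wpM2l //; lra.
have : (t - s) * (F0 * t) <= (t - s) * (tb * Ft) by rewrite ler_wpM2l // subr_ge0.
nra.
Qed.

Lemma lmm_mono (s t : R) : 0 < max_modulus (expR s) f -> s <= t -> lmm f s <= lmm f t.
Proof.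
move=> Ms st; have h : max_modulus (expR s) f <= max_modulus (expR t) f.
  by apply: max_modulus_mono; rewrite ?expR_ge0 ?ler_expR.
by rewrite ler_ln ?posrE // (lt_le_trans Ms).
Qed.

End transcendental.
End growth.

(** * Walks in the square grid *)

Section grid_walks.
Local Notation cell := (int * int)%type.
Implicit Types (p q a b c v x y : cell) (s t u : seq cell) (W : pred cell).

(** Walks use rook moves and the complement uses king moves: the dual notions of adjacency of the
    discrete Jordan theorem. Both allow staying in place. *)
Definition king p q : bool :=
  [&& p.1 <= q.1 + 1, q.1 <= p.1 + 1, p.2 <= q.2 + 1 & q.2 <= p.2 + 1].
Definition rook p q : bool := king p q && ((p.1 == q.1) || (p.2 == q.2)).
(** For [p] and [q] a king move apart these are the one, two or four cells of the rectangle spanned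
    by them. *)
Definition inrect p q c : bool :=
  ((c.1 == p.1) || (c.1 == q.1)) && ((c.2 == p.2) || (c.2 == q.2)).

(* A step moves one cell of the walk inside a rectangle of cells of [W]; it keeps the length,
   and it is realised by a straight-line homotopy of polygons. *)
Inductive deform W : seq cell -> seq cell -> Prop :=
| deform_refl s : deform W s s
| deform_step u a x y b t p q s : king p q -> (forall c, inrect p q c -> W c) ->
    inrect p q a -> inrect p q x -> inrect p q y -> inrect p q b ->
    deform W (u ++ [:: a, y, b & t]) s -> deform W (u ++ [:: a, x, b & t]) s.

Lemma rook_refl p : rook p p.
Proof. by rewrite /rook /king !eqxx !lerDl. Qed.

Lemma rook_sym p q : rook p q = rook q p.
Proof.
rewrite /rook /king [q.1 == _]eq_sym [q.2 == _]eq_sym.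
by do 4 case: (_ <= _).
Qed.

Lemma deform_trans W s1 s2 s3 : deform W s1 s2 -> deform W s2 s3 -> deform W s1 s3.
Proof.
elim=> // u a x y b t p q s kpq rW ha hx hy hb _ IH /IH.
exact: deform_step kpq rW ha hx hy hb.
Qed.

Lemma deform_sub W W' s s' : (forall c, W c -> W' c) -> deform W s s' -> deform W' s s'.
Proof.
move=> WW'; elim=> [{}s|u a x y b t p q {}s kpq rW ha hx hy hb _ IH]; first exact: deform_refl.
by apply: deform_step kpq _ ha hx hy hb IH => c /rW /WW'.
Qed.

Lemma deform_ctx W u s s' t : deform W s s' -> deform W (u ++ s ++ t) (u ++ s' ++ t).
Proof.
elim=> [{}s|u' a x y b t' p q {}s kpq rW ha hx hy hb _ IH]; first exact: deform_refl.
rewrite -catA catA /=; apply: deform_step kpq rW ha hx hy hb _.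
by move: IH; rewrite -catA catA.
Qed.

Lemma deform_fill W p q u a t t' b s : king p q -> (forall c, inrect p q c -> W c) ->
  inrect p q a -> inrect p q b -> all (inrect p q) t -> all (inrect p q) t' -> size t = size t' ->
  deform W (u ++ a :: t ++ b :: s) (u ++ a :: t' ++ b :: s).
Proof.
move=> kpq rW ha hb; elim: t t' u a ha => [|x t IH] [|y t'] // u a ha; first by move=> *; exact: deform_refl.
move=> /= /andP [hx ht] /andP [hy ht'] [sz].
have step : deform W (u ++ [:: a, x & t ++ b :: s]) (u ++ [:: a, y & t ++ b :: s]).
  by case: t ht {IH sz} => [|z t] /= hz; apply: deform_step kpq rW ha hx hy _ (deform_refl _ _) => //;
    case/andP: hz.
apply: deform_trans step _.
have := IH t' (u ++ [:: a]) y hy ht ht' sz.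
by rewrite -!catA.
Qed.

Definition neg_cell c : cell := (- c.1, - c.2).

Lemma neg_cellK : involutive neg_cell.
Proof. by case=> x y; rewrite /neg_cell /= !opprK. Qed.

Lemma king_neg p q : king (neg_cell p) (neg_cell q) = king p q.
Proof. by rewrite /king /=; lia. Qed.

Lemma rook_neg p q : rook (neg_cell p) (neg_cell q) = rook p q.
Proof. by rewrite /rook king_neg /= !eqr_opp. Qed.

Lemma inrect_neg p q c : inrect (neg_cell p) (neg_cell q) (neg_cell c) = inrect p q c.
Proof. by rewrite /inrect /= !eqr_opp. Qed.

Lemma deform_neg W s s' : deform W s s' ->
  deform (fun c => W (neg_cell c)) (map neg_cell s) (map neg_cell s').
Proof.
elim=> [{}s|u a x y b t p q {}s kpq rW ha hx hy hb _ IH]; first exact: deform_refl.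
rewrite map_cat /=; apply: (@deform_step _ _ _ _ (neg_cell y) _ _ (neg_cell p) (neg_cell q));
  rewrite ?king_neg ?inrect_neg //; last by move: IH; rewrite map_cat.
by move=> c; rewrite -{1}[c]neg_cellK inrect_neg => /rW.
Qed.

Definition ind (e : bool) : int := if e then 1 else 0.

(** The signed crossing of a step with the ray to the right of [p] at height [p.2 + 1 / 2]. No cell
    lies at that height, and the sum [wind] over a closed walk is a winding number. *)
Definition cross p a b : int :=
  if (a.1 == b.1) && (p.1 < a.1) then
    ind ((a.2 == p.2) && (b.2 == p.2 + 1)) - ind ((a.2 == p.2 + 1) && (b.2 == p.2))
  else 0.

Fixpoint wind p a s : int := if s is b :: s' then cross p a b + wind p b s' else 0.

(** Moving the ray to the right loses only the crossings in the column [i + 1], and each of these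
    visits the cell [(i + 1, j)]. *)
Lemma wind_right (i j : int) a s : (i + 1, j) \notin a :: s -> wind (i, j) a s = wind (i + 1, j) a s.
Proof.
elim: s a => //= b s IH a; rewrite !in_cons !negb_or => /and3P [h1 h2 h3].
rewrite IH ?in_cons ?negb_or ?h2 //; congr (_ + _).
move: h1 h2; case: a => a1 a2; case: b => b1 b2; rewrite /cross /ind !xpair_eqE /= => h1 h2.
by do ![case: ifPn => ?]; lia.
Qed.

(** The difference of the crossings at two successive heights counts the entries into the half-row
    at height [j + 1] to the right of [i], minus the exits. It telescopes because the walk cannot
    enter or leave through the end of the half-row, where it avoids one of two adjacent cells. *)
Lemma wind_up (i j : int) a s : path rook a s ->
  ((i, j + 1) \notin a :: s) || ((i + 1, j + 1) \notin a :: s) ->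
  wind (i, j) a s - wind (i, j + 1) a s =
   ind ((i < (last a s).1) && ((last a s).2 == j + 1)) - ind ((i < a.1) && (a.2 == j + 1)).
Proof.
elim: s a => [|b s IH] a /=; first by rewrite !subrr.
move=> /andP [ab bs] h.
have {}IH := IH b bs.
have step : cross (i, j) a b - cross (i, j + 1) a b =
   ind ((i < b.1) && (b.2 == j + 1)) - ind ((i < a.1) && (a.2 == j + 1)).
  have : ((i, j + 1) != a) && ((i, j + 1) != b) || ((i + 1, j + 1) != a) && ((i + 1, j + 1) != b).
    by case/orP: h; rewrite !in_cons !negb_or => /and3P [-> -> _]; rewrite ?orbT.
  move: ab; case: a {h} => a1 a2; case: b {IH bs} => b1 b2.
  rewrite /cross /rook /king !xpair_eqE /= => ab h.
  case: (boolP (a1 == b1)) => e1 /=; last by rewrite /ind; do ![case: ifPn => ?]; lia.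
  case: (boolP (i < a1)) => e2 /=.
    have -> : i < b1 by lia.
    by rewrite /= /ind; do ![case: ifPn => ?; try lia].
  have -> /= : (i < b1) = false by lia.
  by rewrite /ind; lia.
have {}IH := IH (ltac:(by case/orP: h; rewrite in_cons negb_or => /andP [_ ->]; rewrite ?orbT)).
by rewrite opprD addrACA step IH; ring.
Qed.

Lemma wind_closed_up (i j : int) a s : path rook a s -> last a s = a ->
  ((i, j + 1) \notin a :: s) || ((i + 1, j + 1) \notin a :: s) ->
  wind (i, j) a s = wind (i, j + 1) a s.
Proof. by move=> ws la /(wind_up ws); rewrite la subrr => /eqP; rewrite subr_eq0 => /eqP. Qed.

Lemma wind_king p q a s : path rook a s -> last a s = a -> king p q ->
  p \notin a :: s -> q \notin a :: s -> wind p a s = wind q a s.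
Proof.
move=> ws la.
have U (i j : int) : (i, j + 1) \notin a :: s -> wind (i, j) a s = wind (i, j + 1) a s.
  by move=> h; apply: wind_closed_up => //; rewrite h.
have R1 (i j : int) : (i + 1, j + 1) \notin a :: s -> wind (i, j) a s = wind (i + 1, j + 1) a s.
  by move=> h; rewrite -wind_right //; apply: wind_closed_up => //; rewrite h orbT.
have R2 (i j : int) : (i, j + 1) \notin a :: s -> (i + 1, j) \notin a :: s ->
    wind (i, j + 1) a s = wind (i + 1, j) a s.
  by move=> h1 h2; rewrite -U // wind_right.
case: p => p1 p2; case: q => q1 q2; rewrite /king /= => k.
have c1 : q1 = p1 \/ q1 = p1 + 1 \/ p1 = q1 + 1 by lia.
have c2 : q2 = p2 \/ q2 = p2 + 1 \/ p2 = q2 + 1 by lia.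
case: c1 => [->|[->|->]]; case: c2 => [->|[->|->]] hp hq //.
- exact: U.
- exact/esym/U.
- exact: wind_right.
- exact: R1.
- exact: R2.
- exact/esym/wind_right.
- exact/esym/R2.
- exact/esym/R1.
Qed.

Definition boxed (n : int) c : bool := [&& - n <= c.1, c.1 <= n, - n <= c.2 & c.2 <= n].

(** From above, below or the right of the box there is no crossing; from the left every vertical
    step through the height counts, and the sum telescopes along the closed walk. *)
Lemma wind_outside (n : int) p a s : path rook a s -> last a s = a -> all (boxed n) (a :: s) ->
  ~~ boxed n p -> wind p a s = 0.
Proof.
case: p => i j ws la bx np.
have [far|near] := boolP [|| n < i, n < j | j < - n].
  elim: s a {ws la} bx => //= b s IH a /and3P [ba bb bxs].
  rewrite IH ?bb ?bxs // addr0; move: ba bb; rewrite /boxed /cross /ind.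
  by case: a => a1 a2; case: b => b1 b2 /= ba bb; do ![case: ifPn => ?; try lia].
have iL : i < - n by move: np near; rewrite /boxed /=; lia.
suff : wind (i, j) a s = ind (j + 1 <= (last a s).2) - ind (j + 1 <= a.2) by rewrite la subrr.
elim: s a ws {la} bx => [a|b s IH a] /=; first by rewrite subrr.
move=> /andP [ab bs] /and3P [ba bb bxs]; rewrite IH //=; last by rewrite bb.
have -> : cross (i, j) a b = ind (j + 1 <= b.2) - ind (j + 1 <= a.2).
  move: ab ba bb; rewrite /rook /king /boxed /cross /ind.
  by case: a => a1 a2; case: b {IH bs} => b1 b2 /= ab ba bb; do ![case: ifPn => ?; try lia].
by ring.
Qed.

Definition escapes W (n : int) p : Prop :=
  exists2 s, path king p s & all (fun c => ~~ W c) (p :: s) /\ ~~ boxed n (last p s).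

Lemma wind_escapes W n p a s : path rook a s -> last a s = a -> all W (a :: s) ->
  (forall c, W c -> boxed n c) -> escapes W n p -> wind p a s = 0.
Proof.
move=> ws la Ws bW [t kt [nW out]].
have nin c : ~~ W c -> c \notin a :: s by apply: contra => /(allP Ws).
elim: t p kt nW out => [|q t IH] p /=.
  move=> _ _; apply: wind_outside => //.
  by apply/allP => c /(allP Ws) /bW.
move=> /andP [kpq kt] /and3P [np nq nt] out.
by rewrite (@wind_king p q) ?nin //; apply: IH => //=; rewrite nq.
Qed.

(** The rightmost cell of the highest row: only its left and lower neighbours can belong to [W]. *)
Definition topmost W v := forall c, W c -> (c.2 < v.2) || ((c.2 == v.2) && (c.1 <= v.1)).

Lemma topmost_neighbour W v c : topmost W v -> W c -> c != v -> rook v c ->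
  c = (v.1 - 1, v.2) \/ c = (v.1, v.2 - 1).
Proof.
move=> tv Wc cv; have := tv _ Wc; case: c cv {Wc} => c1 c2; case: v {tv} => v1 v2.
rewrite /rook /king xpair_eqE /= => cv h r.
have [e|e] : (c1 = v1 - 1 /\ c2 = v2) \/ (c1 = v1 /\ c2 = v2 - 1) by lia.
  by left; case: e => -> ->.
by right; case: e => -> ->.
Qed.

(* Discrete Jordan curve argument: a closed walk through the corner [v] winds once around
   the diagonal cell, which is connected to the outside. *)
Lemma corner_separates W n v a t : topmost W v -> (forall c, W c -> boxed n c) -> W v ->
  escapes W n (v.1 - 1, v.2 - 1) -> path rook a t -> all W (a :: t) -> v \notin a :: t ->
  rook v a -> rook (last a t) v -> a = last a t.
Proof.
move=> tv bW Wv fd wt Wt nv va tl.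
have Wa : W a by case/andP: Wt.
have Wl : W (last a t) by apply: (allP Wt); exact: mem_last.
have av : a != v by apply: contraNneq nv => <-; rewrite mem_head.
have lv : last a t != v by apply: contraNneq nv => <-; exact: mem_last.
set d := (v.1 - 1, v.2 - 1) in fd.
(* A crossing happens in a column from [v.1] on, between the rows of [d] and of [v]; in the row of
   [v] only [v] itself is in [W] there, so that only steps at [v] count. *)
have mid x y : W x -> W y -> x != v -> y != v -> cross d x y = 0.
  move=> Wx Wy; have := tv _ Wx; have := tv _ Wy; rewrite /cross /ind /d.
  case: x {Wx} => x1 x2; case: y {Wy} => y1 y2; case: v {tv bW Wv d fd nv va tl av lv} => v1 v2.
  by rewrite !xpair_eqE /= => h1 h2 h3 h4; do ![case: ifPn => ?; try lia].
have W0 : wind d v (a :: rcons t v) = 0.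
  apply: (wind_escapes _ _ _ bW fd); rewrite /= ?last_rcons //.
    by rewrite va rcons_path wt tl.
  by move: Wt => /= /andP [h1 h2]; rewrite h1 all_rcons Wv /= h2.
have {}W0 : cross d v a + cross d (last a t) v = 0.
  rewrite -W0 /=; congr (_ + _).
  elim: t a {Wl tl lv W0} wt Wt nv {va Wa} av => [|b t IH] a /=; first by rewrite addr0.
  move=> /andP [_ bt] /and3P [Wa Wb Wt]; rewrite !inE !negb_or => /and3P [na nb nt] av.
  have bv : b != v by rewrite eq_sym.
  have Wbt : all W (b :: t) by rewrite /= Wb.
  have nbt : v \notin b :: t by rewrite inE negb_or nb.
  by rewrite -(IH b) // (mid a b) // add0r.
rewrite rook_sym in tl.
have [ea|ea] := topmost_neighbour tv Wa av va; have [el|el] := topmost_neighbour tv Wl lv tl;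
  first [exact: etrans ea (esym el) | exfalso; move: W0; rewrite el ea /d; clear; case: v => v1 v2; rewrite /cross /ind /=;
  by do ![case: ifPn => ?; try lia]].
Qed.

Definition closed_walk W v s := [/\ path rook v s, last v s = v & all W (v :: s)].

Lemma split_first (e : cell) (r : seq cell) : e \in r ->
  exists r1 r2, r = r1 ++ e :: r2 /\ e \notin r1.
Proof.
elim: r => // f r IH; rewrite inE; have [<-|ef] := eqVneq e f; first by move=> _; exists [::], r.
move=> /= /IH [r1 [r2 [-> h]]]; exists (f :: r1), r2; split=> //.
by rewrite inE negb_or ef.
Qed.

Lemma split_run (e : cell) (r : seq cell) : has (predC1 e) r ->
  exists j f r', r = nseq j e ++ f :: r' /\ f != e.
Proof.
elim: r => // f r IH /=; have [->|fe] := eqVneq f e.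
  by move=> /IH [j [g [r' [-> h]]]]; exists j.+1, g, r'.
by move=> _; exists 0%N, f, r.
Qed.

Lemma rect_rook p q c : rook p q -> inrect p q c -> c = p \/ c = q.
Proof.
case: p => p1 p2; case: q => q1 q2; case: c => c1 c2.
rewrite /rook /inrect /= => /andP [_ /orP [/eqP ->|/eqP ->]]; rewrite orbb.
  by move=> /andP [/eqP -> /orP [/eqP ->|/eqP ->]]; [left|right].
by move=> /andP [/orP [/eqP ->|/eqP ->] /eqP ->]; [left|right].
Qed.

Lemma inrect_l p q : inrect p q p. Proof. by rewrite /inrect !eqxx. Qed.
Lemma inrect_r p q : inrect p q q. Proof. by rewrite /inrect !eqxx !orbT. Qed.
Lemma rook_king p q : rook p q -> king p q. Proof. by case/andP. Qed.

Lemma deform_pair W p q u a t t' b s : rook p q -> W p -> W q ->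
  inrect p q a -> inrect p q b -> all (inrect p q) t -> all (inrect p q) t' -> size t = size t' ->
  deform W (u ++ a :: t ++ b :: s) (u ++ a :: t' ++ b :: s).
Proof.
move=> r Wp Wq; apply: deform_fill; first exact: rook_king.
by move=> c /(rect_rook r) [->|->].
Qed.

Lemma path_nseq v j s : path rook v (nseq j v ++ s) = path rook v s.
Proof. by elim: j => //= j ->; rewrite rook_refl. Qed.

Lemma all_nseq_in p q c j : inrect p q c -> all (inrect p q) (nseq j c).
Proof. by move=> h; rewrite all_nseq h orbT. Qed.

Section remove_corner.
Variables (W : pred cell) (n : int) (v base : cell).
Hypotheses (tv : topmost W v) (bW : forall c, W c -> boxed n c) (Wv : W v).
Hypothesis fW : forall c, ~~ W c -> escapes W n c.
Hypothesis bv : base != v.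
Let W' : pred cell := fun c => W c && (c != v).
Hypothesis IHW : forall b s, closed_walk W' b s -> deform W' (b :: s) (nseq (size s).+1 b).

(** Each run of [v] in the walk lies between two neighbours [a] and [c] of [v]. It is pushed to [a]
    if they agree, and to the diagonal cell if that is in [W]. Otherwise the walk cannot pass from
    [c] to [a] without [v], so that it comes back to [v] through [c], and this excursion contracts
    by [IHW]. *)
Lemma contract_off_corner s : closed_walk W base s -> deform W (base :: s) (nseq (size s).+1 base).
Proof.
have subW c : W' c -> W c by case/andP.
have offW s' : all W s' -> v \notin s' -> all W' s'.
  move=> /allP Ws nv; apply/allP => c cs; rewrite /W' Ws //=.
  by apply: contraNneq nv => <-.
(* [s1] is the part already free of [v]. In the measure a cell of [s2] counts twice, except for [v],
   so that both moving cells into [s1] and turning cells into [v] decrease it. *)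
suff H m : forall s1 s2, v \notin s1 -> closed_walk W base (s1 ++ s2) ->
    (size s2 + count (predC1 v) s2 < m)%N ->
    deform W (base :: s1 ++ s2) (nseq (size (s1 ++ s2)).+1 base).
  by move=> cs; exact: (H _ [::] s isT cs (ltnSn _)).
elim: m => // m IH s1 s2 nv1 cs lem.
have [vs2|nv2] := boolP (v \in s2); last first.
  apply: (deform_sub subW); apply: IHW; case: cs => p l a; split=> //.
  by apply: offW => //; rewrite inE mem_cat !negb_or eq_sym bv nv1.
have [t1 [t2 [e2 nt1]]] := split_first vs2.
pose u := s1 ++ t1; have nu : v \notin u by rewrite mem_cat negb_or nv1.
have eu : s1 ++ s2 = u ++ v :: t2 by rewrite e2 catA.
rewrite eu in cs *; have [pth lst al] := cs.
have : has (predC1 v) t2.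
  apply: contraT; rewrite -all_predC => /allP h.
  have := mem_last v t2; rewrite last_cat /= in lst; rewrite lst inE (negbTE bv) /= => /h /=.
  by rewrite bv.
move=> /split_run [j [c [t3 [et2 cv]]]].
have sz : (2 * size t1 + j + 3 + size t3 + count (predC1 v) t3 <= m)%N.
  move: lem; rewrite e2 et2 !size_cat /= !size_cat !count_cat /= !count_cat size_nseq /= cv eqxx /=.
  rewrite (_ : count (predC1 v) t1 = size t1); last first.
    by apply/eqP; rewrite -all_count; apply/allP => x xt /=; apply: contraNneq nt1 => <-.
  by move: (size t1) (size t3) (count _ t3) => k1 k3 k4; clear; lia.
set a := last base u.
have av : a != v.
  have := mem_last base u; rewrite -/a inE => /orP [/eqP -> //|h].
  by apply: contraNneq nu => <-.
move: pth; rewrite cat_path /= -/a => /and3P [pu rav].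
rewrite et2 path_nseq /= => /andP [rvc pt3].
move: lst; rewrite last_cat /= et2 last_cat /= => lst.
move: al; rewrite /= all_cat /= et2 all_cat /= => /andP [Wb /andP [Wu /andP [_ /andP [_ /andP [Wc Wt3]]]]].
rewrite -et2; change (deform W (base :: u ++ v :: t2) (nseq (size (u ++ v :: t2)).+1 base)).
have Wa : W a by have := mem_last base u; rewrite -/a inE => /orP [/eqP ->|/(allP Wu)].
have rva : rook v a by rewrite rook_sym.
have decomp w : base :: u ++ w = belast base u ++ a :: w.
  by rewrite -cat_cons lastI -/a cat_rcons.
have fillback (x : cell) : deform W (base :: u ++ v :: t2) (base :: u ++ nseq j.+1 x ++ c :: t3) ->
    rook a x -> rook x c -> W x -> x != v ->
    deform W (base :: u ++ v :: t2) (nseq (size (u ++ v :: t2)).+1 base).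
  move=> D rax rxc Wx xv; apply: deform_trans D _.
  have nux : v \notin u ++ nseq j.+1 x.
    by rewrite mem_cat negb_or nu mem_nseq eq_sym (negbTE xv) andbF.
  have -> : size (u ++ v :: t2) = size ((u ++ nseq j.+1 x) ++ c :: t3).
    by rewrite et2 -catA !size_cat /= !size_cat !size_nseq.
  have lt : (size (c :: t3) + count (predC1 v) (c :: t3) < m)%N.
    by move: sz; rewrite /= cv; move: (size t1) (size t3) (count _ t3) => k1 k3 k4; clear; lia.
  rewrite catA; apply: IH lt => //; split.
  - by rewrite -catA cat_path pu /= -/a rax path_nseq /= rxc.
  - by rewrite last_cat.
  - by rewrite /= Wb all_cat all_cat Wu /= Wx all_nseq Wx orbT /= Wc.
have [eac|nac] := eqVneq a c.
  have rac : rook a c by rewrite eac rook_refl.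
  apply: (fillback a) => //; last exact: rook_refl.
  rewrite et2 !decomp -[v :: _ ++ _]/(nseq j.+1 v ++ _) -eac.
  apply: (@deform_pair W v a) => //; rewrite ?inrect_r ?size_nseq //.
    by apply: all_nseq_in; exact: inrect_l.
  by apply: all_nseq_in; exact: inrect_r.
have corner : (a = (v.1 - 1, v.2) /\ c = (v.1, v.2 - 1)) \/ (a = (v.1, v.2 - 1) /\ c = (v.1 - 1, v.2)).
  have [ea|ea] := topmost_neighbour tv Wa av rva; have [ec|ec] := topmost_neighbour tv Wc cv rvc.
  - by rewrite ea ec eqxx in nac.
  - by left.
  - by right.
  - by rewrite ea ec eqxx in nac.
pose d : cell := (v.1 - 1, v.2 - 1).
have [Wd|nWd] := boolP (W d).
  have inr x : inrect a c x = ((x.1 == v.1) || (x.1 == v.1 - 1)) && ((x.2 == v.2) || (x.2 == v.2 - 1)).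
    rewrite /inrect; case: corner => -[-> ->] /=.
      by rewrite [(x.1 == _) || _]orbC.
    by rewrite [(x.2 == _) || _]orbC.
  have rect x : inrect a c x -> W x.
    rewrite inr; move: Wv Wd Wa Wc; rewrite /d.
    case: corner => -[-> ->]; case: x => x1 x2; case: (v) => v1 v2 /= Wv' Wd' Wa' Wc';
    by move=> /andP [/orP [/eqP ->|/eqP ->] /orP [/eqP ->|/eqP ->]].
  have kac : king a c by case: corner => -[-> ->]; clear; case: v => v1 v2; rewrite /king /=; lia.
  have rad : rook a d by rewrite /d; case: corner => -[-> _]; clear; case: v => v1 v2; rewrite /rook /king /=; lia.
  have rdc : rook d c by rewrite /d; case: corner => -[_ ->]; clear; case: v => v1 v2; rewrite /rook /king /=; lia.
  have dv : d != v by rewrite /d; clear; case: v => v1 v2; rewrite xpair_eqE /=; lia.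
  apply: (fillback d) => //.
  rewrite et2 !decomp -[v :: _ ++ _]/(nseq j.+1 v ++ _).
  apply: (@deform_fill W a c) => //; rewrite ?inrect_l ?inrect_r ?size_nseq //.
    by apply: all_nseq_in; rewrite inr !eqxx.
  by apply: all_nseq_in; rewrite inr /= !eqxx !orbT.
(* If [v] does not return, the rest of the walk followed by its beginning leads from [c] through
   [base] to [a], which the corner forbids for distinct [a] and [c]. *)
have [vt3|nv3] := boolP (v \in t3); last first.
  have ea : last c (t3 ++ u) = a by rewrite last_cat lst.
  exfalso; move/eqP: nac; apply; rewrite -ea; apply/esym.
  apply: (corner_separates tv bW Wv (fW nWd)); rewrite ?ea //.
  - by rewrite cat_path pt3 lst.
  - by rewrite /= Wc all_cat Wt3.
  - by rewrite inE mem_cat !negb_or eq_sym cv nv3.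
have [r1 [r2 [e3 nr1]]] := split_first vt3.
move: pt3 Wt3; rewrite e3 cat_path all_cat /= => /and3P [pr1 rlv pr2] /and3P [Wr1 _ Wr2].
have lc : c = last c r1.
  apply: (corner_separates tv bW Wv (fW nWd)) => //=; first by rewrite Wc.
  by rewrite inE negb_or eq_sym cv nr1.
have cW : closed_walk W' c r1.
  split=> //; apply: offW; rewrite /= ?Wc //.
  by rewrite inE negb_or eq_sym cv nr1.
have D1 := deform_ctx (base :: u ++ v :: nseq j v) (v :: r2) (deform_sub subW (IHW cW)).
(* The excursion, now constant at [c], is moved into [v]; this extends the run of [v] and lowers the
   measure. *)
have D2 : deform W ((base :: u ++ v :: nseq j v) ++ nseq (size r1).+1 c ++ v :: r2)
     ((base :: u ++ v :: nseq j v) ++ nseq (size r1).+1 v ++ v :: r2).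
  have -> : base :: u ++ v :: nseq j v = (base :: u ++ nseq j v) ++ [:: v].
    by rewrite /= -catA -[v :: nseq j v]/(nseq j.+1 v) -addn1 nseqD.
  rewrite -!catA; apply: (@deform_pair W v c) => //;
    by rewrite ?inrect_l ?inrect_r ?all_nseq_in ?inrect_l ?inrect_r ?size_nseq.
have E : base :: u ++ v :: t2 = (base :: u ++ v :: nseq j v) ++ (c :: r1) ++ v :: r2.
  by rewrite et2 e3 /= -catA.
rewrite E; apply: deform_trans D1 _; apply: deform_trans D2 _.
pose s2' := v :: nseq j v ++ nseq (size r1).+1 v ++ v :: r2.
have E' : (base :: u ++ v :: nseq j v) ++ nseq (size r1).+1 v ++ v :: r2 = base :: u ++ s2'.
  by rewrite /s2' /= -catA.
have -> : size (u ++ v :: t2) = size (u ++ s2').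
  by rewrite et2 e3 /s2' !size_cat /= !size_cat /= !size_cat !size_nseq.
have lt : (size s2' + count (predC1 v) s2' < m)%N.
  move: sz; rewrite e3 /s2' /= !size_cat !count_cat /= !size_cat !count_cat /= !size_nseq !count_nseq /= eqxx /=.
  by move: (size t1) (size r1) (size r2) (count _ r1) (count _ r2) => k1 k2 k3 k4 k5; clear; lia.
rewrite E'; apply: IH lt => //; split.
- by rewrite cat_path pu /s2' /= -/a rav !path_nseq /= rook_refl path_nseq /= rook_refl.
- by rewrite last_cat /s2' /= last_cat /= last_cat /=; move: lst; rewrite e3 last_cat.
- have hn k : all W (nseq k v) by rewrite all_nseq Wv orbT.
  by rewrite /= Wb all_cat Wu /s2' /= Wv all_cat hn /= Wv all_cat hn /= Wv.
Qed.

End remove_corner.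

Lemma escapes_sub W W' n p : (forall c, W' c -> W c) -> escapes W n p -> escapes W' n p.
Proof.
move=> sub [s ps [/allP nW out]]; exists s => //; split=> //.
by apply/allP => c /nW; apply: contra => /sub.
Qed.

(** The removed cell escapes through its right neighbour, which is not in [W]. *)
Lemma escapes_remove W n v c : topmost W v -> (forall c, ~~ W c -> escapes W n c) ->
  ~~ (W c && (c != v)) -> escapes (fun c => W c && (c != v)) n c.
Proof.
move=> tv fW; have sub x : W x && (x != v) -> W x by case/andP.
have [->|cv] := eqVneq c v; last by rewrite andbT => /fW; exact: escapes_sub.
move=> h; have : ~~ W (v.1 + 1, v.2) by apply/negP => /tv /=; lia.
move=> /fW /(escapes_sub sub) [s ps [al out]]; exists ((v.1 + 1, v.2) :: s) => /=.
  by rewrite ps andbT /king /=; lia.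
by split; rewrite // eqxx andbF; exact: al.
Qed.

Lemma topmost_exists W (l : seq cell) b : W b -> (forall c, W c -> c \in l) ->
  exists2 v, W v & topmost W v.
Proof.
move=> Wb; elim: l W b Wb => [|x l IH] W b Wb sub; first by have := sub _ Wb.
have [h|h] := pselect (exists2 c, W c & c != x); last first.
  have e c : W c -> c = x by move=> Wc; apply/eqP; apply: contrapT => /negP cx; apply: h; exists c.
  exists b => // c /e ->; rewrite (e _ Wb); lia.
have [c Wc cx] := h.
have [y /andP [Wy yx] ty] := IH (fun c => W c && (c != x)) c (introT andP (conj Wc cx))
  (fun z => ltac:(by move=> /andP [/sub]; rewrite inE => /orP [->|])).
have [hx|hx] := boolP (W x && ((y.2 < x.2) || ((y.2 == x.2) && (y.1 <= x.1)))).
  case/andP: hx => Wx hx; exists x => // z Wz; have [->|zx] := eqVneq z x; first by lia.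
  have := ty z; rewrite Wz zx => /(_ isT); lia.
exists y => // z Wz; have [zx|zx] := eqVneq z x; last by apply: ty; rewrite Wz.
by move: hx; rewrite -zx Wz; lia.
Qed.

Lemma closed_walk_neg W b s : closed_walk W b s ->
  closed_walk (fun c => W (neg_cell c)) (neg_cell b) (map neg_cell s).
Proof.
case=> p l a; split; last 2 first.
- by rewrite last_map l.
- rewrite -map_cons all_map; apply: sub_all a => x /=; by rewrite neg_cellK.
rewrite path_map; apply: sub_path p => x y /=; by rewrite rook_neg.
Qed.

Lemma escapes_neg W n p : escapes W n p -> escapes (fun c => W (neg_cell c)) n (neg_cell p).
Proof.
case=> s ps [al out]; exists (map neg_cell s).
  by rewrite path_map; apply: sub_path ps => x y /=; rewrite king_neg.
split; first by rewrite -map_cons all_map; apply: sub_all al => x /=; rewrite neg_cellK.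
by move: out; rewrite last_map /boxed /neg_cell /=; lia.
Qed.

(** Corners are removed one by one, but the base cannot be removed. If it is the topmost cell, the
    central symmetry [neg_cell] provides the opposite corner; if it is that corner too, [W] is a
    single cell. *)
Theorem closed_walk_contracts W (m : nat) base s :
  (forall c, W c -> boxed m%:Z c) -> (forall c, ~~ W c -> escapes W m%:Z c) ->
  closed_walk W base s -> deform W (base :: s) (nseq (size s).+1 base).
Proof.
move=> bW.
pose l : seq cell := [seq (i%:Z - m%:Z, j%:Z - m%:Z) | i <- iota 0 (m + m).+1, j <- iota 0 (m + m).+1].
have Wl c : W c -> c \in l.
  move=> /bW; case: c => x y; rewrite /boxed /= => h; apply/allpairsP.
  exists (absz (x + m%:Z), absz (y + m%:Z)); rewrite !mem_iota ![(_, _).1]/= ![(_, _).2]/=; split; try lia.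
  by congr (_, _); lia.
move: {2}(size l) (leqnn (size l)) => N; elim: N l W Wl bW base s => [|N IH] l W Wl bW base s lN fW cw.
  by case: cw => _ _ /= /andP [/Wl]; case: l lN {Wl}.
have Wb : W base by case: cw => _ _ /= /andP [].
have key W1 (l1 : seq cell) v1 b1 s1 : (forall c, W1 c -> c \in l1) -> (forall c, W1 c -> boxed m%:Z c) ->
    (size l1 <= N.+1)%N -> (forall c, ~~ W1 c -> escapes W1 m%:Z c) -> closed_walk W1 b1 s1 ->
    W1 v1 -> topmost W1 v1 -> b1 != v1 -> deform W1 (b1 :: s1) (nseq (size s1).+1 b1).
  move=> Wl1 bW1 lN1 fW1 cw1 Wv1 tv1 bv1; apply: (contract_off_corner tv1 bW1 Wv1 fW1 bv1 _ cw1) => b' s'.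
  apply: (IH (seq.filter (predC1 v1) l1)).
  - by move=> c /andP [Wc cv]; rewrite mem_filter /= cv Wl1.
  - by move=> c /andP [/bW1].
  - by rewrite size_filter -ltnS; apply: leq_trans lN1; rewrite -(count_predC (pred1 v1) l1) -addn1 addnC leq_add2r
      -has_count has_pred1 Wl1.
  - by move=> c; exact: escapes_remove.
have [v Wv tv] := topmost_exists Wb Wl.
have [ebv|bv] := eqVneq base v; last exact: (key _ l v).
pose W2 : pred cell := fun c => W (neg_cell c).
have Wl2 c : W2 c -> c \in map neg_cell l by move=> /Wl h; rewrite -[c]neg_cellK map_f.
have bW2 c : W2 c -> boxed m%:Z c by move=> /bW; rewrite /boxed /=; lia.
have fW2 c : ~~ W2 c -> escapes W2 m%:Z c by move=> /fW /escapes_neg; rewrite neg_cellK.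
have Wb2 : W2 (neg_cell base) by rewrite /W2 neg_cellK.
have [v2 Wv2 tv2] := topmost_exists Wb2 Wl2.
have [ebv2|bv2] := eqVneq (neg_cell base) v2.
  have e c : W c -> c = base.
    move=> Wc; have := tv _ Wc; have := tv2 (neg_cell c); rewrite /W2 neg_cellK => /(_ Wc).
    rewrite -ebv -ebv2; case: (c) (base) => x y [x' y'] /=; rewrite !eqr_opp => h1 h2; congr (_, _); lia.
  have -> : base :: s = nseq (size s).+1 base.
    case: cw => _ _; rewrite -[X in nseq X]/(size (base :: s)) => al; apply/all_pred1P.
    by apply: sub_all al => x /e ->; rewrite /= eqxx.
  exact: deform_refl.
have := deform_neg (key _ _ v2 _ _ Wl2 bW2 _ fW2 (closed_walk_neg cw) Wv2 tv2 bv2).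
rewrite size_map => /(_ lN); rewrite map_cons neg_cellK mapK; last exact: neg_cellK.
rewrite size_map map_nseq neg_cellK; apply: deform_sub => c; by rewrite /W2 neg_cellK.
Qed.

End grid_walks.

(** * Homotopies of loops *)

Section homotopies.
Context {R : realType}.
Local Notation C := R[i].
Implicit Types (z w : C) (U : set C).

(** The existence of a Lebesgue number: local validity with a radius that serves a whole
    neighbourhood becomes validity with one radius. *)
Lemma compact_uniform (K : set C) (P : R -> C -> Prop) : compact K ->
  (forall d d' z, d' <= d -> P d z -> P d' z) ->
  (forall z, K z -> exists2 d, 0 < d & forall w, cmod (w - z) < d -> P d w) ->
  exists2 d, 0 < d & forall z, K z -> P d z.
Proof.
move=> /compact_near_coveringP cK mono loc.
have := cK R (0^'+) (fun d => P d) _ => /(_ _) [].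
  move=> z /loc [d d0 Hd].
  exists (cdisc z d, [set e | 0 < e <= d]) => /=.
    split; first by apply/nbhs_cdiscP; exists d.
    near=> e; apply/andP; split; near: e.
      exact: nbhs_right_gt.
    exact: nbhs_right_le.
  by move=> [w e] /= [/Hd h /andP [_ ed]]; exact: mono ed h.
move=> e /= e0 H; exists (e / 2); first by rewrite divr_gt0.
move=> z Kz; apply: H => //=; last by rewrite divr_gt0.
by rewrite sub0r normrN gtr0_norm ?divr_gt0 // ltr_pdivrMr // ltr_pMr // ltr1n.
Unshelve. all: by end_near. Qed.

Lemma within_continuousP (X : pseudoMetricType R) (A : set X) (f : X -> C) :
  {within A, continuous f} <->
  forall x, A x -> forall e, 0 < e -> exists2 d, 0 < d & forall y, A y -> ball x d y -> cmod (f y - f x) < e.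
Proof.
split.
  move=> /subspace_continuousP cf x Ax e e0.
  have : nbhs (f x) [set w | cmod (w - f x) < e] by apply/nbhs_cdiscP; exists e.
  move=> /(cf x Ax) /nbhs_ballP [d /= d0 Hd]; exists d => // y Ay xy.
  exact: Hd.
move=> H; apply/subspace_continuousP => x Ax B /nbhs_cdiscP [e e0 He].
have [d d0 Hd] := H _ Ax _ e0.
by apply/nbhs_ballP; exists d => // y xy Ay; apply/He/Hd.
Qed.

(** The retraction of the line onto the unit interval; it extends loops and homotopies to total
    continuous maps. *)
Definition clamp (x : R) : R := Num.max 0 (Num.min x 1).

Lemma clamp_id x : 0 <= x <= 1 -> clamp x = x.
Proof. by move=> /andP [x0 x1]; rewrite /clamp min_l // max_r. Qed.

Lemma clamp_itv x : 0 <= clamp x <= 1.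
Proof.
by rewrite /clamp le_max lexx /= ge_max ler01 /= ge_min lexx orbT.
Qed.

Lemma clamp0 x : x <= 0 -> clamp x = 0.
Proof. by move=> h; rewrite /clamp max_l // ge_min h. Qed.

Lemma clamp1 x : 1 <= x -> clamp x = 1.
Proof. by move=> h; rewrite /clamp min_r // max_r // ler01. Qed.

Lemma clamp_lip x y : `|clamp x - clamp y| <= `|x - y|.
Proof.
wlog xy : x y / x <= y.
  by move=> H; have [/H //|/ltW /H] := leP x y; rewrite distrC [X in _ <= X]distrC.
have h : clamp x <= clamp y <= clamp x + (y - x).
  have [y0|y0] := leP y 0; first by rewrite !clamp0; lra.
  have [x1|x1] := leP 1 x; first by rewrite !clamp1; lra.
  have [x0|x0] := leP x 0; have [y1|y1] := leP 1 y; rewrite ?(clamp0 x0) ?(clamp1 y1) ?[clamp y]clamp_id ?[clamp x]clamp_id; lra.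
by rewrite distrC [X in _ <= X]distrC !ger0_norm; lra.
Qed.

Definition lip k (phi : C -> R) := forall z w, `|phi w - phi z| <= k * cmod (w - z).

Lemma lip_Re : lip 1 (@Re R).
Proof. by move=> z w; rewrite mul1r -cReN -cReD cmod_Re. Qed.

Lemma lip_Im : lip 1 (@Im R).
Proof. by move=> z w; rewrite mul1r -cImN -cImD cmod_Im. Qed.

Lemma lip_clamp k phi : lip k phi -> lip k (clamp \o phi).
Proof. by move=> h z w; apply: le_trans (h z w); exact: clamp_lip. Qed.

Lemma lip_affine k phi a b : lip k phi -> lip (`|a| * k) (fun z => a * phi z + b).
Proof.
move=> h z w; rewrite opprD addrACA subrr addr0 -mulrBr normrM -mulrA.
by rewrite ler_wpM2l.
Qed.

Definition curve (g : R -> C) := forall t e, 0 < e ->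
  exists2 d, 0 < d & forall s, `|s - t| < d -> cmod (g s - g t) < e.

Lemma curve_lip g k phi z : curve g -> lip k phi -> ccont (fun w => g (phi w)) z.
Proof.
move=> cg lp; split=> e e0; have [d d0 Hd] := cg (phi z) e e0.
exists (d / (`|k| + 1)); first by rewrite divr_gt0 // ltr_wpDl.
move=> w; rewrite ltr_pdivlMr ?ltr_wpDl // => h; apply: Hd.
apply: le_lt_trans (lp z w) (le_lt_trans _ h).
by rewrite mulrC ler_wpM2l ?cmod_ge0 // (le_trans (ler_norm k)) // lerDl.
Qed.

Lemma curve_real : curve (fun x => x%:C).
Proof. by move=> t e e0; exists e => // s; rewrite -rmorphB cmodR. Qed.

Lemma curve_within (g : R -> C) : {within `[0, 1], continuous g} -> curve (g \o clamp).
Proof.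
move=> /within_continuousP cg t e e0.
have I x : [set` `[0, 1 : R]] (clamp x) by rewrite /= in_itv /= clamp_itv.
have [d d0 Hd] := cg _ (I t) _ e0; exists d => // s st; apply: Hd => //.
by rewrite /ball /= distrC; exact: le_lt_trans (clamp_lip _ _) st.
Qed.

(* The unit square is seen in [C], so that the lemmas on [ccont] apply to homotopies. *)
Definition contracts U (g : R -> C) := exists H : C -> C,
  [/\ forall z, ccont H z,
    forall s t, 0 <= s <= 1 -> 0 <= t <= 1 -> U (H (s +i* t)),
    forall t, 0 <= t <= 1 -> H (0 +i* t) = g t /\ H (1 +i* t) = g 0 &
    forall s, 0 <= s <= 1 -> H (s +i* 0) = g 0 /\ H (s +i* 1) = g 0].

Lemma contracts_homotopic U g : contracts U g -> null_homotopic_in U g.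
Proof.
case=> H [cH HU H01 Hs]; exists (fun p => H (p.1 +i* p.2)); split.
- apply/within_continuousP => -[s t] _ e e0.
  have [d d0 Hd] := ccont_eps (cH (s +i* t)) e0; exists (d / 2); first by rewrite divr_gt0.
  move=> [s' t'] _ [/= h1 h2]; apply: Hd; apply: le_lt_trans (cmod_leD _) _.
  rewrite !(cReD, cReN, cImD, cImN) /=; move: h1 h2; rewrite /ball /= distrC [`|t - _|]distrC; lra.
- by move=> _ [[s t] [/= hs ht] <-]; move: hs ht; rewrite !in_itv /=; exact: HU.
- by move=> t; rewrite in_itv /=; exact: H01.
- by move=> s; rewrite in_itv /=; exact: Hs.
Qed.

Lemma homotopic_contracts U g : null_homotopic_in U g -> contracts U g.
Proof.
case=> H [/within_continuousP cH HU H01 Hs].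
have I x : [set` `[0, 1 : R]] (clamp x) by rewrite /= in_itv /= clamp_itv.
exists (fun z => H (clamp (Re z), clamp (Im z))); split.
- move=> z; split=> e e0.
  have [d d0 Hd] := cH (clamp (Re z), clamp (Im z)) (conj (I _) (I _)) e e0.
  exists d => // w wz; apply: Hd; first by split; exact: I.
  split; rewrite /ball /= distrC; apply: le_lt_trans (clamp_lip _ _) _;
    apply: le_lt_trans wz; rewrite -?cReN -?cImN -?cReD -?cImD; [exact: cmod_Re|exact: cmod_Im].
- by move=> s t _ _; apply: HU; exists (clamp s, clamp t) => //; split; exact: I.
- have h0 : 0 <= (0 : R) <= 1 by rewrite lexx ler01.
  have h1 : 0 <= (1 : R) <= 1 by rewrite lexx ler01.
  by move=> t ht /=; rewrite !clamp_id //; apply: H01; rewrite in_itv.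
- have h0 : 0 <= (0 : R) <= 1 by rewrite lexx ler01.
  have h1 : 0 <= (1 : R) <= 1 by rewrite lexx ler01.
  by move=> s hs /=; rewrite !clamp_id //; apply: Hs; rewrite in_itv.
Qed.

Lemma contracts_eq U g g' : (forall t, 0 <= t <= 1 -> g t = g' t) -> contracts U g -> contracts U g'.
Proof.
move=> e [H [cH HU H01 Hs]]; exists H.
have e0 : g 0 = g' 0 by apply: e; rewrite lexx ler01.
split=> // [t ht|s hs]; first by rewrite -e0 -e //; exact: H01.
by rewrite -e0; exact: Hs.
Qed.

Lemma contracts_cst U c : U c -> contracts U (fun=> c).
Proof. by move=> Uc; exists (fun=> c); split=> // z; exact: ccont_cst. Qed.

(** The straight-line homotopy from [g] to [g'] is followed by the contraction of [g']. The
    parameters [b] and [a] run through the unit interval one after the other, so that one formula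
    covers both halves and is visibly continuous. *)
Lemma contracts_straight U g g' : curve g -> curve g' -> g 0 = g' 0 -> g 1 = g' 1 ->
  (forall s t, 0 <= s <= 1 -> 0 <= t <= 1 -> U (g' t + (1 - s)%:C * (g t - g' t))) ->
  contracts U g' -> contracts U g.
Proof.
move=> cg cg' e0 e1 seg [H [cH HU H01 Hs]].
pose a z := clamp (2 * Re z + -1); pose b z := clamp (2 * Re z + 0).
exists (fun z => H ((a z)%:C + 'i * (clamp (Im z))%:C) + (1 - b z)%:C * (g (Im z) - g' (Im z))).
have i0 : 0 <= (0 : R) <= 1 by rewrite lexx ler01.
have i1 : 0 <= (1 : R) <= 1 by rewrite lexx ler01.
have pe s t : (s%:C + 'i * t%:C : C) = s +i* t.
  by apply/eqP; rewrite eq_complex /= !mul0r !mul1r !subr0 !addr0 !add0r !eqxx.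
have E s t : 0 <= s <= 1 -> 0 <= t <= 1 ->
   H ((a (s +i* t))%:C + 'i * (clamp t)%:C) + (1 - b (s +i* t))%:C * (g t - g' t) =
   if s <= 2^-1 then g' t + (1 - 2 * s)%:C * (g t - g' t) else H ((2 * s - 1) +i* t).
  move=> hs ht; rewrite pe clamp_id // /a /b /=; case: ifPn => h.
    rewrite clamp0 ?(proj1 (H01 _ _)) //; last by lra.
    by rewrite addr0 clamp_id //; lra.
  by rewrite [clamp (_ + 0)]clamp1 ?subrr ?mul0r ?addr0 ?clamp_id //; lra.
split.
- move=> z; apply: ccontD; last apply: ccontM.
  + apply: (@ccont_comp _ H) => //; apply: ccontD; last apply: ccontM.
    * by apply: (curve_lip z curve_real); apply/lip_clamp/lip_affine/lip_Re.
    * exact: ccont_cst.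
    * by apply: (curve_lip z curve_real); apply/lip_clamp/lip_Im.
  + apply: (@ccont_near _ (fun w => 1 - (b w)%:C)).
      apply: ccontB; first exact: ccont_cst.
      by apply: (curve_lip z curve_real); apply/lip_clamp/lip_affine/lip_Re.
    by near=> w; rewrite rmorphB.
  + by apply: ccontB; [apply: (curve_lip z cg)|apply: (curve_lip z cg')]; exact: lip_Im.
- move=> s t hs ht; rewrite /= E //; case: ifPn => h; first by apply: seg => //; lra.
  by apply: HU => //; lra.
- move=> t ht; rewrite /= !E // invr_ge0 ler0n ifF; last by apply/negbTE; rewrite -ltNge; lra.
  rewrite mulr0 subr0 mul1r addrC subrK; split=> //.
  have -> : 2 * 1 - 1 = 1 :> R by lra.
  by rewrite (proj2 (H01 _ _)).
move=> s hs; rewrite /= !E // -e0 -e1 !subrr !mulr0 !addr0.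
case: ifPn => h; last first.
  by have [|-> ->] := Hs (2 * s - 1); [lra|rewrite e0].
split=> //; rewrite e1; have [_ h1] := Hs _ i0.
by have [<- _] := H01 _ i1; rewrite h1 e0.
Unshelve. all: by end_near. Qed.

(** The polygon with vertices [l], the vertex number [k] being reached at [x = k]. Each side
    contributes a clamped term, which makes continuity clear. *)
Fixpoint pline (l : seq C) (x : R) : C :=
  if l is a :: l' then
    if l' is b :: _ then pline l' (x - 1) + (1 - clamp x)%:C * (a - b) else a
  else 0.

Lemma pline_cons a b l x : pline [:: a, b & l] x = pline (b :: l) (x - 1) + (1 - clamp x)%:C * (a - b).
Proof. by []. Qed.

Lemma curve_pline l : curve (pline l).
Proof.
have cst c : curve (fun=> c) by move=> t e e0; exists 1 => // s _; rewrite subrr cmod0.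
elim: l => [|a [|b l] IH]; [exact: cst|exact: cst|].
move=> t e e0; have e2 : 0 < e / 2 by rewrite divr_gt0.
have [d1 d10 H1] := IH (t - 1) _ e2.
have M : 0 < cmod (a - b) + 1 by rewrite ltr_wpDl ?cmod_ge0.
exists (Num.min d1 (e / 2 / (cmod (a - b) + 1))); first by rewrite lt_min d10 divr_gt0.
move=> s; rewrite lt_min ltr_pdivlMr // => /andP [h1 h2]; rewrite !pline_cons.
rewrite opprD addrACA -mulrBl -rmorphB; apply: le_lt_trans (cmodD _ _) _.
have -> : e = e / 2 + e / 2 by lra.
apply: ltr_leD; first by apply: H1; rewrite opprB addrA subrK.
have -> : 1 - clamp s - (1 - clamp t) = clamp t - clamp s by ring.
rewrite cmodM [X in X * _](_ : _ = `|clamp t - clamp s|); last exact: cmodR.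
apply: le_trans (ltW h2); apply: ler_pM; rewrite ?normr_ge0 ?cmod_ge0 ?lerDl //.
by rewrite distrC; exact: clamp_lip.
Qed.

Lemma pline_le0 a l x : x <= 0 -> pline (a :: l) x = a.
Proof.
elim: l a x => [|b l IH] a x x0 //; rewrite pline_cons IH; last by lra.
by rewrite clamp0 // subr0 mul1r addrC subrK.
Qed.

Lemma pline_first a b l x : 0 <= x <= 1 -> pline [:: a, b & l] x = b + (1 - x)%:C * (a - b).
Proof. by move=> h; rewrite pline_cons pline_le0 ?clamp_id //; lra. Qed.

Lemma pline_next a b l x : 1 <= x -> pline [:: a, b & l] x = pline (b :: l) (x - 1).
Proof. by move=> h; rewrite pline_cons clamp1 // subrr mul0r addr0. Qed.

Lemma pline_last a l x : (size l)%:R <= x -> pline (a :: l) x = last a l.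
Proof.
elim: l a x => [|b l IH] a x // h; rewrite pline_next ?IH //=.
  by move: h; rewrite /= -natr1; lra.
by apply: le_trans h; rewrite ler1n.
Qed.

Lemma pline_nseq a k x : pline (nseq k.+1 a) x = a.
Proof. by elim: k x => // k IH x; rewrite [nseq _ _]/= pline_cons IH subrr mulr0 addr0. Qed.

Lemma pline_nth (l : seq C) k x : (k.+1 < size l)%N -> k%:R <= x <= k.+1%:R ->
  pline l x = nth 0 l k.+1 + (k.+1%:R - x)%:C * (nth 0 l k - nth 0 l k.+1).
Proof.
elim: k l x => [|k IH] [|a [|b l]] // x; first by move=> _; exact: pline_first.
rewrite ltnS => sl h; rewrite pline_next; last first.
  by case/andP: h => h _; apply: le_trans h; rewrite ler1n.
have h' : k%:R <= x - 1 <= k.+1%:R by move: h; rewrite -![_.+1%:R]natr1; lra.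
rewrite (IH (b :: l) _ sl h') /=; congr (_ + (_ : R)%:C * _).
by rewrite -[k.+2%:R]natr1; lra.
Qed.

Definition cvx_set (K : C -> Prop) := forall z w (s : R), K z -> K w -> 0 <= s <= 1 -> K (w + s%:C * (z - w)).

(** Replacing one vertex changes two sides only, and these join points of the convex set [K]. *)
Lemma pline_step (K : C -> Prop) (u : seq C) (a x y b : C) t r : cvx_set K -> K a -> K x -> K y -> K b -> 0 <= r ->
  pline (u ++ [:: a, x, b & t]) r = pline (u ++ [:: a, y, b & t]) r \/
  K (pline (u ++ [:: a, x, b & t]) r) /\ K (pline (u ++ [:: a, y, b & t]) r).
Proof.
move=> cK Ka Kx Ky Kb.
have base r' : 0 <= r' -> pline [:: a, x, b & t] r' = pline [:: a, y, b & t] r' \/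
    K (pline [:: a, x, b & t] r') /\ K (pline [:: a, y, b & t] r').
  move=> r0; have [r1|r1] := leP r' 1.
    by right; rewrite !pline_first ?r0 //; split; apply: cK => //; lra.
  rewrite !(@pline_next a) ?(ltW r1) //.
  have [r2|r2] := leP (r' - 1) 1.
    by right; rewrite !pline_first //; try lra; split; apply: cK => //; lra.
  by left; rewrite !pline_next // ltW.
elim: u r => [|e u IH] r r0; first exact: base.
have cc z : exists l h, u ++ [:: a, z, b & t] = h :: l /\ h = head a u.
  by case: u {IH} => [|h u]; [exists [:: z, b & t], a|exists (u ++ [:: a, z, b & t]), h].
have [l1 [h1 [e1 eh1]]] := cc x; have [l2 [h2 [e2 eh2]]] := cc y.
rewrite /= -/(pline _ _) e1 e2.
have [r1|r1] := leP r 1.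
  by left; rewrite -!/(pline [:: _, _ & _] _) !pline_first ?r0 // eh1 eh2.
have := IH (r - 1); rewrite e1 e2 -!/(pline [:: _, _ & _] _) !(@pline_next e) ?(ltW r1) //.
by apply; lra.
Qed.

End homotopies.

(** * Square cells in the plane and polygons along walks *)

Section grid.
Context {R : realType}.
Local Notation C := R[i].
Local Notation cell := (int * int)%type.
Implicit Types (z w : C) (U : set C) (c p q : cell).

Lemma curve_scale (g : R -> C) k : curve g -> curve (fun t => g (k * t)).
Proof.
move=> cg t e /(cg (k * t)) [d d0 Hd]; exists (d / (`|k| + 1)); first by rewrite divr_gt0 // ltr_wpDl.
move=> s; rewrite ltr_pdivlMr ?ltr_wpDl // => h; apply: Hd; apply: le_lt_trans h.
by rewrite -mulrBr normrM mulrC ler_wpM2l // lerDl.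
Qed.

Lemma contracts_in U (g : R -> C) t : contracts U g -> 0 <= t <= 1 -> U (g t).
Proof.
case=> H [_ HU H01 _] ht; have [<- _] := H01 _ ht.
by apply: HU; rewrite ?lexx ?ler01.
Qed.

Lemma cdisc_convex a (r : R) : cvx_set (cdisc a r).
Proof.
move=> z w s hz hw hs; rewrite /cdisc /=.
have -> : w + s%:C * (z - w) - a = s%:C * (z - a) + (1 - s)%:C * (w - a) by rewrite rmorphB rmorph1; ring.
apply: le_lt_trans (cmodD _ _) _; rewrite !cmodM !(@cmodR R) !ger0_norm; try lra.
move: hz hw; rewrite /cdisc /=; move: (cmod (z - a)) (cmod (w - a)) => x y xr yr.
have [xy|/ltW xy] := leP x y; [apply: le_lt_trans yr|apply: le_lt_trans xr]; nra.
Qed.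

Section cells.
Variables (o : C) (d : R).
Hypothesis d0 : 0 < d.

Definition center c : C := (Re o + d * c.1%:~R) +i* (Im o + d * c.2%:~R).
Definition incell (r : R) c z := `|Re z - Re (center c)| <= r /\ `|Im z - Im (center c)| <= r.

(** Quantifying over all enclosing intervals avoids an order of [a] and [b], and convexity follows
    at once. *)
Definition between (a b x : R) := forall lo hi, lo <= a <= hi -> lo <= b <= hi -> lo <= x <= hi.

Definition hull p q z := between (Re (center p)) (Re (center q)) (Re z) /\
  between (Im (center p)) (Im (center q)) (Im z).

Lemma between_convex a b x y (s : R) : between a b x -> between a b y -> 0 <= s <= 1 ->
  between a b (y + s * (x - y)).
Proof. by move=> hx hy hs lo hi ha hb; have := hx _ _ ha hb; have := hy _ _ ha hb; nra. Qed.

Lemma hull_convex p q : cvx_set (hull p q).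
Proof.
move=> z w s [h1 h2] [h3 h4] hs.
by split; rewrite ?(mulrC s%:C) ?(cReD, cImD, cReMr, cImMr, cReN, cImN) mulrC; exact: between_convex.
Qed.

Lemma hull_center p q c : inrect p q c -> hull p q (center c).
Proof.
move=> /andP [h1 h2]; split; move=> lo hi /=.
  by case/orP: h1 => /eqP ->.
by case/orP: h2 => /eqP ->.
Qed.

Lemma between_cell (a b : int) (l x : R) : a <= b + 1 -> b <= a + 1 ->
  between (l + d * a%:~R) (l + d * b%:~R) x ->
  exists2 e, (e == a) || (e == b) & `|x - (l + d * e%:~R)| <= d / 2.
Proof.
wlog ab : a b / a <= b.
  move=> H h1 h2 h; have [ab|ba] := leP a b; first exact: H.
  have [|e h3 h4] := H b a (ltW ba) h2 h1; first by move=> lo hi h5 h6; exact: h.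
  by exists e => //; rewrite orbC.
move=> _ ba h.
have e : b%:~R = a%:~R + (b - a)%:~R :> R by rewrite -intrD addrC subrK.
have [h0 h1] : 0 <= (b - a)%:~R :> R /\ (b - a)%:~R <= 1 :> R.
  by rewrite ler0z lerz1; lia.
have g0 := mulr_ge0 (ltW d0) h0; have g1 : d * (b - a)%:~R <= d by rewrite ler_piMr // ltW.
have hx : l + d * a%:~R <= x <= l + d * b%:~R by apply: h; rewrite e mulrDr; lra.
have hb : d * b%:~R <= d * a%:~R + d by rewrite e mulrDr; lra.
have [hd|hd] := leP (x - (l + d * a%:~R)) (d / 2).
  by exists a; rewrite ?eqxx // ger0_norm; lra.
by exists b; rewrite ?eqxx ?orbT // ler0_norm; lra.
Qed.

Lemma hull_incell p q z : king p q -> hull p q z -> exists2 c, inrect p q c & incell (d / 2) c z.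
Proof.
case/and4P=> h1 h2 h3 h4 [hr hi].
have [e1 e1E h5] := between_cell h1 h2 hr; have [e2 e2E h6] := between_cell h3 h4 hi.
by exists (e1, e2); rewrite /inrect /= ?e1E.
Qed.

Definition walkline (s : seq cell) (t : R) := pline (map center s) ((size s).-1%:R * t).

(** At each time the two polygons agree or both lie in the hull of one rectangle of centres; the
    hull is covered by the cells of the rectangle, hence lies in [U]. *)
Lemma deform_contracts U (W : pred cell) s s' : (forall c z, W c -> incell (d / 2) c z -> U z) ->
  deform W s s' -> contracts U (walkline s') -> contracts U (walkline s).
Proof.
move=> WU D; elim: D => // {s s'} u a x y b t p q s kpq rW ha hx hy hb _ IH /IH.
set l1 := u ++ [:: a, x, b & t]; set l2 := u ++ [:: a, y, b & t] => cl.
have sz : size l1 = size l2 by rewrite !size_cat.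
have U2 r : 0 <= r <= 1 -> U (walkline l2 r) by move=> hr; exact: contracts_in cl hr.
have hd (z : cell) : exists l, u ++ [:: a, z, b & t] = head a u :: l /\ last (head a u) l = last b t.
  case: (u) => [|h u']; first by exists [:: z, b & t].
  by exists (u' ++ [:: a, z, b & t]); rewrite last_cat.
apply: contracts_straight cl.
- by apply: curve_scale; exact: curve_pline.
- by apply: curve_scale; exact: curve_pline.
- by have [m1 [e1 _]] := hd x; have [m2 [e2 _]] := hd y; rewrite /walkline !mulr0 /l1 /l2 e1 e2 !map_cons !pline_le0.
- have [m1 [e1 L1]] := hd x; have [m2 [e2 L2]] := hd y.
  rewrite /walkline !mulr1 /l1 /l2 e1 e2 !map_cons !pline_last ?size_map //.
  by rewrite !last_map L1 L2.
- move=> r r' hr hr'; rewrite /walkline sz.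
  have r0 : 0 <= (size l2).-1%:R * r' by case/andP: hr' => h _; rewrite mulr_ge0.
  have := U2 _ hr'; rewrite /walkline; move: r0; move: (_ * r') => k k0 Uk.
  have := @pline_step R _ (map center u) _ _ _ _ (map center t) k (@hull_convex p q)
    (hull_center ha) (hull_center hx) (hull_center hy) (hull_center hb) k0.
  rewrite -!(map_cons center) -!map_cat -/l1 -/l2 => -[->|[H1 H2]].
    by rewrite subrr mulr0 addr0.
  have [|c hc ic] := hull_incell kpq (hull_convex H1 H2 (s := 1 - r) _); first by lra.
  exact: WU (rW _ hc) ic.
Qed.

Definition rnd (x : R) : int := Num.floor (x / d + 2^-1).

Lemma rnd_dist x : `|x - d * (rnd x)%:~R| <= d / 2.
Proof.
have := floor_itv (x / d + 2^-1); rewrite -/(rnd x) intrD mulr1z => /andP [h1 h2].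
have [y xy] : exists y, x = y * d by exists (x / d); rewrite divfK // gt_eqF.
move: h1 h2; rewrite xy mulfK ?gt_eqF //; move: (_%:~R : R) => k h1 h2.
have -> : y * d - d * k = (y - k) * d by ring.
rewrite normrM (gtr0_norm d0) mulrC ler_pM2l // ler_norml; lra.
Qed.

Lemma rnd0 : rnd 0 = 0.
Proof. by apply/eqP; rewrite /rnd mul0r floor_eq /=; lra. Qed.

Lemma rnd_lip x y : `|x - y| < d -> rnd x <= rnd y + 1 /\ rnd y <= rnd x + 1.
Proof.
wlog suff H : x y / `|x - y| < d -> rnd x <= rnd y + 1.
  by move=> h; split; apply: H => //; rewrite distrC.
have := rnd_dist x; have := rnd_dist y; rewrite !ler_norml ltr_norml => h1 h2 h3.
suff : (rnd x)%:~R < (rnd y + 2)%:~R :> R by rewrite ltr_int; lia.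
by rewrite intrD -(ltr_pM2l d0) mulrDr; lra.
Qed.

Lemma near_cell (a : int) (l x : R) : `|x - (l + d * a%:~R)| <= d ->
  exists2 e, (a <= e + 1) && (e <= a + 1) & `|x - (l + d * e%:~R)| <= d / 2.
Proof.
rewrite ler_norml => h.
have [h1|h1] := ltP (x - (l + d * a%:~R)) (- (d / 2)).
  by exists (a - 1); rewrite ?ler_norml ?intrB ?mulrBr ?mulr1; [lia|lra].
have [h2|h2] := ltP (d / 2) (x - (l + d * a%:~R)).
  by exists (a + 1); rewrite ?ler_norml ?intrD ?mulrDr ?mulr1; [lia|lra].
by exists a; rewrite ?ler_norml; [lia|lra].
Qed.

Lemma incell_near c z : incell d c z -> exists2 c', king c c' & incell (d / 2) c' z.
Proof.
case=> /near_cell [e1 h1 k1] /near_cell [e2 h2 k2]; exists (e1, e2) => //.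
by rewrite /king /=; move: h1 h2 => /andP [-> ->] /andP [-> ->].
Qed.

Lemma incell_leD r r' c z w : r <= r' -> incell r c z -> cmod (w - z) <= r' - r -> incell r' c w.
Proof.
move=> rr [h1 h2] wz; split.
  apply: le_trans (ler_distD (Re z) _ _) _; have := le_trans (cmod_Re _) wz.
  by rewrite cReD cReN; lra.
apply: le_trans (ler_distD (Im z) _ _) _; have := le_trans (cmod_Im _) wz.
by rewrite cImD cImN; lra.
Qed.

End cells.

(** * A loop that does not contract surrounds a point outside the domain *)

Section surround.
Variables (U : set C) (g : R -> C) (d : R).
Hypotheses (cg : curve g) (g01 : g 0 = g 1) (d0 : 0 < d).
Hypothesis gU : forall t z, 0 <= t <= 1 -> cmod (z - g t) < 8 * d -> U z.

Let o := g 0.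
Notation center := (center o d).
Notation incell := (incell o d).

Let near_curve c : Prop := exists2 t, 0 <= t <= 1 & incell (2 * d) c (g t).

(** Each coordinate deviates by at most [3 * d] from that of [g t], so that the distance is at most
    [6 * d], within the margin of [gU]. *)
Let near_curve_in c z : near_curve c -> incell d c z -> U z.
Proof.
case=> t ht [h1 h2] [h3 h4]; apply: (gU ht); apply: le_lt_trans (cmod_leD _) _.
rewrite cReD cReN cImD cImN.
have := ler_distD (Re (center c)) (Re z) (Re (g t)); have := ler_distD (Im (center c)) (Im z) (Im (g t)).
rewrite ![`|_ (center c) - _|]distrC => h5 h6.
apply: le_lt_trans (lerD h6 h5) _; apply: le_lt_trans (lerD (lerD h3 h1) (lerD h4 h2)) _. have := d0; lra.
Qed.

Let fine_partition : exists2 n, (0 < n)%N & forall s t, 0 <= t <= 1 -> `|s - t| <= n%:R^-1 -> cmod (g s - g t) < d / 2.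
Proof.
(* Uniform continuity of [g], with the interval seen as the set of real parts of the unit disc,
   since [compact_uniform] is stated in [C]. *)
have [e e0 He] : exists2 e, 0 < e & forall z : C, cmod z <= 1 ->
    forall s, `|s - Re z| < e -> cmod (g s - g (Re z)) < d / 2.
  have cK : compact [set z : C | cmod z <= 1].
    by have := @compact_closed_cdisc R 0 1; under eq_fun do rewrite subr0.
  apply: (compact_uniform (P := fun e z => forall s, `|s - Re z| < e -> cmod (g s - g (Re z)) < d / 2) cK).
    by move=> e e' z ee' H s h; apply: H; exact: lt_le_trans h ee'.
  move=> z _; have [e e0 He] := @cg (Re z) (d / 4) (ltac:(by rewrite divr_gt0)).
  exists (e / 2); first by rewrite divr_gt0.
  move=> w wz s sw; have wz' : `|Re w - Re z| < e / 2.
    by rewrite -cReN -cReD; exact: le_lt_trans (cmod_Re _) wz.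
  apply: le_lt_trans (cmod_distD (g (Re z)) _ _) _; rewrite [cmod (g (Re z) - _)]cmodB.
  have h1 : cmod (g s - g (Re z)) < d / 4.
    by apply: He; apply: le_lt_trans (ler_distD (Re w) _ _) _; lra.
  have h2 : cmod (g (Re w) - g (Re z)) < d / 4 by apply: He; lra.
  by lra.
exists (Num.bound e^-1).+1 => // s t ht st; have := He t%:C; rewrite cmodR /=; apply; first by rewrite ger0_norm; lra.
apply: le_lt_trans st _; rewrite -[ltRHS]invrK ltf_pV2 ?posrE ?invr_gt0 ?ltr0n //.
by apply: lt_trans (archi_boundP _) _; rewrite ?invr_ge0 ?(ltW e0) // ltr_nat.
Qed.

Let curve_boxed : exists m : nat, forall c, near_curve c -> boxed m%:Z c.
Proof.
have cK : compact [set z : C | cmod z <= 1].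
  by have := @compact_closed_cdisc R 0 1; under eq_fun do rewrite subr0.
have [||c _ Hc] := compact_max_cmod (f := fun z => cmod (g (Re z))) cK.
- by exists 0; apply: (@le_trans _ _ 0); [rewrite (@cmod0 R)|exact: ler01].
- move=> z _; apply/continuous_cmod_comp/ccont_continuous; exact: (curve_lip z cg (@lip_Re R)).
have {Hc} Hc t : 0 <= t <= 1 -> cmod (g t) <= cmod (g (Re c)).
  move=> ht; apply: (Hc t%:C); apply: (@le_trans _ _ `|t|); first by rewrite -(@cmodR R).
  by rewrite ger0_norm; lra.
move: (cmod _) Hc => B Hc.
have o_le : cmod o <= B by apply: Hc; rewrite lexx ler01.
have B0 : 0 <= B by apply: le_trans o_le; exact: cmod_ge0.
pose k := (B + B + 2 * d) / d.
have k0 : 0 <= k by rewrite divr_ge0 ?(ltW d0) //; have := d0; lra.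
exists (Num.bound k) => -[i j] [t ht [/= h1 h2]].
have hi (x y : R) (n : int) : `|x| <= B -> `|y| <= B -> `|x - (y + d * n%:~R)| <= 2 * d -> `|n%:~R| <= k.
  rewrite /k ler_pdivlMr // !ler_norml => a1 a2 a3.
  by rewrite -[X in _ * X](gtr0_norm d0) -normrM ler_norml mulrC; lra.
have := hi _ _ _ (le_trans (cmod_Re _) (Hc _ ht)) (le_trans (cmod_Re _) o_le) h1.
have := hi _ _ _ (le_trans (cmod_Im _) (Hc _ ht)) (le_trans (cmod_Im _) o_le) h2.
have := archi_boundP k0; move: (Num.bound k) => N kN hj hi'.
have li (n : int) : `|n%:~R| <= k -> - N%:Z <= n <= N%:Z.
  move=> /le_lt_trans /(_ kN); rewrite ltr_norml -[N%:R]/(N%:Z%:~R) -intrN !ltr_int; clear; lia.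
by rewrite /boxed /=; have := li _ hj; have := li _ hi'; clear; lia.
Qed.

Hypothesis ng : ~ contracts U g.

(** The curve is followed by a closed walk in the filled set [W], which contracts there. If the
    cells of [W] were all in [U], the curve would contract in [U]; so one leaves [U], and the
    interior of the union of these cells is the required set. A boundary point can only lie near a
    cell of [V0], because all neighbours of the other cells of [W] are in [W]. *)
Theorem grid_surrounds : exists Om : set C, [/\ open Om, exists B, forall z, Om z -> cmod z <= B,
  forall z, (forall e, 0 < e -> exists2 w, Om w & cmod (w - z) < e) -> ~ Om z -> U z &
  exists2 z, Om z & ~ U z].
Proof.
have D0 := d0; have [n n0 fine] := fine_partition; have [m Vbox] := curve_boxed.
pose V0 : pred cell := fun c => `[< near_curve c >].
(* The cells near the curve together with those that they separate from the outside of the box. *)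
pose W : pred cell := fun c => `[< ~ escapes V0 m%:Z c >].
have V0W c : V0 c -> W c.
  by move=> h; apply/asboolP => -[s _ [/=]]; rewrite h.
have bW c : W c -> boxed m%:Z c.
  move=> /asboolP h; apply: contrapT => /negP nb; apply: h.
  by exists [::] => //=; split=> //; rewrite andbT; apply/negP => /asboolP /Vbox; apply/negP.
have fV c : ~~ W c -> escapes V0 m%:Z c by move=> /asboolPn /contrapT.
have fW c : ~~ W c -> escapes W m%:Z c.
  move=> /fV [s ps [al out]]; exists s => //; split=> //.
  elim: s c ps al out => [|b s IH] c /=.
    move=> _ /andP [h _] out; rewrite andbT; apply/negP => /asboolP; apply.
    by exists [::] => //=; rewrite h.
  move=> /andP [kcb ps] /and3P [h1 h2 h3] out; have h23 : all (fun c => ~~ V0 c) (b :: s) by rewrite /= h2.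
  have /= -> := IH _ ps h23 out; rewrite andbT; apply/negP => /asboolP; apply.
  by exists (b :: s) => /=; [rewrite kcb|rewrite h1 h2].
have Wking c b : W c -> ~~ V0 c -> king c b -> W b.
  move=> /asboolP Wc nV k; apply/asboolP => -[s ps [al out]]; apply: Wc.
  by exists (b :: s) => /=; [rewrite k|rewrite nV].
pose tk k : R := k%:R / n%:R.
have nR : 0 < n%:R :> R by rewrite ltr0n.
have tk01 k : (k <= n)%N -> 0 <= tk k <= 1.
  by move=> kn; rewrite /tk divr_ge0 //= ler_pdivrMr // mul1r ler_nat.
(* At even indices [u] is the cell nearest to a point of the curve; the odd indices are intermediate
   cells, where only the first coordinate has been updated, so that all steps are rook moves. *)
pose I k := rnd d (Re (g (tk k)) - Re o); pose J k := rnd d (Im (g (tk k)) - Im o).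
pose u k : cell := (I (uphalf k), J k./2).
have o01 : g (tk n) = o by rewrite /tk divff ?gt_eqF.
have o00 : g (tk 0%N) = o by rewrite /tk mul0r.
have u0 : u 0%N = (0, 0) by rewrite /u /I /J o00 !subrr rnd0.
have un : u n.*2 = (0, 0) by rewrite /u uphalf_double doubleK /I /J o01 !subrr rnd0.
have step k : (k < n)%N -> cmod (g (tk k.+1) - g (tk k)) < d / 2.
  move=> kn; apply: fine; first by apply: tk01; exact: ltnW.
  by rewrite /tk -mulrBl -natr1 addrAC subrr add0r mul1r ger0_norm ?invr_ge0 ?(ltW nR).
have uwalk k : (k < n.*2)%N -> rook (u k) (u k.+1).
  move=> kn; have h2 : (k./2 < n)%N by lia.
  have [|i1 i2] := rnd_lip d0 (x := Re (g (tk k./2.+1)) - Re o) (y := Re (g (tk k./2)) - Re o).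
    rewrite opprB addrA subrK -cReN -cReD; apply: le_lt_trans (cmod_Re _) _; have := step _ h2; lra.
  have [|j1 j2] := rnd_lip d0 (x := Im (g (tk k./2.+1)) - Im o) (y := Im (g (tk k./2)) - Im o).
    rewrite opprB addrA subrK -cImN -cImD; apply: le_lt_trans (cmod_Im _) _; have := step _ h2; lra.
  rewrite -/(I _) -/(I _) in i1 i2; rewrite -/(J _) -/(J _) in j1 j2.
  rewrite /rook /king /u [uphalf k.+1]/=; have [ok|ek] := boolP (odd k).
    have -> : uphalf k = k./2.+1 by lia.
    have -> : k.+1./2 = k./2.+1 by lia.
    by rewrite /= eqxx /= andbT lerDl /= j1 j2.
  have -> : uphalf k = k./2 by lia.
  have -> : k.+1./2 = k./2 by lia.
  by rewrite /= eqxx orbT andbT lerDl /= i1 i2.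
have unear k : (k <= n.*2)%N -> `|Re (center (u k)) - Re (g (tk k./2))| <= d /\
    `|Im (center (u k)) - Im (g (tk k./2))| <= d / 2.
  move=> kn; have hI j : `|Re o + d * (I j)%:~R - Re (g (tk j))| <= d / 2.
    have := rnd_dist d0 (Re (g (tk j)) - Re o); rewrite -/(I j) distrC => h.
    by rewrite (_ : _ - _ = d * (I j)%:~R - (Re (g (tk j)) - Re o)) //; ring.
  have hJ j : `|Im o + d * (J j)%:~R - Im (g (tk j))| <= d / 2.
    have := rnd_dist d0 (Im (g (tk j)) - Im o); rewrite -/(J j) distrC => h.
    by rewrite (_ : _ - _ = d * (J j)%:~R - (Im (g (tk j)) - Im o)) //; ring.
  split; last exact: hJ.
  rewrite /u /=; have [ok|ek] := boolP (odd k).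
    have -> : uphalf k = k./2.+1 by lia.
    have h2 : (k./2 < n)%N by lia.
    apply: le_trans (ler_distD (Re (g (tk k./2.+1))) _ _) _; have := hI k./2.+1.
    have : `|Re (g (tk k./2.+1)) - Re (g (tk k./2))| < d / 2.
      by rewrite -cReN -cReD; exact: le_lt_trans (cmod_Re _) (step _ h2).
    by lra.
  have -> : uphalf k = k./2 by lia.
  by apply: le_trans (hI _) _; lra.
have uV k : (k <= n.*2)%N -> V0 (u k).
  move=> kn; apply/asboolP; exists (tk k./2); first by apply: tk01; lia.
  by have [h1 h2] := unear _ kn; rewrite /incell ![`|_ (g _) - _|]distrC; split; lra.
pose s := map u (iota 1 n.*2).
have su : u 0%N :: s = map u (iota 0 n.*2.+1) by [].
have cw : closed_walk W (u 0%N) s.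
  split.
  - suff : sorted rook (u 0%N :: s) by [].
    apply/(sortedP (u 0%N)) => i; rewrite su size_map size_iota => hi.
    by rewrite !(nth_map 0%N) ?size_iota ?nth_iota // ?(ltnW hi) // uwalk.
  - rewrite (last_nth (u 0%N)) su size_map size_iota (nth_map 0%N) ?size_iota // nth_iota //.
    by rewrite add0n un u0.
  - apply/allP => c; rewrite su => /mapP [k]; rewrite mem_iota => hk ->.
    by apply/V0W/uV; lia.
have D := closed_walk_contracts bW fW cw.
have [WU|] := pselect (forall c z, W c -> incell (d / 2) c z -> U z).
  exfalso; apply: ng.
  have c0o : center (u 0%N) = o by rewrite /center u0 /= !mulr0 !addr0; case: (o).
  have Uo : U o by apply: (gU (t := 0)); rewrite ?lexx ?ler01 // subrr cmod0 mulr_gt0.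
  have : contracts U (walkline o d (nseq (size s).+1 (u 0%N))).
    apply: contracts_eq (contracts_cst Uo) => t _.
    by rewrite /walkline map_nseq pline_nseq c0o.
  have sz : (size (u 0%N :: s)).-1 = n.*2 by rewrite su size_map size_iota.
  move=> /(deform_contracts d0 WU D); rewrite /walkline sz.
  apply: contracts_straight => //.
  - by apply: curve_scale; exact: curve_pline.
  - by rewrite mulr0 map_cons pline_le0 // c0o.
  - rewrite mulr1 map_cons pline_last ?size_map ?size_iota //.
    by rewrite last_map; case: cw => _ -> _; rewrite c0o -g01.
  move=> s' t hs' ht; set P := pline _ _.
  (* The side of the polygon at time [t]. The last side is chosen when [t = 1], where truncation
     would give an index out of range. *)
  have [k kn hk] : exists2 k, (k < n.*2)%N & k%:R <= n.*2%:R * t <= k.+1%:R.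
    have x0 : 0 <= n.*2%:R * t by rewrite mulr_ge0 //; case/andP: ht.
    have [h|h] := ltnP (Num.trunc (n.*2%:R * t)) n.*2.
      by exists (Num.trunc (n.*2%:R * t)) => //; have /andP [-> /ltW ->] := truncn_itv x0.
    exists n.*2.-1; first by rewrite ltn_predL double_gt0.
    rewrite prednK ?double_gt0 //; apply/andP; split; last by rewrite ler_piMr //; case/andP: ht.
    by move: h; rewrite truncn_ge_nat // => h; apply: le_trans h; rewrite ler_nat; exact: leq_pred.
  have cen j : (j <= n.*2)%N -> `|j%:R - n.*2%:R * t| <= 1 -> cmod (center (u j) - g t) < 3 * d.
    move=> jn jt; apply: le_lt_trans (cmod_distD (g (tk j./2)) _ _) _.
    have h1 : cmod (g (tk j./2) - g t) < d / 2.
      apply: fine => //; rewrite -(ler_pM2r nR) mulVf ?gt_eqF // -[X in _ * X](gtr0_norm nR) -normrM mulrBl /tk divfK ?gt_eqF //.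
      have e : j = (odd j + j./2.*2)%N by rewrite odd_double_half.
      have ej : j%:R = (odd j)%:R + 2 * (j./2)%:R :> R by rewrite {1}e natrD -mul2n natrM.
      have ob : 0 <= ((odd j)%:R : R) <= 1 by case: (odd j); rewrite ?lexx ?ler01.
      move: jt; rewrite ej -mul2n natrM !ler_norml; lra.
    have [h2 h3] := unear j jn; apply: le_lt_trans (lerD (cmod_leD _) (ltW h1)) _.
    by rewrite cReD cReN cImD cImN; lra.
  have Pn : cmod (P - g t) < 8 * d.
    have := @pline_nth R (map center (u 0%N :: s)) k (n.*2%:R * t).
    rewrite su size_map size_map size_iota ltnS kn hk => /(_ isT isT).
    rewrite /P su => ->.
    have nc j : (j <= n.*2)%N -> (map center (map u (iota 0 n.*2.+1)))`_j = center (u j).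
      by move=> jn; rewrite (nth_map (u 0%N)) ?size_map ?size_iota // (nth_map 0%N) ?size_iota // nth_iota.
    rewrite !nc //; last exact: ltnW.
    have c1 := cen k (ltnW kn); have c2 := cen k.+1 kn.
    have hd : cdisc (g t) (3 * d) `<=` cdisc (g t) (8 * d).
      by move=> z; rewrite /cdisc /= => /lt_trans; apply; rewrite ltr_pM2r // ltr_nat.
    have kS : k.+1%:R = k%:R + 1 :> R by rewrite natr1.
    rewrite kS in hk *; rewrite kS in c2.
    by apply: (hd); apply: cdisc_convex; [apply: c1; rewrite ler_norml|apply: c2; rewrite ler_norml|]; lra.
  have gg : cdisc (g t) (8 * d) (g t) by apply: cdisc_center; rewrite mulr_gt0.
  by apply: (gU ht); apply: (cdisc_convex gg Pn); lra.
move=> /existsNP [c0 /existsNP [z0 /not_implyP [Wc0 /not_implyP [ic0 nU]]]].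
pose X z := exists2 c, W c & incell (d / 2) c z.
have block c z : W c -> ~~ V0 c -> incell d c z -> X z.
  by move=> Wc nV /(incell_near d0) [c' k ic]; exists c' => //; exact: Wking k.
have d2 : d / 2 <= d by lra.
exists [set z | exists2 e, 0 < e & forall w, cmod (w - z) < e -> X w]; split.
- apply/open_cdiscP => z [e e0 He]; exists (e / 2); first by rewrite divr_gt0.
  move=> w wz; exists (e / 2); first by rewrite divr_gt0.
  by move=> v vw; apply: He; apply: le_lt_trans (cmod_distD w _ _) _; lra.
- exists (`|Re o| + `|Im o| + 2 * (d * m%:R) + d) => z [e e0 /(_ z)].
  rewrite subrr (@cmod0 R) => /(_ e0) [[i j] /bW + [/= h1 h2]].
  rewrite /boxed /= => /and4P []; rewrite -!(ler_int R) intrN => i1 i2 j1 j2.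
  have hx (x y : R) (k : int) : `|x - (y + d * k%:~R)| <= d / 2 -> - m%:R <= k%:~R :> R ->
      k%:~R <= m%:R :> R -> `|x| <= `|y| + d * m%:R + d / 2.
    move=> h k1 k2; have : `|d * k%:~R| <= d * m%:R by rewrite normrM gtr0_norm // ler_pM2l // ler_norml k1.
    have := ler_normD (x - (y + d * k%:~R)) (y + d * k%:~R); have := ler_normD y (d * k%:~R).
    by rewrite subrK; lra.
  apply: le_trans (cmod_leD _) _; have := hx _ _ _ h1 i1 i2; have := hx _ _ _ h2 j1 j2; lra.
- move=> z /(_ (d / 4)) [|w [e e0 /(_ w)]]; first by rewrite divr_gt0.
  rewrite subrr (@cmod0 R) => /(_ e0) [c Wc ic] wz nO.
  have [Vc|nV] := boolP (V0 c).
    move/asboolP: Vc => /near_curve_in; apply; apply: (incell_leD d2 ic).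
    by rewrite cmodB; lra.
  exfalso; apply: nO; exists (d / 4); first by rewrite divr_gt0.
  move=> v vz; apply: (block c) => //; apply: (incell_leD d2 ic).
  by apply: le_trans (cmod_distD z _ _) _; move: wz; rewrite cmodB; lra.
have nV : ~~ V0 c0.
  apply/negP => /asboolP /near_curve_in h; apply: nU; apply: h.
  by apply: (incell_leD d2 ic0); rewrite subrr (@cmod0 R); lra.
exists z0 => //; exists (d / 2); first by rewrite divr_gt0.
by move=> v vz; apply: (block c0) => //; apply: (incell_leD d2 ic0); lra.
Qed.

End surround.

Theorem loop_surrounds U gamma : open U -> loop_in U gamma -> ~ null_homotopic_in U gamma ->
  exists Om : set C, [/\ open Om, exists B, forall z, Om z -> cmod z <= B,
  forall z, (forall e, 0 < e -> exists2 w, Om w & cmod (w - z) < e) -> ~ Om z -> U z &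
  exists2 z, Om z & ~ U z].
Proof.
move=> /open_cdiscP oU [cgam g01 gU] nh.
pose g := gamma \o clamp; have cg : curve g := curve_within cgam.
have i0 : 0 <= (0 : R) <= 1 by rewrite lexx ler01.
have i1 : 0 <= (1 : R) <= 1 by rewrite lexx ler01.
have ng : ~ contracts U g.
  move=> h; apply/nh/contracts_homotopic; apply: contracts_eq h => t ht.
  by rewrite /g /= clamp_id.
have Ug t : U (g t) by apply: gU; exists (clamp t) => //=; rewrite in_itv /= clamp_itv.
have [r r0 Hr] : exists2 r, 0 < r & forall z : C, cmod z <= 1 -> forall w, cmod (w - g (Re z)) < r -> U w.
  have cK : compact [set z : C | cmod z <= 1].
    by have := @compact_closed_cdisc R 0 1; under eq_fun do rewrite subr0.
  apply: (compact_uniform (P := fun e z => forall w, cmod (w - g (Re z)) < e -> U w) cK).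
    by move=> e e' z ee' H w h; apply: H; exact: lt_le_trans h ee'.
  move=> z _; have [e e0 He] := oU _ (Ug (Re z)).
  have e2 : 0 < e / 2 by rewrite divr_gt0.
  have [d d0 Hd] := cg (Re z) _ e2.
  exists (Num.min d (e / 2)); first by rewrite lt_min d0.
  move=> w; rewrite lt_min => /andP [wd we] v; rewrite lt_min => /andP [_ ve].
  apply: He; apply: le_lt_trans (cmod_distD (g (Re w)) _ _) _.
  have := Hd (Re w); rewrite -cReN -cReD => /(_ (le_lt_trans (cmod_Re _) wd)); lra.
have d0 : 0 < r / 8 by rewrite divr_gt0.
apply: (grid_surrounds cg _ d0) ng; first by rewrite /g /= !clamp_id.
move=> t z ht h; apply: (Hr t%:C); first by rewrite (@cmodR R) ger0_norm; lra.
by move: h; rewrite /=; lra.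
Qed.

(* On a fine grid the winding number is the sum of the arguments of the successive ratios. *)
Lemma winding_invariant (H : C -> C) : (forall z, ccont H z) ->
  (forall s t, 0 <= s <= 1 -> 0 <= t <= 1 -> H (s +i* t) != 0) ->
  (forall s, 0 <= s <= 1 -> H (s +i* 0) = H (s +i* 1)) ->
  (forall t, 0 <= t <= 1 -> H (1 +i* t) = H (1 +i* 0)) ->
  forall r, 0 < r -> ~ forall t, 0 <= t <= 1 -> H (0 +i* t) = r%:C * cexp ('i * (2 * pi * t)%:C).
Proof.
move=> cH H0 Hp H1 r r0 Hc.
pose K : set C := [set z | 0 <= Re z <= 1 /\ 0 <= Im z <= 1].
have cK : compact K.
  apply: (@compact_bounded_closed R K 2); last first.
    by move=> z [h1 h2]; apply: le_trans (cmod_leD _) _; rewrite !ger0_norm; lra.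
  (* The square is the set of fixed points of the retraction [clamp] of both coordinates, hence
     closed. *)
  suff -> : K = [set z | cmod (z - clamp (Re z) +i* clamp (Im z)) <= 0].
    pose phi := fun z : C => z - clamp (Re z) +i* clamp (Im z).
    suff cphi z : ccont phi z.
      apply: closed_comp (@closed_le R 0) => z _.
      exact: (continuous_cmod_comp (f := phi) (proj1 (ccont_continuous phi z) (cphi z))).
    apply: ccontB; first exact: ccont_id.
    apply: (@ccont_near _ (fun z => (clamp (Re z))%:C + 'i * (clamp (Im z))%:C)).
      apply: ccontD; last apply: ccontM; first by apply: (curve_lip z curve_real); apply/lip_clamp/lip_Re.
        exact: ccont_cst.
      by apply: (curve_lip z curve_real); apply/lip_clamp/lip_Im.
    by near=> w; apply/eqP; rewrite eq_complex /= !mul0r !mul1r !subr0 !addr0 !add0r !eqxx.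
  apply/seteqP; split=> z /=.
    by move=> [h1 h2]; rewrite !clamp_id //; case: z {h1 h2} => x y; rewrite subrr (@cmod0 R).
  rewrite le_eqVlt ltNge cmod_ge0 orbF cmod_eq0 subr_eq0 => /eqP e.
  by split; rewrite e /=; exact: clamp_itv.
have [d d0 Hd] : exists2 d, 0 < d & forall z, K z -> forall w, cmod (w - z) < d -> cmod (H w - H z) < cmod (H z).
  apply: (compact_uniform (P := fun d z => forall w, cmod (w - z) < d -> cmod (H w - H z) < cmod (H z)) cK).
    by move=> d d' z dd' h w wd; apply: h; exact: lt_le_trans wd dd'.
  move=> [s t] [/= hs ht]; have := H0 s t hs ht; rewrite -cmod_gt0 => m0.
  have m4 : 0 < cmod (H (s +i* t)) / 4 by rewrite divr_gt0.
  have [d d0 Hd] := ccont_eps (cH (s +i* t)) m4.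
  exists (d / 2); first by rewrite divr_gt0.
  move=> w wz v vw; have h1 : cmod (H w - H (s +i* t)) < cmod (H (s +i* t)) / 4 by apply: Hd; lra.
  have h2 : cmod (H v - H (s +i* t)) < cmod (H (s +i* t)) / 4.
    by apply: Hd; apply: le_lt_trans (cmod_distD w _ _) _; lra.
  have := cmod_subl (H (s +i* t)) (H w); rewrite cmodB => h3.
  apply: le_lt_trans (cmod_distD (H (s +i* t)) _ _) _.
  by rewrite [cmod (H (s +i* t) - _)]cmodB; lra.
(* The mesh is below [d], so that all ratios of adjacent values lie in the right half-plane; [4 < N]
   makes the angle [2 * pi / N] less than [pi / 2]. *)
have [N N4 Nd] : exists2 N, (4 < N)%N & N%:R^-1 < d.
  exists ((Num.bound d^-1) + 5)%N; first by lia.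
  rewrite -[ltRHS]invrK ltf_pV2 ?posrE ?invr_gt0 ?ltr0n ?addnS //.
  by apply: lt_le_trans (archi_boundP _) _; rewrite ?invr_ge0 ?(ltW d0) // ler_nat; lia.
have NR : 0 < N%:R :> R by rewrite ltr0n; lia.
pose tk k : R := k%:R / N%:R.
have tk01 k : (k <= N)%N -> 0 <= tk k <= 1.
  by move=> kn; rewrite /tk divr_ge0 //= ler_pdivrMr // mul1r ler_nat.
have tkS k : tk k.+1 = tk k + N%:R^-1 by rewrite /tk -natr1 mulrDl mul1r.
have tk0 : tk 0%N = 0 by rewrite /tk mul0r.
have tkN : tk N = 1 by rewrite /tk divff // gt_eqF.
pose h j k := H (tk j +i* tk k).
have h0 j k : (j <= N)%N -> (k <= N)%N -> h j k != 0 by move=> jN kN; apply: H0; exact: tk01.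
have ratio j k j' k' : (j <= N)%N -> (k <= N)%N -> (j' = j /\ k' = k.+1 \/ j' = j.+1 /\ k' = k) ->
    0 < Re (h j' k' / h j k).
  move=> jN kN jk; have nz := h0 _ _ jN kN.
  have : cmod (h j' k' / h j k - 1) < 1.
    rewrite -(divff nz) -mulrBl cmodM cmodV ltr_pdivrMr ?cmod_gt0 // mul1r.
    apply: Hd; first by split; exact: tk01.
    apply: le_lt_trans (cmod_leD _) _; rewrite !(cReD, cReN, cImD, cImN) /=.
    have dk i : `|tk i.+1 - tk i| = N%:R^-1.
      by rewrite tkS addrAC subrr add0r ger0_norm // invr_ge0 ltW.
    by case: jk => -[-> ->]; rewrite dk subrr normr0 ?add0r ?addr0.
  move=> /(le_lt_trans (cmod_Re _)); rewrite cReD cReN /= ltr_norml; lra.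
have /choice [L HL] : forall q : C, exists l, 0 < Re q -> cexp l = q /\ `|Im l| < pi / 2.
  move=> q; have [q0|] := pselect (0 < Re q); last by exists 0.
  by have [l l1 l2] := cexp_surj_right q0; exists l.
(* The two sides have equal exponentials, and the strict bounds on the four arguments exclude a
   difference by a nonzero multiple of [2 pi i]. *)
have LE (q p q' p' : C) : 0 < Re q -> 0 < Re p -> 0 < Re q' -> 0 < Re p' -> p' != 0 -> q * p' = p * q' ->
   L q - L q' = L p - L p'.
  move=> /HL [e1 b1] /HL [e2 b2] /HL [e3 b3] /HL [e4 b4] p'0 e.
  apply/eqP; rewrite -subr_eq0; apply/eqP; apply: cexp_eq1.
    have q'0 : q' != 0 by rewrite -e3 cexp_neq0.
    have p0 : p != 0 by rewrite -e2 cexp_neq0.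
    rewrite !cexpD !cexpN !cexpD !cexpN e1 e2 e3 e4 invfM invrK.
    rewrite (_ : _ * _ = (q * p') / (p * q')); first by rewrite e divff // mulf_neq0.
    by rewrite invfM; ring.
  rewrite !(cImD, cImN); move: b1 b2 b3 b4; rewrite !ltr_norml; lra.
pose T j := \sum_(k < N) L (h j k.+1 / h j k).
(* By [LE] around each small square, the difference of two rows telescopes to the vertical ratios at
   the two ends, which agree because [H] is periodic in the second coordinate. *)
have Tstep j : (j < N)%N -> T j.+1 = T j.
  move=> jN; apply/eqP; rewrite -subr_eq0 -sumrB.
  rewrite (eq_bigr (fun k : 'I_N => L (h j.+1 k.+1 / h j k.+1) - L (h j.+1 k / h j k))); last first.
    move=> [k kN] _ /=; apply: LE.
    - by apply: ratio => //; [exact: ltnW|left].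
    - by apply: ratio => //; [exact: ltnW|right].
    - by apply: ratio => //; [exact: ltnW|exact: ltnW|left].
    - by apply: ratio => //; [exact: ltnW|exact: ltnW|right].
    - by rewrite mulf_neq0 ?invr_neq0 ?h0 // ltnW.
    - have n1 := h0 _ _ jN (ltnW kN); have n2 := h0 _ _ (ltnW jN) kN.
      rewrite !mulrA mulfVK // [h j.+1 k.+1 / _ * _]mulrAC mulrAC -!mulrA; congr (_ * _).
      by rewrite mulrA mulVf // mul1r.
  rewrite -(big_mkord xpredT (fun k => L (h j.+1 k.+1 / h j k.+1) - L (h j.+1 k / h j k))).
  rewrite telescope_sumr // /h tkN tk0 -!Hp ?subrr //; apply: tk01 => //; exact: ltnW.
have Tc j : (j <= N)%N -> T j = T 0%N.
  by elim: j => // j IH jN; rewrite Tstep // IH // ltnW.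
have TN : T N = 0.
  rewrite /T big1 // => -[k kN] _ /=; rewrite /h tkN H1; last exact: tk01.
  rewrite [H (1 +i* tk k)]H1; last by apply: tk01; exact: ltnW.
  have nz : H (1 +i* 0) != 0 by apply: H0; rewrite ?lexx ?ler01.
  rewrite divff //; have [|e b] := HL 1; first by rewrite /= ltr01.
  by apply: cexp_eq1 => //; have := pi_gt0 R; lra.
have T0 : T 0%N = 'i * (2 * pi)%:C.
  rewrite /T (eq_bigr (fun=> 'i * (2 * pi / N%:R)%:C)).
    by rewrite sumr_const card_ord -mulrnAr -rmorphMn -mulr_natr divfK // gt_eqF.
  move=> [k kN] _ /=; have rp := ratio 0%N k 0%N k.+1 isT (ltnW kN) (or_introl (conj erefl erefl)).
  have [e b] := HL _ rp; apply/eqP; rewrite -subr_eq0; apply/eqP; apply: cexp_eq1.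
    rewrite cexpD cexpN e /h tk0 !Hc ?tk01 // ?(ltnW kN) // tkS mulrDr rmorphD mulrDr cexpD.
    have := @cexp_neq0 R ('i * (2 * pi * tk k)%:C); move: (cexp _) => c c0.
    have := @cexp_neq0 R ('i * (2 * pi / N%:R)%:C); move: (cexp _) => c' c'0.
    have rC : r%:C != 0 by rewrite (inj_eq (@complexI R)) gt_eqF.
    by field; rewrite rC c0 c'0.
  have hN : 2 * pi / N%:R < pi / 2 :> R.
    rewrite ltr_pdivrMr //; have : 0 < (N%:R - 4) * pi :> R by rewrite mulr_gt0 ?pi_gt0 // subr_gt0 ltr_nat.
    by rewrite mulrBl; lra.
  have hN0 : 0 < 2 * pi / N%:R :> R by rewrite divr_gt0 // mulr_gt0 // pi_gt0.
  rewrite !(cImD, cImN, cImMr) /= mul1r; move: b; rewrite !ltr_norml; have := pi_gt0 R; lra.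
have : 'i * (2 * pi)%:C = 0 :> C by rewrite -T0 -(Tc N) // TN.
move=> /eqP; rewrite mulf_eq0 => /orP [|].
  by rewrite -cmod_eq0 cmod_i oner_eq0.
by rewrite -cmod_eq0 (@cmodR R) normr_eq0 gt_eqF // mulr_gt0 // pi_gt0.
Unshelve. all: by end_near. Qed.

Definition circle_loop (r : R) (t : R) : C := r%:C * cexp ('i * (2 * pi * t)%:C).

Lemma cmod_circle_loop r t : 0 <= r -> cmod (circle_loop r t) = r.
Proof.
move=> r0; rewrite /circle_loop cmodM (@cmodR R) ger0_norm // cmod_cexp cReMr /= mul0r expR0 mulr1 //.
Qed.

Lemma circle_loop_in U r : 0 <= r -> (forall z, cmod z = r -> U z) -> loop_in U (circle_loop r).
Proof.
move=> r0 cU; split.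
- apply: continuous_subspaceT => t; apply/curve_continuous_atP => e e0.
  have cf : ccont (fun z => r%:C * cexp ('i * (2 * pi)%:C * z)) t%:C.
    apply: ccontM; first exact: ccont_cst.
    apply: (@ccont_comp _ cexp); last exact/holo_ccont/holo_cexp.
    by apply: ccontM; [exact: ccont_cst|exact: ccont_id].
  have [d d0 Hd] := ccont_eps cf e0; exists d => // s st.
  have := Hd s%:C; rewrite -rmorphB (@cmodR R) => /(_ st).
  by rewrite -!mulrA -!rmorphM.
- rewrite /circle_loop mulr0 mulr1 rmorph0 mulr0; congr (_ * _).
  by rewrite -[X in _ = cexp X]add0r cexp_2pi.
- by move=> _ [t _ <-]; apply: cU; exact: cmod_circle_loop.
Qed.

(** The contraction would avoid [p]. Moving the circle by [- p], which avoids 0 as [cmod p < r], and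
    then contracting would join a curve of winding number 1 to a constant one within the nonzero
    numbers. *)
Lemma circle_contracts_disc U (r : R) (p : C) : 0 < r -> null_homotopic_in U (circle_loop r) ->
  cmod p < r -> U p.
Proof.
move=> r0 /homotopic_contracts [H [cH HU H01 Hs]] pr; apply: contrapT => nU.
pose a z := clamp (2 * Re z + -1); pose b z := clamp (2 * Re z + 0).
have i0 : 0 <= (0 : R) <= 1 by rewrite lexx ler01.
have i1 : 0 <= (1 : R) <= 1 by rewrite lexx ler01.
have pe s t : (s%:C + 'i * t%:C : C) = s +i* t.
  by apply/eqP; rewrite eq_complex /= !mul0r !mul1r !subr0 !addr0 !add0r !eqxx.
pose H' z := H ((a z)%:C + 'i * (clamp (Im z))%:C) - (b z)%:C * p.
have E s t : 0 <= s <= 1 -> 0 <= t <= 1 ->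
   H' (s +i* t) = if s <= 2^-1 then circle_loop r t - (2 * s)%:C * p else H ((2 * s - 1) +i* t) - p.
  move=> hs ht; rewrite /H' pe /= clamp_id // /a /b /=; case: ifPn => h.
    rewrite clamp0 ?(proj1 (H01 _ _)) //; last by lra.
    by rewrite addr0 clamp_id //; lra.
  by rewrite [clamp (_ + 0)]clamp1 ?mul1r ?clamp_id //; lra.
apply: (@winding_invariant H' _ _ _ _ r r0).
- move=> z; apply: ccontB; last apply: ccontM.
  + apply: (@ccont_comp _ H) => //; apply: ccontD; last apply: ccontM.
    * by apply: (curve_lip z curve_real); apply/lip_clamp/lip_affine/lip_Re.
    * exact: ccont_cst.
    * by apply: (curve_lip z curve_real); apply/lip_clamp/lip_Im.
  + by apply: (curve_lip z curve_real); apply/lip_clamp/lip_affine/lip_Re.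
  + exact: ccont_cst.
- move=> s t hs ht; rewrite E //; case: ifPn => h; rewrite subr_eq0; apply/eqP.
    move=> /(congr1 (@cmod R)); rewrite cmod_circle_loop ?(ltW r0) // cmodM (@cmodR R) ger0_norm; last by lra.
    by have := cmod_ge0 p; nra.
  by move=> e; apply: nU; rewrite -e; apply: HU => //; lra.
- move=> s hs; rewrite !E //; case: ifPn => h.
    by congr (_ - _); rewrite -(proj1 (H01 _ i0)) -(proj1 (H01 _ i1)) !(proj1 (Hs _ i0), proj2 (Hs _ i0)).
  have [|e1 e2] := Hs (2 * s - 1); first by lra.
  by rewrite e1 e2.
- move=> t ht; have f1 : ((1 : R) <= 2^-1) = false by apply/negbTE; rewrite -ltNge; lra.
  rewrite !E // f1; by have -> : 2 * 1 - 1 = 1 :> R by [lra]; rewrite (proj2 (H01 _ ht)) (proj2 (H01 _ i0)).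
- by move=> t ht; rewrite E // ifT ?mulr0 ?rmorph0 ?mul0r ?subr0 //; lra.
Qed.

End grid.

(** * Fatou components *)

Section connectedness.
Context {R : realType}.
Local Notation C := R[i].
Implicit Types (z w : C) (U : set C).

(** If [P] propagates between any two points of small discs, then [P] and its complement are both
    open relative to [U]. *)
Lemma connected_induct U (P : C -> Prop) z0 : connected U -> U z0 -> P z0 ->
  (forall z, U z -> exists2 r, 0 < r & forall w w', U w -> U w' -> cmod (w - z) < r ->
     cmod (w' - z) < r -> P w -> P w') ->
  forall z, U z -> P z.
Proof.
move=> cU Uz0 Pz0 loc.
pose G (Q : C -> Prop) := [set w | exists z r, [/\ cmod (w - z) < r, U z, Q z &
   forall v v', U v -> U v' -> cmod (v - z) < r -> cmod (v' - z) < r -> P v -> P v']].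
have oG Q : open (G Q).
  apply/open_cdiscP => w [z [r [wz Uz Qz H]]].
  have [s s0 Hs] := cdisc_cdisc wz.
  exists s => // v vw; exists z, r; split=> //.
  by apply: Hs; exact: ltW.
have e1 : U `&` P = U `&` G P.
  apply/seteqP; split=> w [Uw Pw]; split=> //.
    by have [r r0 H] := loc w Uw; exists w, r; rewrite subrr cmod0.
  have [z [r [wz Uz Pz H]]] := Pw.
  by apply: (H z) => //; rewrite subrr cmod0; exact: le_lt_trans (cmod_ge0 _) wz.
have e2 : U `&` P = U `&` ~` G (~` P).
  apply/seteqP; split=> w [Uw Pw]; split=> //.
    move=> [z [r [wz Uz nPz H]]]; apply: nPz.
    by apply: (H w) => //; rewrite subrr cmod0; exact: le_lt_trans (cmod_ge0 _) wz.
  apply: contrapT => nP; apply: Pw; have [r r0 H] := loc w Uw.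
  by exists w, r; rewrite subrr cmod0.
have -> : U = U `&` P; last by move=> z [].
apply/esym/cU.
- by exists z0.
- by exists (G P).
- by exists (~` G (~` P)) => //; exact: open_closedC.
Qed.

Lemma convex_connected (K : set C) : cvx_set K -> connected K.
Proof.
move=> cK; have [->|/set0P [a Ka]] := eqVneq K set0; first exact: connected0.
pose seg z := (fun t : R => a + t%:C * (z - a)) @` `[0, 1].
have -> : K = \bigcup_(z in K) seg z.
  apply/seteqP; split=> [z Kz|w [z Kz [t] /=]].
    by exists z => //; exists 1; rewrite /= ?in_itv /= ?ler01 ?lexx // mul1r addrC subrK.
  by rewrite in_itv /= => ht <-; exact: cK.
apply: bigcup_connected.
  by exists a => z _; exists 0; rewrite /= ?in_itv /= ?ler01 ?lexx // mul0r addr0.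
move=> z _; apply: connected_continuous_connected; first exact: segment_connected.
apply: continuous_subspaceT => t; apply/curve_continuous_atP => e e0.
exists (e / (cmod (z - a) + 1)); first by rewrite divr_gt0 // ltr_wpDl ?cmod_ge0.
move=> s; rewrite ltr_pdivlMr ?ltr_wpDl ?cmod_ge0 // => h.
rewrite opprD addrACA subrr add0r -mulrBl -rmorphB cmodM cmodR; apply: le_lt_trans h.
by rewrite ler_wpM2l // lerDl.
Qed.

Lemma cdisc_connected a (r : R) : connected (cdisc a r).
Proof. exact/convex_connected/cdisc_convex. Qed.

Lemma connected_sub U (Om : set C) z0 : connected U -> open Om -> U z0 -> Om z0 ->
  (forall z, U z -> (forall e, 0 < e -> exists2 w, Om w & cmod (w - z) < e) -> Om z) ->
  U `<=` Om.
Proof.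
move=> cU /open_cdiscP oO Uz0 Oz0 bd; apply: (connected_induct cU Uz0 Oz0) => z Uz.
have [Oz|nOz] := pselect (Om z).
  by have [r r0 H] := oO z Oz; exists r => // w w' _ _ _ w'z _; exact: H.
have [r r0 H] : exists2 r, 0 < r & forall w, cmod (w - z) < r -> ~ Om w.
  apply: contrapT => h; apply: nOz; apply: bd => // e e0; apply: contrapT => h'.
  by apply: h; exists e => // w wz Ow; apply: h'; exists w.
by exists r => // w w' _ _ wz _ /(H w wz).
Qed.

Lemma bounded_boundary (Om : set C) (B : R) : open Om -> Om !=set0 -> (forall z, Om z -> cmod z <= B) ->
  exists z, (forall e, 0 < e -> exists2 w, Om w & cmod (w - z) < e) /\ ~ Om z.
Proof.
move=> oO [z0 Oz0] bO; apply: contrapT => h.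
have cT : connected (setT : set C) by apply: convex_connected.
have /(_ (B + 1)%:C I) : setT `<=` Om.
  apply: (connected_sub cT oO _ Oz0) => // z _ hz; apply: contrapT => nz.
  by apply: h; exists z.
by move=> /bO; rewrite cmodR => /(le_trans (ler_norm _)); lra.
Qed.

End connectedness.

(** * Normality on discs and the orbits of Fatou components *)

Section fatou.
Context {R : realType}.
Local Notation C := R[i].
Implicit Types (z w : C) (A U : set C) (m k : nat -> nat) (u : nat -> C -> C).

Definition unif_cauchy A u := forall e : R, 0 < e -> exists N, forall i j, (N <= i)%N -> (N <= j)%N ->
  forall w, A w -> cmod (u i w - u j w) < e.
Definition unif_infty A u := forall B : R, exists N, forall i, (N <= i)%N -> forall w, A w -> B < cmod (u i w).

(* In [normal_family] the neighbourhoods depend on the subsequence; here the disc is fixed. *)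
Definition tame (f : C -> C) z (r : R) := forall m, exists2 k, {homo k : i j / (i < j)%N} &
  unif_cauchy (cdisc z r) (fun i => iter (m (k i)) f) \/ unif_infty (cdisc z r) (fun i => iter (m (k i)) f).

Lemma increasing_ge k : {homo k : i j / (i < j)%N} -> forall i, (i <= k i)%N.
Proof. by move=> hk; elim=> // i IH; apply: leq_ltn_trans IH _; exact: hk. Qed.

Lemma increasing_comp k k' : {homo k : i j / (i < j)%N} -> {homo k' : i j / (i < j)%N} ->
  {homo (k \o k') : i j / (i < j)%N}.
Proof. by move=> hk hk' i j /hk' /hk. Qed.

Lemma unif_cauchy_sub A u k : {homo k : i j / (i < j)%N} -> unif_cauchy A u -> unif_cauchy A (u \o k).
Proof.
move=> hk h e /h [N HN]; exists N => i j Ni Nj w Aw; apply: HN => //.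
  exact: leq_trans (increasing_ge hk i).
exact: leq_trans (increasing_ge hk j).
Qed.

Lemma uniform_cvgP A u (g : C -> C) : {uniform A, u @ \oo --> g} <->
  forall e : R, 0 < e -> exists N, forall n, (N <= n)%N -> forall w, A w -> cmod (u n w - g w) < e.
Proof.
split.
  move=> cu e e0; have : nbhs (g : {uniform` A -> C}) [set h | forall y, A y -> cmod (h y - g y) < e].
    apply/uniform_nbhs; exists [set xy | cmod (xy.2 - xy.1) < e]; split=> //.
    rewrite -entourage_ballE; exists e%:C => /=; first by rewrite ltcR.
    by move=> [x y]; rewrite /= -ball_normE /= -normrN opprB normE ltcR.
  by move=> /cu [N _ HN]; exists N => n Nn w Aw; exact: (HN n Nn w Aw).
move=> H P /uniform_nbhs [E [+ sP]]; rewrite -entourage_ballE => -[e /= e0 He].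
have /complex_realP [r er] := gtr0_real e0; subst e.
have [|N HN] := H r; first by rewrite -ltcR.
exists N => // n /= Nn; apply: sP => y Ay; apply: He => /=.
by rewrite -ball_normE /= -normrN opprB normE ltcR; exact: HN.
Qed.

Lemma compact_eventually (K : set C) (P : nat -> C -> Prop) : compact K ->
  (forall z, K z -> exists2 r, 0 < r & exists N, forall n, (N <= n)%N -> forall w, cmod (w - z) < r -> P n w) ->
  exists N, forall n, (N <= n)%N -> forall w, K w -> P n w.
Proof.
move=> /compact_near_coveringP cK loc.
have := cK nat \oo (fun n => P n) _ => /(_ _) [].
  move=> z /loc [r r0 [N HN]].
  exists (cdisc z r, [set n | (N <= n)%N]) => /=.
    by split; [apply/nbhs_cdiscP; exists r|exists N].
  by move=> [w n] /= [h1 h2]; exact: HN.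
by move=> N _ H; exists N => n Nn w Kw; exact: (H n Nn w Kw).
Qed.

Lemma fatou_tame (f : C -> C) z : fatou_set f z -> exists2 r, 0 < r & tame f z r.
Proof.
case=> U [/open_cdiscP oU Uz nU]; have [r r0 Hr] := oU z Uz.
exists (r / 2); first by rewrite divr_gt0.
move=> m; have [|k hk H] := nU (fun i => iter (m i) f); first by move=> n; exists (m n).
exists k => //.
have sub w : cmod (w - z) <= r / 2 -> U w by move=> h; apply: Hr; lra.
have cK := @compact_closed_cdisc R z (r / 2).
case: H => [[g Hg]|Hg]; [left|right].
  move=> e e0; have e2 : 0 < e / 2 by rewrite divr_gt0.
  have [N HN] : exists N, forall n, (N <= n)%N -> forall w, cmod (w - z) <= r / 2 ->
      cmod (iter (m (k n)) f w - g w) < e / 2.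
    apply: (compact_eventually (P := fun n w => cmod (iter (m (k n)) f w - g w) < e / 2) cK) => w /sub /Hg.
    move=> [V /nbhs_cdiscP [s s0 Hs] /uniform_cvgP /(_ _ e2) [N HN]].
    by exists s => //; exists N => n Nn v vw; apply: HN => //; exact: Hs.
  exists N => i j Ni Nj w /ltW wz; apply: le_lt_trans (cmod_distD (g w) _ _) _.
  by rewrite [cmod (g w - _)]cmodB; have := HN _ Ni _ wz; have := HN _ Nj _ wz; lra.
move=> B; have [N HN] : exists N, forall n, (N <= n)%N -> forall w, cmod (w - z) <= r / 2 ->
    B < cmod (iter (m (k n)) f w).
  apply: (compact_eventually (P := fun n w => B < cmod (iter (m (k n)) f w)) cK) => w /sub /Hg.
  move=> [V /nbhs_cdiscP [s s0 Hs] /(_ B) [N _ HN]].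
  by exists s => //; exists N => n Nn v vw; apply: (HN n) => //; exact: Hs.
by exists N => i Ni w /ltW wz; exact: HN.
Qed.

Lemma tame_fatou (f : C -> C) z (r : R) : 0 < r -> tame f z r -> fatou_set f z.
Proof.
move=> r0 H; exists (cdisc z r); split; [exact: cdisc_open|exact: cdisc_center|].
move=> u Hu; have /choice [m Hm] : forall n, exists p, u n = iter p f.
  by move=> n; have [p _ <-] := Hu n; exists p.
have eu : u = fun i => iter (m i) f by apply/funext.
have [k hk [uc|ui]] := H m; exists k => //.
  left.
  have /choice [g Hg] : forall w, exists l, cdisc z r w -> forall e : R, 0 < e ->
      exists N, forall n, (N <= n)%N -> cmod (iter (m (k n)) f w - l) < e.
    move=> w; have [dw|] := pselect (cdisc z r w); last by exists 0.
    have [|l Hl] := @cauchy_complex R (fun n => iter (m (k n)) f w); last by exists l.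
    by move=> e /uc [N HN]; exists N => i j Ni Nj; exact: HN.
  exists g => w dw; exists (cdisc z r); first exact: cdisc_open_near.
  apply/uniform_cvgP => e e0; have e2 : 0 < e / 2 by rewrite divr_gt0.
  have [N HN] := uc _ e2; exists N => n Nn v dv; rewrite eu /=.
  have [N' HN'] := Hg v dv _ e2.
  apply: le_lt_trans (cmod_distD (iter (m (k (maxn N N'))) f v) _ _) _.
  have := HN n (maxn N N') Nn (leq_maxl _ _) v dv; have := HN' (maxn N N') (leq_maxr _ _); lra.
right=> w dw; exists (cdisc z r); first exact: cdisc_open_near.
by move=> B; have [N HN] := ui B; exists N => // n Nn v dv; rewrite eu /=; exact: HN.
Qed.

Lemma tame_sub (f : C -> C) z z' (r r' : R) : cdisc z' r' `<=` cdisc z r -> tame f z r -> tame f z' r'.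
Proof.
move=> s H m; have [k hk [uc|ui]] := H m; exists k => //.
  by left=> e /uc [N HN]; exists N => i j Ni Nj w /s; exact: HN.
by right=> B; have [N HN] := ui B; exists N => i Ni w /s; exact: HN.
Qed.

Lemma fatou_open (f : C -> C) : open (fatou_set f).
Proof.
apply/open_cdiscP => z /fatou_tame [r r0 H]; exists r => // w wz.
have [s s0 Hs] := cdisc_cdisc wz.
by apply: (tame_fatou s0); apply: tame_sub H => v /ltW; exact: Hs.
Qed.

(** A disc about [f z] is covered by the image of a disc on which the iterates are tame, and
    exponents shift by one. *)
Lemma fatou_forward (f : C -> C) z : hol f -> (exists a b, f a != f b) ->
  fatou_set f z -> fatou_set f (f z).
Proof.
move=> hf nc /fatou_tame [r r0 H]; have [d d0 Hd] := open_mapping hf nc z r0.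
apply: (tame_fatou d0) => m; have [k hk [uc|ui]] := H (fun i => (m i).+1); exists k => //.
  left=> e /uc [N HN]; exists N => i j Ni Nj w /Hd [v vz <-].
  by have := HN i j Ni Nj v vz; rewrite !iterSr.
right=> B; have [N HN] := ui B; exists N => i Ni w /Hd [v vz <-].
by have := HN i Ni v vz; rewrite iterSr.
Qed.

(** Otherwise some subsequence takes bounded values at points of the disc. It has no subsequence
    tending uniformly to infinity, and none that is uniformly Cauchy, in view of [z']. *)
Lemma tame_infty (f : C -> C) z z' (r : R) m : tame f z r -> cdisc z r z' ->
  (forall B : R, exists N, forall i, (N <= i)%N -> B < cmod (iter (m i) f z')) ->
  unif_infty (cdisc z r) (fun i => iter (m i) f).
Proof.
move=> H dz' inf; apply: contrapT => /existsNP [B /forallNP h].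
have /choice [p Hp] : forall N, exists i, (N <= i)%N /\ exists2 w, cdisc z r w & cmod (iter (m i) f w) <= B.
  move=> N; have /existsNP [i /not_implyP [Ni /existsNP [w /not_implyP [dw hw]]]] := h N.
  by exists i; split=> //; exists w => //; rewrite leNgt; apply/negP.
have [k hk [uc|ui]] := H (m \o p).
  have [N HN] := uc 1 ltr01.
  have [N' HN'] := inf (cmod (iter (m (p (k N))) f z') + 1).
  pose j := maxn N N'; have Nj : (N <= j)%N by rewrite leq_maxl.
  have pj : (N' <= p (k j))%N.
    apply: leq_trans (proj1 (Hp _)); apply: leq_trans (increasing_ge hk _); exact: leq_maxr.
  have := HN' _ pj; have := HN j N Nj (leqnn _) z' dz'; have := cmod_subl (iter (m (p (k j))) f z') (iter (m (p (k N))) f z').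
  by rewrite /=; lra.
have [N HN] := ui B; have [_ [w dw]] := Hp (k N).
by rewrite leNgt => /negP; apply; exact: (HN N (leqnn _) w dw).
Qed.

Lemma infty_connected (f : C -> C) U z0 m : connected U -> U `<=` fatou_set f -> U z0 ->
  (forall B : R, exists N, forall i, (N <= i)%N -> B < cmod (iter (m i) f z0)) ->
  forall K, compact K -> K `<=` U -> unif_infty K (fun i => iter (m i) f).
Proof.
move=> cU UF Uz0 inf K cK KU.
have pt : forall z, U z -> forall B : R, exists N, forall i, (N <= i)%N -> B < cmod (iter (m i) f z).
  apply: (connected_induct cU Uz0 inf) => z /UF /fatou_tame [r r0 H]; exists r => // w w' _ _ wz w'z hw B.
  have [N HN] := tame_infty H wz hw B; exists N => i Ni; exact: HN.
move=> B; apply: (compact_eventually (P := fun i w => B < cmod (iter (m i) f w)) cK) => z /KU Uz.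
have [r r0 H] := fatou_tame (UF z Uz).
have [N HN] := tame_infty H (cdisc_center z r0) (pt z Uz) B.
by exists r => //; exists N => n Nn w wz; exact: HN.
Qed.

Lemma fatou_componentP (f : C -> C) U : fatou_component f U ->
  [/\ open U, connected U, U !=set0, U `<=` fatou_set f &
   forall V, connected V -> V `<=` fatou_set f -> (exists2 z, V z & U z) -> V `<=` U].
Proof.
case=> z Fz ->; have cc := @component_connected C (fatou_set f) z.
have Uz : connected_component (fatou_set f) z z by exact: connected_component_refl.
have mx V : connected V -> V `<=` fatou_set f -> (exists2 w, V w & connected_component (fatou_set f) z w) ->
    V `<=` connected_component (fatou_set f) z.
  move=> cV VF [w Vw Uw] v Vv; exists (V `|` connected_component (fatou_set f) z); last by left.
  split; first by right.
    by move=> y [/VF//|]; exact: connected_component_sub.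
  by apply: connectedU => //; exists w.
split=> //; last 1 first.
- exact: connected_component_sub.
- apply/open_cdiscP => w Uw.
  have Fw : fatou_set f w by exact: connected_component_sub Uw.
  have /open_cdiscP /(_ w Fw) [r r0 Hr] := @fatou_open f; exists r => // v vw.
  apply: (mx (cdisc w r)) => //; first exact: cdisc_connected.
  by exists w => //; exact: cdisc_center.
by exists z.
Qed.

Lemma fatou_component_eq (f : C -> C) U V z : fatou_component f U -> fatou_component f V -> U z -> V z -> U = V.
Proof.
move=> /fatou_componentP [_ cU _ UF mU] /fatou_componentP [_ cV _ VF mV] Uz Vz.
by apply/seteqP; split; [apply: mV|apply: mU] => //; exists z.
Qed.

Lemma orbit_step (f : C -> C) U (Us : nat -> set C) n z : hol f -> (exists a b, f a != f b) ->
  component_orbit f U Us -> Us n z -> Us n.+1 (f z).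
Proof.
move=> hf nc [U0 HU] Uz; have [cn sn] := HU n; have [cn1 sn1] := HU n.+1.
have [c0 _] := HU 0%N; have [_ _ [z0 Uz0] _ _] := fatou_componentP c0.
have [_ conn _ UF _] := fatou_componentP cn; have [_ _ _ _ mx] := fatou_componentP cn1.
apply: (mx (f @` Us n)); last by exists z.
- apply: connected_continuous_connected => //; apply: continuous_subspaceT => w.
  by apply/ccont_continuous/holo_ccont/hf.
- by move=> _ [w Uw <-]; apply: fatou_forward => //; exact: UF.
rewrite U0 in Uz0; exists (iter n.+1 f z0); last by apply: sn1; exists z0.
by exists (iter n f z0) => //; apply: sn; exists z0.
Qed.

(** If two components of the orbit meet they coincide, and so do all their successors, which makes
    the orbit eventually periodic. *)
Lemma wandering_distinct (f : C -> C) U : hol f -> (exists a b, f a != f b) ->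
  wandering_domain f U -> exists2 Us, component_orbit f U Us &
  forall (m n : nat) z, Us m z -> Us n z -> m = n.
Proof.
move=> hf nc [cU [Us orb np]]; exists Us => // m n z Um Un.
wlog mn : m n Um Un / (m < n)%N.
  by move=> H; have [h|h|//] := ltngtP m n; [exact: H h|apply/esym; exact: H h].
have [_ HU] := orb.
exfalso; apply: np; exists m, (n - m)%N; split=> [|p mp]; first by rewrite subn_gt0.
have [i ->] : exists i, p = (i + m)%N by exists (p - m)%N; rewrite subnK.
have Hi (j q : nat) : Us q z -> Us (j + q)%N (iter j f z).
  by move=> Uk; elim: j => // j IH; rewrite addSn iterS; exact: (orbit_step hf nc orb IH).
rewrite -addnA subnKC ?(ltnW mn) //.
by apply: (fatou_component_eq (proj1 (HU _)) (proj1 (HU _))); exact: Hi.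
Qed.

End fatou.

(** * Harnack chains in a domain *)

Section chains.
Context {R : realType}.
Local Notation C := R[i].
Implicit Types (x y z w : C) (U K : set C) (h : C -> C).

(** Requiring the disc about both points makes the relation symmetric. The ratio [1 / 4] suits
    [annulus_cover] and gives the constant [5 / 3] in Harnack's inequality. *)
Definition legal U x y := exists2 r, 0 < r & [/\ cdisc x r `<=` U, cdisc y r `<=` U & cmod (y - x) < r / 4].

Inductive steps U : nat -> C -> C -> Prop :=
| steps0 x : U x -> steps U 0 x x
| stepsS n x y z : legal U x y -> steps U n y z -> steps U n.+1 x z.

Lemma legal_sym U x y : legal U x y -> legal U y x.
Proof. by case=> r r0 [h1 h2 h3]; exists r; rewrite // cmodB. Qed.

Lemma legal_in U x y : legal U x y -> U x.
Proof. by case=> r r0 [h1 _ _]; apply: h1; exact: cdisc_center. Qed.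

Lemma near_legal U z : open U -> U z ->
  exists2 r, 0 < r & forall w w', cmod (w - z) < r -> cmod (w' - z) < r -> legal U w w'.
Proof.
move=> /open_cdiscP oU /oU [r r0 Hr]; exists (r / 16); first by rewrite divr_gt0.
move=> w w' wz w'z; exists (r / 2); first by rewrite divr_gt0.
split=> [v|v|]; rewrite /cdisc /=.
- by move=> vw; apply: Hr; apply: le_lt_trans (cmod_distD w _ _) _; lra.
- by move=> vw; apply: Hr; apply: le_lt_trans (cmod_distD w' _ _) _; lra.
by apply: le_lt_trans (cmod_distD z _ _) _; rewrite [cmod (z - w)]cmodB; lra.
Qed.

Lemma legal_refl U z : open U -> U z -> legal U z z.
Proof. by move=> oU Uz; have [r r0 H] := near_legal oU Uz; apply: H; rewrite subrr cmod0. Qed.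

Lemma steps_trans U n m x y z : steps U n x y -> steps U m y z -> steps U (n + m) x z.
Proof. by elim=> // {}n {}x y' {}y l _ IH /IH; exact: stepsS. Qed.

Lemma steps_end U n x y : steps U n x y -> U y.
Proof. by elim. Qed.

Lemma steps_sym U n x y : steps U n x y -> steps U n y x.
Proof.
elim=> [{}x|{}n {}x y' {}y l _ IH]; first exact: steps0.
rewrite -addn1; apply: steps_trans IH _; apply: stepsS (legal_sym l) _.
by apply: steps0; exact: legal_in l.
Qed.

Lemma steps_pad U n N x y : open U -> steps U n x y -> (n <= N)%N -> steps U N x y.
Proof.
move=> oU s nN; have Uy := steps_end s; rewrite -(subnKC nN); apply: steps_trans s _.
elim: (N - n)%N => [|k IH]; first exact: steps0.
by apply: stepsS IH; exact: legal_refl.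
Qed.

Lemma steps_exist U x y : open U -> connected U -> U x -> U y -> exists n, steps U n x y.
Proof.
move=> oU cU Ux Uy; move: x Ux.
apply: (connected_induct cU Uy); first by exists 0%N; exact: steps0.
move=> z Uz; have [r r0 H] := near_legal oU Uz; exists r => // w w' _ _ wz w'z [n s].
by exists n.+1; apply: stepsS s; exact: H.
Qed.

Lemma steps_bounded U K : open U -> connected U -> compact K -> K `<=` U ->
  exists N, forall x y, K x -> K y -> steps U N x y.
Proof.
move=> oU cU cK KU; have [->|/set0P [y0 Ky0]] := eqVneq K set0; first by exists 0%N.
have [N HN] : exists N, forall n, (N <= n)%N -> forall x, K x -> steps U n x y0.
  apply: (compact_eventually (P := fun n x => steps U n x y0) cK) => z /KU Uz.
  have [r r0 H] := near_legal oU Uz; have [n s] := steps_exist oU cU Uz (KU _ Ky0).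
  exists r => //; exists n.+1 => p np w wz; apply: (steps_pad oU _ np).
  by apply: stepsS s; apply: H; rewrite // subrr cmod0.
exists (N + N)%N => x y Kx Ky; apply: (@steps_trans _ _ _ _ y0); first exact: HN.
by apply: steps_sym; exact: HN.
Qed.

Lemma steps_upper U (phi : C -> R) (q : R) n x y : 0 <= q ->
  (forall v w, legal U v w -> phi w <= q * phi v) -> steps U n x y -> phi y <= q ^+ n * phi x.
Proof.
move=> q0 H; elim=> [{}x _|{}n {}x y' {}y l _ IH]; first by rewrite expr0 mul1r.
apply: le_trans IH _; rewrite exprSr -mulrA ler_wpM2l ?exprn_ge0 //; exact: H.
Qed.

Lemma steps_lower U (phi : C -> R) (q : R) n x y : 0 <= q ->
  (forall v w, legal U v w -> q * phi v <= phi w) -> steps U n x y -> q ^+ n * phi x <= phi y.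
Proof.
move=> q0 H; elim=> [{}x _|{}n {}x y' {}y l _ IH]; first by rewrite expr0 mul1r.
apply: le_trans _ IH; rewrite exprSr -mulrA ler_wpM2l ?exprn_ge0 //; exact: H.
Qed.

Lemma harnack_compact U K : open U -> connected U -> compact K -> K `<=` U ->
  exists2 c : R, 1 <= c & forall h, (forall w, U w -> holo h w) -> (forall w, U w -> 1 < cmod (h w)) ->
  forall x y, K x -> K y -> ln (cmod (h y)) <= c * ln (cmod (h x)).
Proof.
move=> oU cU cK KU; have [N HN] := steps_bounded oU cU cK KU.
exists ((5 / 3) ^+ N); first by rewrite exprn_ege1 //; lra.
move=> h hU h1 x y Kx Ky.
apply: (steps_upper (phi := fun w => ln (cmod (h w))) _ _ (HN x y Kx Ky)); first by lra.
move=> v w [r r0 [s1 s2 vw]].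
have [||A B] := @harnack R h v r (1 / 4) w r0 (fun u du => hU u (s1 u du)) (fun u du => h1 u (s1 u du)).
- lra.
- by apply: ltW; lra.
lra.
Qed.

Lemma bernoulli (k : R) n : k <= 1 -> 1 - n%:R * k <= (1 - k) ^+ n.
Proof.
move=> k1; elim: n => [|n IH]; first by rewrite mul0r subr0 expr0.
rewrite exprS -natr1; have : 0 <= n%:R * k ^+ 2 :> R by rewrite mulr_ge0 // sqr_ge0.
have : (1 - k) * (1 - n%:R * k) <= (1 - k) * (1 - k) ^+ n by rewrite ler_wpM2l // subr_ge0.
rewrite expr2; lra.
Qed.

(** If [ln |h|] fell by a factor of at least [1 - k] at every link, it could not fall by the factor
    [th] along a chain of length [N]. So one link has a larger drop, and [annulus_cover] applies to
    it. *)
Lemma chain_annulus U K (th : R) : open U -> connected U -> compact K -> K `<=` U -> 0 <= th < 1 ->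
  exists2 eta : R, 0 < eta < 1 & forall h, (forall w, U w -> holo h w) ->
  (forall w, U w -> 1 < cmod (h w)) -> (forall w, U w -> pi <= eta * ln (cmod (h w))) ->
  forall x y, K x -> K y -> ln (cmod (h y)) <= th * ln (cmod (h x)) ->
  exists2 a, U a & forall w, w != 0 -> `|ln (cmod w) - ln (cmod (h a))| <= eta * ln (cmod (h a)) ->
    exists2 z, U z & h z = w.
Proof.
move=> oU cU cK KU th01; have [N HN] := steps_bounded oU cU cK KU.
have Npos : 0 < (N.+1)%:R :> R by rewrite ltr0n.
(* By Bernoulli's inequality this [k] gives [th < (1 - k) ^+ N]. *)
have [k [k0 kN]] : exists k, 0 < k /\ (N.+1)%:R * k = (1 - th) / 2.
  exists ((1 - th) / (2 * (N.+1)%:R)); split; first by rewrite divr_gt0 ?mulr_gt0 //; lra.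
  by field; lra.
have k1 : k <= 1.
  by apply: le_trans (_ : (N.+1)%:R * k <= 1); [rewrite ler_peMl ?(ltW k0) // ler1n|lra].
have thk : th < (1 - k) ^+ N.
  by apply: lt_le_trans (bernoulli N k1); move: kN; rewrite -natr1; lra.
exists ((k / 10) ^+ 3 / 2).
  rewrite divr_gt0 ?exprn_gt0 ?divr_gt0 //=.
  have : (k / 10) ^+ 3 <= 1 by rewrite exprn_ile1 //; lra.
  lra.
move=> h hU h1 hL x y Kx Ky hxy; have Ux := KU _ Kx.
have lx : 0 < ln (cmod (h x)) by rewrite ln_gt0 // h1.
have [v [w [l vw]]] : exists v w, legal U v w /\ ln (cmod (h w)) < (1 - k) * ln (cmod (h v)).
  apply: contrapT => no.
  have : (1 - k) ^+ N * ln (cmod (h x)) <= ln (cmod (h y)).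
    apply: (steps_lower (phi := fun w => ln (cmod (h w))) _ _ (HN x y Kx Ky)); first by lra.
    by move=> v w l; rewrite leNgt; apply/negP => vw; apply: no; exists v, w.
  by move=> /le_trans /(_ hxy); rewrite ler_pM2r // leNgt thk.
have Uv := legal_in l; exists v => //; case: l => r r0 [s1 s2 rvw] u u0 hu.
have := @annulus_cover R h v w r k (ln (cmod (h v))) r0 (fun u du => hU u (s1 u du))
  (fun u du => h1 u (s1 u du)) erefl _ (ltW rvw) _ _ u u0 hu.
case.
- by rewrite k0 k1.
- have : 0 < ln (cmod (h v)) by rewrite ln_gt0 // h1.
  by move=> lv; have := mulr_gt0 k0 lv; move: vw; rewrite mulrBl mul1r => vw kl; rewrite ler0_norm; lra.
- by have := hL v Uv; lra.
by move=> z dz hz; exists z => //; exact: s1.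
Qed.

End chains.

(** * The orbit of a multiply connected wandering domain *)

Section compactness.
Context {R : realType}.
Local Notation C := R[i].
Implicit Types (z w : C) (K A : set C).

(** Compactness as an induction over an ideal of sets; the sets with complement in the ideal would
    otherwise form a filter without cluster point in [K]. It serves to extract subsequences, which
    differ from disc to disc. *)
Lemma compact_ideal K (I : set C -> Prop) : compact K -> I set0 -> (forall A B, A `<=` B -> I B -> I A) ->
  (forall A B, I A -> I B -> I (A `|` B)) ->
  (forall z, K z -> exists2 r, 0 < r & I (K `&` cdisc z r)) -> I K.
Proof.
move=> cK I0 Isub IU loc; apply: contrapT => nK.
pose F : set_system C := [set S | I (K `\` S)].
have fF : ProperFilter F.
  apply: Build_ProperFilter_ex => [S FS|].
    apply: contrapT => /forallNP nS; apply: nK; apply: Isub FS => z Kz; split=> //; exact: nS.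
  split; rewrite /F /=.
  - by rewrite setDT.
  - move=> A B FA FB; apply: Isub (IU _ _ FA FB) => z [Kz nAB].
    by have [Az|nA] := pselect (A z); [right|left]; split=> // Bz; exact: nAB.
  - by move=> A B AB; apply: Isub; exact: setDS.
have [|z [Kz cz]] := cK F fF; first by rewrite /F /= setDv.
have [r r0 Ir] := loc z Kz.
have [||w [nw dw]] := cz (~` cdisc z r) (cdisc z r) => //.
- by rewrite /F /= setDE setCK.
- by apply/nbhs_cdiscP; exists r.
Qed.

Lemma closureP (A : set C) z : closure A z <-> forall e : R, 0 < e -> exists2 w, A w & cmod (w - z) < e.
Proof.
split=> [cz e e0|H B /nbhs_cdiscP [e e0 He]].
  by have [|w [Aw wz]] := cz (cdisc z e); [apply/nbhs_cdiscP; exists e|exists w].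
by have [w Aw wz] := H e e0; exists w; split=> //; exact: He.
Qed.

End compactness.

(** Three circles with a bound [x] at the inner circle that is at most half of the bound [y] at the
    outer one: the factor gained at [l] is [(t + l) / (2 * t)], less than 1 for [l < t]. *)
Lemma interpolation_room (R : realType) (t l x y : R) : (t - l) * (2 * x) <= (t - l) * y ->
  (t - l) * x + l * y <= (t + l) / 2 * y.
Proof. lra. Qed.

Section surrounding_orbit.
Context {R : realType}.
Local Notation C := R[i].
Variables (f : C -> C) (U Om : set C) (Us : nat -> set C) (B : R).
Hypotheses (hf : hol f) (npoly : ~ exists p : {poly C}, forall z, f z = p.[z]).
Hypotheses (orb : component_orbit f U Us) (dist : forall (m n : nat) z, Us m z -> Us n z -> m = n).
Hypotheses (oO : open Om) (bO : forall z, Om z -> cmod z <= B).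
Hypotheses (bdO : forall z, closure Om z -> ~ Om z -> U z) (nOU : exists2 z, Om z & ~ U z).

Let nc := transcendental_nonconstant npoly.
Let Bd : set C := closure Om `\` Om.
Let It n := iter n f.

Let hI n : hol (It n). Proof. by move=> z; exact: holo_iter. Qed.

Let cU : fatou_component f U.
Proof. by have [e /(_ 0%N) [c _]] := orb; rewrite -e. Qed.

Let iterU n z : U z -> Us n (It n z).
Proof. by case: orb => _ /(_ n) [_ H] Uz; apply: H; exists z. Qed.

Let stepU n m z : Us n z -> Us (m + n)%N (It m z).
Proof. by move=> Uz; elim: m => // m IH; rewrite addSn /It iterS; exact: (orbit_step hf nc orb IH). Qed.

Let clB z : closure Om z -> cmod z <= B.
Proof.
move=> /closureP cz; rewrite leNgt; apply/negP => h.
have [|w Ow wz] := cz (cmod z - B); first by rewrite subr_gt0.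
by have := bO Ow; have := cmod_subl z w; rewrite cmodB; lra.
Qed.

Let ccl : compact (closure Om).
Proof. exact: (compact_bounded_closed (@closed_closure _ _) clB). Qed.

Let cBd : compact Bd.
Proof.
apply: (@compact_bounded_closed _ _ B); last by move=> z [/clB].
by apply: closedI; [exact: closed_closure|exact: open_closedC].
Qed.

Let BdU : Bd `<=` U. Proof. by move=> z [h1 h2]; exact: bdO. Qed.

Let BdN : Bd !=set0.
Proof.
have [z1 Oz1 _] := nOU; have [|z [/closureP h1 h2]] := bounded_boundary oO _ bO; first by exists z1.
by exists z.
Qed.

Let maxp h (M : R) : hol h -> (forall z, Bd z -> cmod (h z) <= M) -> forall z, closure Om z -> cmod (h z) <= M.
Proof.
move=> hh HM; apply: (maximum_principle (@closed_closure _ _) clB) => z cz.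
  exact/holo_ccont/hh.
have [Oz|nO] := pselect (Om z); last by left; apply: HM.
right; have /open_cdiscP /(_ z Oz) [r r0 Hr] := oO; exists r; first exact: r0.
move=> w wz; split; last exact: hh.
by apply: subset_closure; exact: Hr.
Qed.

Let minp h (m : R) : hol h -> 0 < m -> (forall z, Om z -> h z != 0) -> (forall z, Bd z -> m <= cmod (h z)) ->
  forall z, closure Om z -> m <= cmod (h z).
Proof.
move=> hh m0 nz Hm; apply: (minimum_principle (@closed_closure _ _) clB) => // z cz.
  have [Oz|nO] := pselect (Om z); first exact: nz.
  by rewrite -cmod_gt0; apply: lt_le_trans m0 _; exact: Hm.
have [Oz|nO] := pselect (Om z); last by left; apply: Hm.
right; have /open_cdiscP /(_ z Oz) [r r0 Hr] := oO; exists r; first exact: r0.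
move=> w wz; by apply: subset_closure; exact: Hr.
Qed.

(** Otherwise [Om] minus [U] would be open, since the other Fatou components are open. Being bounded
    and nonempty it would have a boundary point, and such a point would lie in the open set [U],
    which it does not meet. *)
Let julia_inside : exists2 z, Om z & ~ fatou_set f z.
Proof.
apply: contrapT => h; have OF z : Om z -> fatou_set f z by move=> Oz; apply: contrapT => nF; apply: h; exists z.
have [oU _ _ _ _] := fatou_componentP cU.
pose O' := Om `\` U.
have sub z : O' z -> exists2 r, 0 < r & forall w, cmod (w - z) < r -> O' w.
  move=> [Oz nU]; have cV : fatou_component f (connected_component (fatou_set f) z) by exists z => //; exact: OF.
  have [/open_cdiscP oV _ _ _ _] := fatou_componentP cV.
  have Vz : connected_component (fatou_set f) z z by apply: connected_component_refl; exact: OF.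
  have [r r0 Hr] := oV z Vz; have /open_cdiscP /(_ z Oz) [s s0 Hs] := oO.
  exists (Num.min r s); first by rewrite lt_min r0.
  move=> w; rewrite lt_min => /andP [wr ws]; split; first exact: Hs.
  by move=> Uw; apply: nU; rewrite (fatou_component_eq cU cV Uw (Hr w wr)).
have [||z Oz|z [lz nz]] := @bounded_boundary _ O' B.
- by apply/open_cdiscP.
- by case: nOU => z; exists z.
- by case: Oz => /bO.
have Uz : U z.
  apply: contrapT => nU; apply: nz; split=> //; apply: contrapT => nO; apply: nU; apply: bdO => //.
  by apply/closureP => e /lz [w [Ow _] wz]; exists w.
move/open_cdiscP: oU => /(_ z Uz) [r r0 Hr]; have [w [_ nU] wz] := lz r r0.
by apply: nU; exact: Hr.
Qed.

(** Subsequences are extracted disc by disc. The alternatives of the discs are compatible, because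
    divergence at one point spreads to all compact subsets of the connected set [U]. *)
Let subseq_on K (m : nat -> nat) : compact K -> K `<=` U -> exists2 k : nat -> nat, {homo k : i j / (i < j)%N} &
  unif_cauchy K (fun i => It (m (k i))) \/ unif_infty K (fun i => It (m (k i))).
Proof.
move=> cK KU; have [_ coU _ UF _] := fatou_componentP cU.
pose I (A : set C) := forall m, exists2 k : nat -> nat, {homo k : i j / (i < j)%N} &
  unif_cauchy (K `&` A) (fun i => It (m (k i))) \/ unif_infty (K `&` A) (fun i => It (m (k i))).
suff : I K by move=> /(_ m); rewrite setIid.
have toK (p : nat -> nat) A : (K `&` A) !=set0 -> unif_infty (K `&` A) (fun i => It (p i)) -> unif_infty K (fun i => It (p i)).
  move=> [z [Kz Az]] ui; apply: (infty_connected coU UF (KU _ Kz)) => // M.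
  by have [N HN] := ui M; exists N => i Ni; exact: HN.
apply: (compact_ideal cK).
- by move=> p; exists id => //; left=> e _; exists 0%N => i j _ _ w; rewrite setI0.
- move=> A A' AA' HA' p; have [k hk [uc|ui]] := HA' p; exists k => //.
    by left=> e /uc [N HN]; exists N => i j Ni Nj w [Kw /AA' Aw]; exact: HN.
  by right=> M; have [N HN] := ui M; exists N => i Ni w [Kw /AA' Aw]; exact: HN.
- move=> A A' HA HA' p.
  have [eA|/set0P nA] := eqVneq (K `&` A) set0; first by rewrite setIUr eA set0U.
  have [eA'|/set0P nA'] := eqVneq (K `&` A') set0; first by rewrite setIUr eA' setU0.
  have [k hk [uc|/(toK _ _ nA) ui]] := HA p; last first.
    by exists k => //; right=> M; have [N HN] := ui M; exists N => i Ni w [Kw _]; exact: HN.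
  have [k' hk' [uc'|/(toK _ _ nA') ui]] := HA' (p \o k); exists (k \o k'); try exact: increasing_comp.
    left=> e e0; have [N HN] := unif_cauchy_sub hk' uc e0; have [N' HN'] := uc' e e0.
    exists (maxn N N') => i j; rewrite !geq_max => /andP [i1 i2] /andP [j1 j2] w [Kw [Aw|Aw]].
      by apply: HN.
    by apply: HN'.
  by right=> M; have [N HN] := ui M; exists N => i Ni w [Kw _]; exact: HN.
move=> z /KU /UF /fatou_tame [r r0 H]; exists r => // p; have [k hk [uc|ui]] := H p; exists k => //.
  by left=> e /uc [N HN]; exists N => i j Ni Nj w [_ [_ Aw]]; exact: HN.
by right=> M; have [N HN] := ui M; exists N => i Ni w [_ [_ Aw]]; exact: HN.
Qed.

(** Otherwise the iterates would be normal in [Om], against [julia_inside]: convergence on the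
    boundary is carried inside by the maximum principle, and divergence by the minimum principle,
    there being no zeros. *)
Let large_with_zero (M : R) : exists n, (forall z, Bd z -> M < cmod (It n z)) /\ exists2 z, Om z & It n z = 0.
Proof.
apply: contrapT => no; have [ze Oze nF] := julia_inside.
have /open_cdiscP /(_ ze Oze) [r r0 Hr] := oO.
apply: nF; apply: (tame_fatou r0) => m.
have [k hk [uc|ui]] := subseq_on m cBd BdU; exists k => //.
  left=> e e0; have e2 : 0 < e / 2 by rewrite divr_gt0.
  have [N HN] := uc _ e2; exists N => i j Ni Nj w dw.
  have le : cmod (It (m (k i)) w - It (m (k j)) w) <= e / 2; last by apply: le_lt_trans le _; lra.
  apply: (maxp (h := fun w => It (m (k i)) w - It (m (k j)) w)).
  - by move=> z; apply: holoB; exact: hI.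
  - by move=> z Bz; apply/ltW/HN.
  - by apply: subset_closure; exact: Hr.
right=> b; pose b' := `|b| + `|M| + 1; have b'0 : 0 < b' by rewrite ltr_wpDl // addr_ge0.
have [N HN] := ui b'; exists N => i Ni w dw.
have bb : b < b' by have := ler_norm b; have := normr_ge0 M; rewrite /b'; lra.
apply: lt_le_trans bb _; apply: (minp (hI (m (k i))) b'0).
- move=> z Oz; apply/eqP => e; apply: no; exists (m (k i)); split; last by exists z.
  move=> v Bv; apply: lt_trans (HN i Ni v Bv); have := ler_norm M; have := normr_ge0 b; rewrite /b'; lra.
- by move=> z Bz; apply/ltW/HN.
- by apply: subset_closure; exact: Hr.
Qed.

Let O n : set C := It n @` Om.

Let open_O n : open (O n).
Proof.
elim: n => [|n IH]; first by rewrite /O /It (_ : _ @` _ = Om) //; apply/seteqP; split=> [_ [z Oz <-]//|z Oz]; exists z.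
apply/open_cdiscP => _ [z Oz <-]; have /open_cdiscP /(_ (It n z)) [|r r0 Hr] := IH; first by exists z.
have [d d0 Hd] := open_mapping hf nc (It n z) r0; exists d => // w /Hd [v /Hr [x Ox <-] <-].
by exists x.
Qed.

Let O_S n z : O n z -> O n.+1 (f z).
Proof. by move=> [x Ox <-]; exists x. Qed.

(** The image of the compact closure of [Om] is closed, and a point of it that is outside the image
    of [Om] comes from the boundary. *)
Let O_boundary n z : (forall e, 0 < e -> exists2 w, O n w & cmod (w - z) < e) -> ~ O n z ->
  exists2 x, Bd x & It n x = z.
Proof.
move=> /closureP lz nz.
have cI : compact (It n @` closure Om).
  apply: (@continuous_compact _ _ (It n) (closure Om) _ ccl); apply: continuous_subspaceT => w.
  exact/ccont_continuous/holo_ccont/hI.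
have clI : closed (It n @` closure Om) by apply: compact_closed cI; exact: norm_hausdorff.
have : (It n @` closure Om) z.
  apply: clI; apply: closure_subset lz => _ [x Ox <-]; exists x => //; exact: subset_closure.
case=> x cx ex; exists x => //; split=> // Ox; apply: nz; by exists x.
Qed.

Let bounded_iterates N : exists M : R, forall i, (i <= N)%N -> forall x, closure Om x -> cmod (It i x) <= M.
Proof.
have b1 i : exists M : R, forall x, closure Om x -> cmod (It i x) <= M.
  have [M _ HM] := hol_bounded_disc 0 B (hI i); exists M => x /clB xB; apply: HM; by rewrite subr0.
elim: N => [|N [M HM]].
  by have [M HM] := b1 0%N; exists M => i; rewrite leqn0 => /eqP ->.
have [M' HM'] := b1 N.+1; exists (Num.max M M') => i; rewrite leq_eqVlt => /orP [/eqP ->|iN] x cx.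
  by rewrite le_max HM' ?orbT.
by rewrite le_max HM.
Qed.

(* Otherwise [sup |f^m|] over [Om] would not increase from [m = n] on. *)
Let next_outside n z : Us n.+1 z -> ~ O n z.
Proof.
move=> Uz Oz.
have [_ /(_ n.+1) [cn _]] := orb; have [_ con _ _ _] := fatou_componentP cn.
have sub : Us n.+1 `<=` O n.
  apply: (connected_sub con (@open_O n) Uz Oz) => w Uw lw; apply: contrapT => nO.
  have [x Bx ex] := O_boundary lw nO.
  have Uw' : Us n w by rewrite -ex; apply: iterU; exact: BdU.
  by have := dist Uw Uw'; lia.
have inO m : (n <= m)%N -> forall x, Bd x -> O m (It m.+1 x).
  elim: m => [|m IH]; last first.
    rewrite leq_eqVlt => /orP [/eqP <- x Bx|nm x Bx]; first by apply/sub/iterU/BdU.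
    by rewrite /It iterS; apply: O_S; exact: IH.
  by rewrite leqn0 => /eqP <- x Bx; apply/sub/iterU/BdU.
have [M HM] := bounded_iterates n.
have HM' m : (n <= m)%N -> forall x, closure Om x -> cmod (It m x) <= M.
  elim: m => [|m IH]; first by move=> n0; apply: HM; move: n0; rewrite leqn0 => /eqP ->.
  rewrite leq_eqVlt => /orP [/eqP <-|nm]; first exact: HM.
  apply: (maxp (hI _)) => x Bx; have [y Oy <-] := inO m nm x Bx.
  by apply: IH => //; exact: subset_closure.
have [m [Hm _]] := large_with_zero M; have [x Bx] := BdN.
have := Hm x Bx; rewrite ltNge => /negP; apply.
have cx : closure Om x by case: Bx.
by have [/HM|/ltnW /HM'] := leqP m n; apply.
Qed.

(** The disc is enlarged so as to contain [f 0]. Then [O m.+1] meets it at [f 0] as soon as [O m]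
    contains 0, and the boundary of [O m.+1], being in [Us m.+1], avoids [O m] and hence the
    disc. *)
Let disc_in_O (r : R) : exists N, forall n, (N <= n)%N -> cdisc 0 r `<=` O n.
Proof.
pose r' := `|r| + cmod (f 0) + 1.
have r0 : 0 < r' by rewrite ltr_wpDl // addr_ge0 // cmod_ge0.
suff [N HN] : exists N, forall n, (N <= n)%N -> cdisc 0 r' `<=` O n.
  exists N => n Nn z; rewrite /cdisc /= => zr; apply: (HN n Nn); apply: lt_trans zr _.
  by have := ler_norm r; have := cmod_ge0 (f 0); rewrite /r'; lra.
have [n [Hn [z0 Oz0 e0]]] := large_with_zero r'; exists n; elim=> [|m IH].
  rewrite leqn0 => /eqP en; move: Hn; rewrite en => Hn.
  apply: (connected_sub (@cdisc_connected _ 0 r') (@open_O 0) (cdisc_center 0 r0)); first by exists z0; rewrite -?en.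
  move=> z dz lz; apply: contrapT => /(O_boundary lz) [x Bx ex].
  by have := Hn x Bx; rewrite ex; move: dz; rewrite /cdisc /= subr0 => /lt_trans h /h; rewrite ltxx.
rewrite leq_eqVlt => /orP [/eqP en|/IH sub].
  rewrite -en.
  apply: (connected_sub (@cdisc_connected _ 0 r') (@open_O n) (cdisc_center 0 r0)); first by exists z0.
  move=> z dz lz; apply: contrapT => /(O_boundary lz) [x Bx ex].
  by have := Hn x Bx; rewrite ex; move: dz; rewrite /cdisc /= subr0 => /lt_trans h /h; rewrite ltxx.
have df : cdisc 0 r' (f 0) by rewrite /cdisc /= subr0 /r'; have := normr_ge0 r; lra.
have Of : O m.+1 (f 0) by apply/O_S/sub/cdisc_center.
apply: (connected_sub (@cdisc_connected _ 0 r') (@open_O m.+1) df Of) => z dz lz.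
apply: contrapT => /(O_boundary lz) [x Bx ex].
by apply: (@next_outside m z); [rewrite -ex; apply/iterU/BdU|exact: sub].
Qed.

Let escape_uniformly (M : R) : exists N, forall n, (N <= n)%N -> forall z, Us n z -> M < cmod z.
Proof.
have [N HN] := disc_in_O (M + 1); exists N.+1 => -[//|n] Nn z Uz; rewrite ltNge; apply/negP => zM.
by apply: (next_outside Uz); apply: (HN n Nn); rewrite /cdisc /= subr0; lra.
Qed.

Let maximizers : exists q : nat -> C, forall n, Bd (q n) /\ forall z, closure Om z -> cmod (It n z) <= cmod (It n (q n)).
Proof.
have /choice [q Hq] : forall n, exists x, Bd x /\ forall z, closure Om z -> cmod (It n z) <= cmod (It n x); last by exists q.
move=> n; have [|x Bx Hx] := compact_max_cmod cBd BdN (f := fun z => cmod (It n z)).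
  by move=> z _; exact/hol_continuous_cmod/hI.
by exists x; split=> //; apply: maxp (hI n) Hx.
Qed.

Section growth_on_boundary.
Variable q : nat -> C.
Hypothesis Hq : forall n, Bd (q n) /\ forall z, closure Om z -> cmod (It n z) <= cmod (It n (q n)).
Let Q n := ln (cmod (It n (q n))).

Let log_le n z : closure Om z -> 0 < cmod (It n z) -> ln (cmod (It n z)) <= Q n.
Proof.
move=> cz h; have hq := (proj2 (Hq n)) z cz; have h' := lt_le_trans h hq.
by rewrite /Q ler_ln ?posrE.
Qed.

Let Q_large (M : R) : exists N, forall n, (N <= n)%N -> M < Q n.
Proof.
have [N HN] := escape_uniformly (expR M); exists N => n Nn.
have h : expR M < cmod (It n (q n)) by exact: (HN n Nn _ (iterU n (BdU (proj1 (Hq n))))).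
by rewrite /Q -[M]expRK ltr_ln ?posrE ?expR_gt0 // (lt_trans (expR_gt0 M)).
Qed.

(** Harnack's inequality on [U] makes all values of [f^n] on the boundary at least [exp (Q n / c)]
    in modulus, so that [O n] contains that disc. One more application of [f] multiplies the
    logarithm by as much as superlinear growth allows. *)
Let Q_double : exists N, forall n, (N <= n)%N -> 2 * Q n <= Q n.+1.
Proof.
have [oU coU _ _ _] := fatou_componentP cU.
have [c c1 Hc] := harnack_compact oU coU cBd BdU.
have [t0 _ Ht] := lmm_superlinear hf npoly (4 * c).
have [N1 H1] := escape_uniformly 1; have [N2 H2] := disc_in_O 1; have [N3 H3] := Q_large (2 * c * t0).
exists (maxn N1 (maxn N2 N3)) => n; rewrite !geq_max => /and3P [n1 n2 n3].
have c0 : 0 < c by lra.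
have big x : Bd x -> 1 < cmod (It n x) by move=> Bx; apply: (H1 n n1); exact/iterU/BdU.
have Q0 : 0 < Q n by rewrite ln_gt0 // big //; exact: (proj1 (Hq n)).
have low x : Bd x -> expR (Q n / c) <= cmod (It n x).
  move=> Bx; rewrite -[leRHS]lnK ?posrE; last by have := big x Bx; lra.
  rewrite ler_expR ler_pdivrMr // mulrC.
  apply: (Hc (It n)) => //; last exact: (proj1 (Hq n)).
    by move=> w _; exact: hI.
  by move=> w Uw; apply: (H1 n n1); exact: iterU.
have e0 : 0 < expR (Q n / c) by exact: expR_gt0.
have sub : cdisc 0 (expR (Q n / c)) `<=` O n.
  have O0 : O n 0 by apply: (H2 n n2); apply: cdisc_center.
  apply: (connected_sub (@cdisc_connected _ 0 _) (@open_O n) (cdisc_center 0 e0) O0) => z dz lz.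
  apply: contrapT => /(O_boundary lz) [x Bx ex].
  by have := low x Bx; rewrite ex leNgt; move: dz; rewrite /cdisc /= subr0 => ->.
(* Half of the logarithmic radius of the disc; the growth factor [4 * c] at [t] yields [2 * Q n]. *)
have [t et] : exists t, Q n = 2 * c * t by exists (Q n / (2 * c)); field; lra.
have tt : t0 <= t.
  by have := H3 n n3; rewrite et => /ltW; rewrite ler_pM2l // mulr_gt0.
have t_gt0 : 0 < t by move: Q0; rewrite et pmulr_rgt0 // mulr_gt0.
have [pos gr] := Ht t tt.
have [z ez ef] := max_modulus_attained hf (expR_ge0 t).
have [x Ox ex] : O n z.
  apply: sub; rewrite /cdisc /= subr0 ez ltr_expR et ltr_pdivlMr //.
  by have := mulr_gt0 c0 t_gt0; lra.
apply: le_trans (_ : lmm f t <= _); first by rewrite et; lra.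
have e : It n.+1 x = f z by rewrite /It iterS -ex.
rewrite /lmm -ef -e; apply: log_le; first exact: subset_closure.
by rewrite e ef.
Qed.

(** The iterate [f^m] has to vary on a compact subset [K] of [U_k] by a factor independent of [m].
    It is large at [ws], the image of a maximizer, and smaller by the factor [th] at [zs], by the
    three circles theorem with the bounds [Q (m + j)] and [Q (m + k)]. *)
Lemma annulus_in_orbit : exists2 eta : R, 0 < eta < 1 & forall (T : R) n0, exists n L,
  [/\ (n0 <= n)%N, T <= L & forall w, w != 0 -> `|ln (cmod w) - L| <= eta * L -> Us n w].
Proof.
have [N1 H1] := disc_in_O 2; have [N2 H2] := Q_double; have [N3 H3] := Q_large 0.
have [N4 H4] := escape_uniformly 1.
(* From the index [j] on, the unit circle lies in [O j], which bounds [f^m] there by [Q (m + j)], at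
   most half of [Q (m + k)]. *)
pose j := N1; pose k := j.+1.
have [x Bx Hx] : exists2 x, Bd x & forall z, Bd z -> cmod (It k x) <= cmod (It k z).
  apply: (compact_min_cmod cBd BdN (f := fun z => cmod (It k z))) => z _; exact/hol_continuous_cmod/hI.
set rho := cmod (It k x).
have [_ /(_ k) [ck _]] := orb; have [oUk coUk _ _ _] := fatou_componentP ck.
have Uw : Us k (It k x) by exact/iterU/BdU.
have far z : Us k z -> 2 <= cmod z.
  move=> Uz; rewrite leNgt; apply/negP => z2; apply: (next_outside Uz).
  by apply: (H1 j (leqnn _)); rewrite /cdisc /= subr0.
have rho2 : 2 <= rho by exact: far.
have rho0 : 0 < rho by lra.
have sub : cdisc 0 rho `<=` O k.
  have O0 : O k 0 by apply: (H1 k (leqnSn _)); exact: cdisc_center.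
  apply: (connected_sub (@cdisc_connected _ 0 rho) (@open_O k) (cdisc_center 0 rho0) O0) => z dz lz.
  apply: contrapT => /(O_boundary lz) [y By ey].
  by have := Hx y By; rewrite ey leNgt; move: dz; rewrite /cdisc /= subr0 => ->.
(* Starting from a point of the image of the boundary closest to 0, a small move towards 0 stays in
   [U_k] and enters the disc of radius [rho] in [O k]. *)
have [tau [tau0 tau1 Uz]] : exists tau : R, [/\ 0 < tau, tau < 1 & Us k ((1 - tau)%:C * It k x)].
  have /open_cdiscP /(_ _ Uw) [r r0 Hr] := oUk.
  exists (r / (2 * (r + rho))).
  have h : 0 < r + rho by lra.
  split; first by rewrite divr_gt0 // mulr_gt0.
    by rewrite ltr_pdivrMr ?mulr_gt0 //; lra.
  apply: Hr; rewrite rmorphB rmorph1 mulrBl mul1r addrAC subrr add0r cmodN cmodM cmodR -/rho.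
  rewrite ger0_norm ?divr_ge0 ?mulr_ge0 //; try lra.
  by rewrite mulrAC ltr_pdivrMr ?mulr_gt0 //; nra.
set zs := (1 - tau)%:C * It k x in Uz.
have czs : cmod zs = (1 - tau) * rho by rewrite /zs cmodM cmodR ger0_norm //; lra.
(* The outer circle has radius [r2] strictly between [cmod zs] and [rho], hence lies in [O k]. *)
pose l := ln (cmod zs); pose r2 := (1 - tau / 2) * rho; pose t2 := ln r2.
have zs2 : 2 <= cmod zs by exact: far.
have zr : cmod zs < r2 by rewrite czs /r2 ltr_pM2r //; lra.
have r20 : 0 < r2 by lra.
have l0 : 0 < l by rewrite ln_gt0; lra.
have lt2 : l < t2 by rewrite ltr_ln ?posrE //; lra.
have r2rho : r2 < rho by rewrite /r2 gtr_pMl //; lra.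
pose th := (t2 + l) / (2 * t2).
have t20 : 0 < t2 by lra.
have th01 : 0 <= th < 1.
  by rewrite /th divr_ge0 ?mulr_ge0 ?ltr_pdivrMr ?mulr_gt0 //=; lra.
pose K := It k @` Bd `|` [set zs].
have cK : compact K.
  apply: compactU; last exact: compact_set1.
  apply: (@continuous_compact _ _ (It k) Bd _ cBd); apply: continuous_subspaceT => w.
  exact/ccont_continuous/holo_ccont/hI.
have KU : K `<=` Us k by move=> _ [[y By <-]|->] //; exact/iterU/BdU.
have [eta eta01 Heta] := chain_annulus oUk coUk cK KU th01.
exists eta => // T n0; have /andP [eta0 _] := eta01.
have [N5 H5] := escape_uniformly (expR (pi / eta)); have [N6 H6] := escape_uniformly (expR T).
pose m := (n0 + N2 + N3 + N4 + N5 + N6)%N.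
have [m1 m2 m4 m5 m6] : [/\ (n0 <= m)%N, (N2 <= m)%N, (N4 <= m)%N, (N5 <= m)%N & (N6 <= m)%N].
  by rewrite /m; split; clear; lia.
have lemk i : (i <= m)%N -> (i <= m + k)%N by move=> h; exact: leq_trans h (leq_addr _ _).
have itD y : It (m + k) y = It m (It k y) by rewrite /It iterD.
have Usm z : Us k z -> Us (m + k)%N (It m z) by exact: stepU.
have big1 w : Us k w -> 1 < cmod (It m w) by move=> /Usm; apply: H4; exact: lemk.
have ln_big (s : R) w : expR s < cmod w -> s <= ln (cmod w).
  by move=> h; rewrite -[s]expRK ler_ln ?posrE ?expR_gt0 ?(ltW h) // (lt_trans (expR_gt0 s)).
have bigpi w : Us k w -> pi <= eta * ln (cmod (It m w)).
  move=> /Usm Uw'; rewrite mulrC -ler_pdivrMr //; apply: ln_big; by apply: H5 Uw'; exact: lemk.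
have bigT w : Us k w -> T <= ln (cmod (It m w)).
  by move=> /Usm Uw'; apply: ln_big; by apply: H6 Uw'; exact: lemk.
pose ws := It k (q (m + k)%N).
have Qk : ln (cmod (It m ws)) = Q (m + k) by rewrite /Q itD.
have dQ : 2 * Q (m + j)%N <= Q (m + k)%N by rewrite /k addnS; apply: H2; exact: leq_trans m2 (leq_addr _ _).
have cw : Bd (q (m + k)%N) := proj1 (Hq _).
have Kws : K ws by left; exists (q (m + k)%N).
have Kzs : K zs by right.
have bound n z : O n z -> cmod (It m z) <= expR (Q (m + n)).
  move=> [y Oy <-]; rewrite /It -iterD -/(It (m + n)).
  have [->|p] := eqVneq (It (m + n) y) 0; first by rewrite cmod0 expR_ge0.
  rewrite -[leLHS]lnK ?posrE ?cmod_gt0 // ler_expR; apply: log_le; first exact: subset_closure.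
  by rewrite cmod_gt0.
have hzs : ln (cmod (It m zs)) <= th * ln (cmod (It m ws)).
  have zs0 : zs != 0 by rewrite -cmod_gt0; apply: lt_le_trans zs2.
  have := @three_circles R (It m) 0 t2 (Q (m + j)) (Q (m + k)) (hI m) t20 _ _ zs zs0.
  rewrite -/l => h.
  have {}h : cmod (It m zs) <= expR (((t2 - l) * Q (m + j) + (l - 0) * Q (m + k)) / (t2 - 0)).
    apply: h; last by rewrite (ltW l0) ltW.
      move=> z; rewrite expR0 => z1; apply: bound; apply: (H1 j (leqnn _)); by rewrite /cdisc /= subr0 z1 ltr1n.
    by move=> z; rewrite /t2 lnK ?posrE // => z1; apply: bound; apply: sub; rewrite /cdisc /= subr0 z1.
  have c0 : 0 < cmod (It m zs) := lt_trans ltr01 (big1 _ Uz).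
  rewrite Qk -[leRHS]expRK ler_ln ?posrE ?expR_gt0 //; apply: le_trans h _.
  rewrite ler_expR !subr0 ler_pdivrMr //.
  have -> : th * Q (m + k) * t2 = (t2 + l) / 2 * Q (m + k) by rewrite /th; field; exact: lt0r_neq0.
  by apply: interpolation_room; apply: ler_wpM2l => //; rewrite subr_ge0 ltW.
have [a Ua Ha] := Heta (It m) (fun w _ => hI m w) big1 bigpi ws zs Kws Kzs hzs.
exists (m + k)%N, (ln (cmod (It m a))); split; [exact: lemk|exact: bigT|].
by move=> w w0 hw; have [z Uz' <-] := Ha w w0 hw; exact: Usm.
Qed.

End growth_on_boundary.

Lemma orbit_escapes (M : R) : exists N, forall n, (N <= n)%N -> forall z, Us n z -> M < cmod z.
Proof. exact: escape_uniformly. Qed.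

Lemma orbit_annuli : exists2 eta : R, 0 < eta < 1 & forall (T : R) n0, exists n L,
  [/\ (n0 <= n)%N, T <= L & forall w, w != 0 -> `|ln (cmod w) - L| <= eta * L -> Us n w].
Proof. by have [q Hq] := maximizers; exact: annulus_in_orbit Hq. Qed.

End surrounding_orbit.

Theorem wandering_annuli (R : realType) (f : R[i] -> R[i]) : hol f ->
  (~ exists p : {poly R[i]}, forall z, f z = p.[z]) -> has_multiply_connected_wandering_domain f ->
  exists Us : nat -> set R[i], [/\ forall n, open (Us n), forall n z, Us n z -> Us n.+1 (f z),
    forall M : R, exists N, forall n, (N <= n)%N -> forall z, Us n z -> M < cmod z &
    exists2 eta : R, 0 < eta < 1 & forall (T : R) n0, exists n L,
      [/\ (n0 <= n)%N, T <= L & forall w, w != 0 -> `|ln (cmod w) - L| <= eta * L -> Us n w]].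
Proof.
move=> hf npoly [U wU [dU nsc]]; have nc := transcendental_nonconstant npoly.
have [Us orb dist] := wandering_distinct hf nc wU.
have [_ oU _] := dU.
have /existsNP [gam /not_implyP [lg ng]] := nsc.
have [Om [oO [B bO] bdO nOU]] := loop_surrounds oU lg ng.
have bdO' z : closure Om z -> ~ Om z -> U z by move=> /closureP; exact: bdO.
exists Us; split.
- by move=> n; have [_ /(_ n) [/fatou_componentP []]] := orb.
- by move=> n z; exact: (orbit_step hf nc orb).
- exact: (orbit_escapes hf npoly orb dist oO bO bdO' nOU).
- exact: (orbit_annuli hf npoly orb dist oO bO bdO' nOU).
Qed.

(** * Comparison of two entire functions on annuli *)

Section rings.
Context {R : realType}.
Local Notation C := R[i].
Implicit Types (z w : C) (f h : C -> C).

Lemma ring_connected (m M : R) : 0 < m -> connected [set w : C | m < cmod w < M].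
Proof.
move=> m0; have -> : [set w : C | m < cmod w < M] = cexp @` [set u : C | m < expR (Re u) < M].
  apply/seteqP; split=> [w /= h|_ [u /= h <-]]; last by rewrite cmod_cexp.
  have w0 : w != 0 by rewrite -cmod_gt0; lra.
  by have [u e _] := cexp_surj_pi w0; exists u; rewrite //= -cmod_cexp e.
apply: connected_continuous_connected.
  apply: convex_connected => z w s /= /andP [h1 h2] /andP [h3 h4] hs.
  rewrite cReD mulrC cReMr cReD cReN.
  have [e|e] := leP (Re z) (Re w).
    apply/andP; split; [apply: lt_le_trans h1 _|apply: le_lt_trans _ h4]; rewrite ler_expR; nra.
  apply/andP; split; [apply: lt_le_trans h3 _|apply: le_lt_trans _ h2]; rewrite ler_expR; nra.
by apply: continuous_subspaceT => u; apply/ccont_continuous/holo_ccont/holo_cexp.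
Qed.

Lemma open_image f (A : set C) : hol f -> (exists a b, f a != f b) -> open A -> open (f @` A).
Proof.
move=> hf nc /open_cdiscP oA; apply/open_cdiscP => _ [z Az <-].
have [r r0 Hr] := oA z Az; have [d d0 Hd] := open_mapping hf nc z r0.
by exists d => // w /Hd [v /Hr Av <-]; exists v.
Qed.

(** The image of the open ring is open, and its boundary lies in the images of the two circles,
    which avoid the connected target ring. *)
Lemma ring_cover f (r1 r2 m M : R) z0 : hol f -> (exists a b, f a != f b) -> 0 < m ->
  (forall z, cmod z = r1 -> cmod (f z) <= m) -> (forall z, cmod z = r2 -> M <= cmod (f z)) ->
  r1 < cmod z0 < r2 -> m < cmod (f z0) < M ->
  forall w, m < cmod w < M -> exists2 z, r1 < cmod z < r2 & f z = w.
Proof.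
move=> hf nc m0 H1 H2 hz0 hf0.
pose A : set C := [set z | r1 < cmod z < r2].
have oA : open A.
  apply/open_cdiscP => z /= /andP [h1 h2].
  exists (Num.min (cmod z - r1) (r2 - cmod z)); first by rewrite lt_min !subr_gt0 h1 h2.
  move=> w; rewrite lt_min => /andP [k1 k2].
  have A1 := cmod_subl z w; have A2 := cmod_subl w z; rewrite [cmod (z - w)]cmodB in A1.
  by apply/andP; split; lra.
pose K : set C := [set z | r1 <= cmod z <= r2].
have cK : compact K.
  apply: (@compact_bounded_closed R K r2); last by move=> z /andP [].
  have -> : K = [set z | r1 <= cmod z] `&` [set z | cmod z <= r2].
    by apply/seteqP; split=> z /=; [move=> /andP [? ?]; split|move=> [h1 h2]; apply/andP; split].
  apply: closedI.
    by apply: closed_comp (@closed_ge R r1) => z _; exact: continuous_cmod.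
  by apply: closed_comp (@closed_le R r2) => z _; exact: continuous_cmod.
have clf : closed (f @` K).
  apply: compact_closed; first exact: norm_hausdorff.
  apply: (@continuous_compact _ _ f K _ cK); apply: continuous_subspaceT => w.
  exact/ccont_continuous/holo_ccont/hf.
have sub : [set w : C | m < cmod w < M] `<=` f @` A.
  apply: (connected_sub (@ring_connected m M m0) (open_image hf nc oA) hf0); first by exists z0.
  move=> w /= hw lw; have [z /andP [z1 z2] ez] : (f @` K) w.
    apply: (closed_limit clf) => e e0; have [v [z Az <-] vw] := lw e e0.
    by exists (f z) => //; exists z => //; move: Az => /= /andP [/ltW h1 /ltW h2]; rewrite /K /= h1.
  move: z1 z2 hw; rewrite -ez !le_eqVlt => /orP [/eqP e1|z1].
    by have := H1 z (esym e1); lra.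
  move=> /orP [/eqP e2|z2] hw; first by have := H2 z e2; lra.
  by exists z => //; rewrite /A /= z1.
by move=> w hw; have [z Az <-] := sub w hw; exists z.
Qed.

(** In the logarithmic coordinate two points of a circle are at distance at most [pi], and the disc
    of radius [l] is available. With [t = pi / l], the constant [(1 - t) / (1 + t)] is at least
    [1 - 2 * t]. *)
Lemma circle_harnack f (s l : R) z : hol f -> pi < l ->
  (forall w, w != 0 -> `|ln (cmod w) - s| < l -> 1 < cmod (f w)) -> cmod z = expR s ->
  (1 - 2 * (pi / l)) * lmm f s <= ln (cmod (f z)).
Proof.
move=> hf pl H ez; have pi0 : 0 < pi :> R := pi_gt0 R; have l0 : 0 < l by lra.
have [z1 ez1 ef] := max_modulus_attained hf (expR_ge0 s).
have nz w : cmod w = expR s -> w != 0 by move=> e; rewrite -cmod_gt0 e expR_gt0.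
have [u eu _] := cexp_surj_pi (nz _ ez); have [v ev vu] := cexp_surj_near (Im u) (nz _ ez1).
have re w a : cexp w = a -> cmod a = expR s -> Re w = s.
  by move=> e1 e2; apply: (@expR_inj R); rewrite -cmod_cexp e1.
have Ru := re _ _ eu ez; have Rv := re _ _ ev ez1.
pose t := pi / l; have t01 : 0 <= t < 1 by rewrite /t divr_ge0 ?ltW //= ltr_pdivrMr // mul1r.
have big w : cmod w = expR s -> 1 < cmod (f w).
  by move=> e; apply: H; [exact: nz|rewrite e expRK subrr normr0].
have := @harnack R (f \o cexp) u l t v l0 _ _ t01 _.
case.
- by move=> w _; apply: holo_comp; [exact: holo_cexp|exact: hf].
- move=> w uw; apply: H; first exact: cexp_neq0.
  rewrite cmod_cexp expRK -Ru -cReN -cReD; exact: le_lt_trans (cmod_Re _) uw.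
- apply: le_trans (cmod_leD _) _; rewrite cReD cReN Ru Rv subrr normr0 add0r cImD cImN.
  by rewrite /t divfK // gt_eqF.
rewrite /= eu ev ef -/(lmm f s) => h _.
have F0 : 0 < lmm f s by rewrite /lmm -ef ln_gt0 // big.
rewrite -(ler_pM2l (_ : 0 < 1 + t)); last by lra.
apply: le_trans h; rewrite -/t [leLHS]mulrA ler_pM2r //; nra.
Qed.

End rings.

(** * Inequalities between the radii of successive annuli *)

Section arithmetic.
Context {R : realType}.
Implicit Types a d e x y : R.

Lemma cancel_factor a x y : 0 < a -> a * x <= a * y -> x <= y.
Proof. by move=> a0; rewrite ler_pM2l. Qed.

Lemma loss_le1 d e : 0 < d <= 2^-1 -> 16 * e <= d -> 0 <= 1 - e.
Proof. lra. Qed.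

(** In this and the next two lemmas [x] stands for the value of F at [a] or [b]. The hypothesis
    [16 <= d * x] absorbs the additive 1, and [16 * e <= d] the Harnack loss. *)
Lemma inner_room d e x : 0 < d <= 2^-1 -> 0 < e -> 16 * e <= d -> 0 < x -> 16 <= d * x ->
  (1 - d / 2) * x <= ((1 - e) * x - 1) * (1 - d / 4).
Proof.
move=> d0 e0 ed x0 dx; have h : 16 * e * x <= d * x by rewrite ler_pM2r.
have h2 : 0 < e * x * d by rewrite !mulr_gt0 //; case/andP: d0.
lra.
Qed.

Lemma outer_room d e x : 0 < d <= 2^-1 -> 0 < e -> 16 * e <= d -> 0 < x -> 16 <= d * x ->
  (x + 1) * (1 + d / 4) <= (1 - e) * ((1 + d / 2) * x).
Proof.
move=> d0 e0 ed x0 dx; have h : 16 * e * x <= d * x by rewrite ler_pM2r.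
have h2 : e * x * d <= e * x * 2^-1 by rewrite ler_pM2l ?mulr_gt0 //; case/andP: d0.
lra.
Qed.

Lemma zero_room d e x : 0 < d <= 2^-1 -> 0 < e -> 16 * e <= d -> 0 < x -> 16 <= d * x ->
  (1 - d) * x + 1 <= ((1 - e) * x - 1) * (1 - d / 4).
Proof.
move=> d0 e0 ed x0 dx; have h : 16 * e * x <= d * x by rewrite ler_pM2r.
have h2 : 0 < e * x * d by rewrite !mulr_gt0 //; case/andP: d0.
lra.
Qed.

Lemma ring_room a b d : 0 < a -> a <= b -> 0 < d <= 2^-1 ->
  [/\ a * (1 - d) < a * (1 - d / 2), a * (1 - d / 2) < a, b < b * (1 + d / 2),
      b * (1 + d / 2) < b * (1 + d) & a <= 2 * (a * (1 - d))].
Proof.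
move=> a0 ab d0; have ad : 0 < a * d by rewrite mulr_gt0 //; case/andP: d0.
have bd : 0 < b * d by rewrite mulr_gt0 //; [lra|case/andP: d0].
have h : a * d <= a * 2^-1 by rewrite ler_pM2l //; case/andP: d0.
split; lra.
Qed.

Lemma value_room d x y u v : 0 < d -> 0 < x -> x <= y -> u <= (1 - d / 2) * x ->
  (y + 1) * (1 + d / 4) <= v -> u < x /\ x < v.
Proof.
move=> d0 x0 xy ux yv; have h1 : 0 < d * x by exact: mulr_gt0.
have h2 : 0 < d * y by apply: mulr_gt0 => //; lra.
lra.
Qed.

End arithmetic.

Section comparison.
Context {R : realType}.
Local Notation C := R[i].
Variables (f g : C -> C) (al T1 K : R).
Hypotheses (hf : hol f) (hg : hol g) (nc : exists a b, f a != f b).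
Hypotheses (al01 : 0 < al < 1) (T11 : 1 <= T1) (K16 : 16 <= K) (Kal : 2 <= (1 - al) * K).
Hypothesis fpos : forall t, T1 <= t -> 0 < max_modulus (expR t) f.
Hypothesis fgrow : forall t, T1 <= t -> 34 * t <= lmm f t.
Hypothesis fratio : forall s t, T1 <= s -> s <= t -> t * lmm f s <= s * lmm f t.
Hypothesis fclose : forall t, T1 <= t -> max_modulus (expR t) (g \- f) <= expR (al * lmm f t).

Let F := lmm f.

(** As [pi < 4], the last inequality makes the Harnack loss at most [d / K]. The factor in [2 * T1]
    keeps the inner radius [a * (1 - d)] above [T1]. *)
Definition admissible (a b d : R) := [/\ 2 * T1 <= a, a <= b, 0 < d <= 2^-1 & 16 * K <= a * d ^+ 2].
(* In the coordinate [log z], Harnack's inequality is used on discs of radius [a * d / 2] for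
   points at distance at most [pi]. *)
Definition harnack_loss (a d : R) : R := 4 * pi / (a * d).

Let pi0 : 0 < pi :> R := pi_gt0 R.
Let pi4 : pi < 4 :> R.
Proof. by have /andP [_] := @pihalf_02 R; lra. Qed.

Lemma adm_loss a b d : admissible a b d ->
  [/\ 0 < harnack_loss a d, 16 * harnack_loss a d <= d & 2 * harnack_loss a d <= 1 - al].
Proof.
case=> a1 ab d01 Kad; have T := T11; have K1 := K16; have K2 := Kal; have p0 := pi0; have p4 := pi4.
have a0 : 0 < a by lra.
have d0 : 0 < d by lra.
have ad0 : 0 < a * d by exact: mulr_gt0.
have e0 : 0 < harnack_loss a d by rewrite /harnack_loss divr_gt0 ?mulr_gt0.
have e : harnack_loss a d * (a * d) = 4 * pi by rewrite /harnack_loss divfK // gt_eqF.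
have e2 : harnack_loss a d * (16 * K) <= 16 * d.
  apply: le_trans (_ : harnack_loss a d * (a * d ^+ 2) <= _); first by rewrite ler_pM2l.
  by rewrite expr2 !mulrA -[_ * a * d]mulrA e ler_pM2r //; lra.
have hK : harnack_loss a d * K <= d by lra.
have al0 : 0 < 1 - al by have := al01; lra.
split=> //.
  apply: le_trans hK; rewrite mulrC ler_pM2l //.
have K0 : 0 < K by lra.
rewrite -(ler_pM2r K0); lra.
Qed.

Let adm_F a b d t : admissible a b d -> a <= t -> [/\ T1 <= t, 34 * t <= F t, 0 < F t & 16 <= d * F t].
Proof.
case=> a1 ab d01 Kad at_; have T := T11; have K1 := K16.
have Tt : T1 <= t by lra.
have gr := fgrow Tt; have F0 : 0 < F t by rewrite /F; lra.
split=> //.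
have d0 : 0 < d by lra.
apply: le_trans (_ : d * a <= _); last by rewrite ler_pM2l // /F; lra.
apply: le_trans (_ : a * d ^+ 2 <= _); first by lra.
by rewrite [d * a]mulrC ler_pM2l; [rewrite expr2 ler_piMl; lra|lra].
Qed.

Definition next_inner (a d : R) : R := (1 - harnack_loss a d) * F a - 1.
Definition next_outer (b : R) : R := F b + 1.

Let F_mono s t : T1 <= s -> s <= t -> F s <= F t.
Proof. by move=> Ts st; apply: lmm_mono => //; exact: fpos. Qed.

(** The factor 16 is the square of the 4 by which [d] is divided, so that [a * d ^+ 2] does not
    decrease. *)
Lemma next_inner_large a b d : admissible a b d -> 16 * a <= next_inner a d.
Proof.
move=> ad; have [e0 e1 _] := adm_loss ad; have [Ta gr F0 _] := adm_F ad (lexx a).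
case: ad => a1 ab d01 Kad; rewrite /next_inner.
move: (harnack_loss a d) e0 e1 => e e0 e1; have T := T11.
have h : e * F a <= 32^-1 * F a by rewrite ler_pM2r //; lra.
rewrite mulrBl mul1r; lra.
Qed.

Lemma step_admissible a b d : admissible a b d -> admissible (next_inner a d) (next_outer b) (d / 4).
Proof.
move=> ad; have big := next_inner_large ad; have [e0 e1 _] := adm_loss ad.
have [Ta gr F0 _] := adm_F ad (lexx a); case: (ad) => a1 ab d01 Kad.
have T := T11; split.
- lra.
- have := F_mono Ta ab; rewrite /next_inner /next_outer mulrBl mul1r.
  have : 0 < harnack_loss a d * F a by exact: mulr_gt0.
  lra.
- lra.
apply: le_trans Kad _; have -> : (d / 4) ^+ 2 = d ^+ 2 / 16 by field.
have : 16 * a * d ^+ 2 <= next_inner a d * d ^+ 2 by rewrite ler_wpM2r // sqr_ge0.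
lra.
Qed.

Section one_step.
Variables a b d : R.
Hypothesis ad : admissible a b d.
Hypothesis big : forall z, z != 0 -> a * (1 - d) < ln (cmod z) < b * (1 + d) -> 1 < cmod (f z).
Let e := harnack_loss a d.

Let lower s z : a <= s -> s <= b * (1 + d / 2) -> cmod z = expR s -> (1 - e) * F s <= ln (cmod (f z)).
Proof.
move=> as_ sb ez; have [e0 e1 _] := adm_loss ad; case: (ad) => a1 ab d01 Kad; have T := T11.
have K1 := K16; have p0 := pi0; have p4 := pi4.
have a0 : 0 < a by lra.
have d0 : 0 < d by lra.
have l0 : 0 < a * d / 2 by rewrite divr_gt0 // mulr_gt0.
have -> : e = 2 * (pi / (a * d / 2)) by rewrite /e /harnack_loss; field; lra.
apply: circle_harnack => //.
  have : a * d ^+ 2 <= a * d by rewrite expr2 mulrA ler_piMr ?mulr_ge0 //; lra.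
  lra.
move=> w w0; rewrite ltr_norml => hw; apply: big => //.
have h1 : 0 < a * d by exact: mulr_gt0.
have h2 : a * d <= b * d by rewrite ler_pM2r.
lra.
Qed.

(** [ring_cover] is applied between the logarithmic radii [p] and [q], half-way into the margins;
    the outer halves leave space for the Harnack discs. Monotonicity of F(t)/t separates the values
    of F at [p] and [q] from those at [a] and [b] by factors [1 - d / 2] and [1 + d / 2]. *)
Lemma step_cover w : w != 0 ->
  next_inner a d * (1 - d / 4) < ln (cmod w) < next_outer b * (1 + d / 4) ->
  exists2 z, z != 0 /\ a * (1 - d) < ln (cmod z) < b * (1 + d) & f z = w.
Proof.
move=> w0 /andP [hw1 hw2]; have [e0 e1 e2] := adm_loss ad; have [Ta gra Fa0 dFa] := adm_F ad (lexx a).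
case: (ad) => a1 ab d01 Kad; have [Tb grb Fb0 dFb] := adm_F ad ab.
rewrite -/e in e0 e1 e2; have d0 : 0 < d by case/andP: d01.
have a0 : 0 < a by apply: lt_le_trans Ta; exact: lt_le_trans T11.
have b0 : 0 < b := lt_le_trans a0 ab.
have [R1 R2 R3 R4 R5] := ring_room a0 ab d01.
pose p := a * (1 - d / 2); pose q := b * (1 + d / 2).
have Tp : T1 <= p.
  by apply: le_trans (ltW R1); rewrite -(ler_pM2l (ltr0n R 2)); exact: le_trans a1 R5.
have Fp : F p <= (1 - d / 2) * F a.
  by apply: (cancel_factor a0); rewrite mulrA; exact: fratio Tp (ltW R2).
have Fq : (1 + d / 2) * F b <= F q.
  by apply: (cancel_factor b0); rewrite mulrA; exact: fratio Tb (ltW R3).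
have in1 : (1 - d / 2) * F a <= next_inner a d * (1 - d / 4) by exact: inner_room.
have in2 : next_outer b * (1 + d / 4) <= (1 - e) * F q.
  apply: le_trans (outer_room d01 e0 e1 Fb0 dFb) _; apply: ler_wpM2l => //.
  exact: loss_le1 d01 e1.
have [v1 v2] := value_room d0 Fa0 (F_mono Ta ab) Fp in2.
have wE : cmod w = expR (ln (cmod w)) by rewrite lnK // posrE cmod_gt0.
have [z0 ez0 ef0] := max_modulus_attained hf (expR_ge0 a).
have fE t : T1 <= t -> max_modulus (expR t) f = expR (F t) by move=> Tt; rewrite lnK // posrE fpos.
have [|||||z hz ezw] := @ring_cover R f (expR p) (expR q) (expR (F p)) (expR ((1 - e) * F q)) z0 hf nc
  (expR_gt0 _) _ _ _ _ w.
- by move=> z ez; rewrite -(fE p Tp) -ez; exact: le_max_modulus_circle.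
- move=> z ez; have z0' : z != 0 by rewrite -cmod_gt0 ez expR_gt0.
  have c1 : 1 < cmod (f z).
    apply: big => //; rewrite ez expRK R4 andbT.
    by apply: lt_trans R1 (lt_trans R2 (le_lt_trans ab R3)).
  have c0 : 0 < cmod (f z) by apply: lt_trans c1; exact: ltr01.
  have lo := lower (ltW (le_lt_trans ab R3)) (lexx _) ez.
  by rewrite -[leRHS]lnK ?posrE // ler_expR; exact: lo.
- by rewrite ez0 !ltr_expR R2; exact: le_lt_trans ab R3.
- rewrite ef0 (fE a Ta); apply/andP; split; rewrite ltr_expR; [exact: v1|exact: v2].
- rewrite wE !ltr_expR; apply/andP; split; last exact: lt_le_trans hw2 in2.
  exact: le_lt_trans Fp (le_lt_trans in1 hw1).
have z0' : 0 < cmod z by apply: lt_trans (expR_gt0 p) _; case/andP: hz.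
exists z => //; split; first by rewrite -cmod_gt0.
move: hz; rewrite -[cmod z]lnK ?posrE // !ltr_expR lnK ?posrE // => /andP [h1 h2].
by apply/andP; split; [exact: lt_trans R1 h1|exact: lt_trans h2 R4].
Qed.

Let diff_le t z : T1 <= t -> cmod z = expR t -> cmod (g z - f z) <= expR (al * F t).
Proof.
move=> Tt ez; apply: le_trans (fclose Tt); rewrite -ez.
by apply: (@le_max_modulus_circle R (g \- f)) => w; apply: holoB; [exact: hg|exact: hf].
Qed.

Let half_e : 2 <= expR 1 :> R.
Proof. by have := expR_ge1Dx (1 : R); lra. Qed.

(** As [2 * e <= 1 - al], the lower bound [(1 - e) * F s] for [ln |f|] exceeds [al * F s] by at
    least 1. So [|g - f|] is at most half of [|f|], and the logarithm changes by at most 1. *)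
Lemma step_g z : z != 0 -> a <= ln (cmod z) <= b -> g z != 0 /\
  (1 - e) * F (ln (cmod z)) - 1 <= ln (cmod (g z)) <= F (ln (cmod z)) + 1.
Proof.
move=> z0 hz; set s := ln (cmod z) in hz *; have ez : cmod z = expR s by rewrite lnK // posrE cmod_gt0.
have [e0 e1 e2] := adm_loss ad; rewrite -/e in e0 e1 e2.
have as_ : a <= s by lra.
have [Ts gr Fs0 dFs] := adm_F ad as_; case: (ad) => a1 ab d01 Kad; have T := T11.
have b0 : 0 < b * d by apply: mulr_gt0; lra.
have lo : (1 - e) * F s <= ln (cmod (f z)) by apply: lower => //; lra.
have fz1 : 1 < cmod (f z).
  apply: big => //; rewrite -/s; have : 0 < a * d by apply: mulr_gt0; lra.
  lra.
have up : cmod (f z) <= expR (F s).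
  by rewrite lnK ?posrE ?fpos // -ez; exact: le_max_modulus_circle.
have df := diff_le Ts ez.
have key : al * F s <= ln (cmod (f z)) - 1.
  have h : 2 <= (1 - al) * F s.
    apply: le_trans Kal _; rewrite ler_pM2l; last by have := al01; lra.
    have h1 : a * d ^+ 2 <= a.
      by rewrite ler_piMr ?expr_le1 //; lra.
    have := K16; lra.
  have : 2 * e * F s <= (1 - al) * F s by rewrite ler_pM2r.
  lra.
have fE : cmod (f z) = expR (ln (cmod (f z))) by rewrite lnK // posrE; lra.
have df2 : cmod (g z - f z) * 2 <= cmod (f z).
  apply: le_trans (_ : expR (ln (cmod (f z)) - 1) * 2 <= _).
    by rewrite ler_pM2r //; apply: le_trans df _; rewrite ler_expR.
  rewrite expRD -fE -mulrA ler_piMr ?cmod_ge0 // expRN mulrC ler_pdivrMr ?expR_gt0 // mul1r.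
  exact: half_e.
have t1 := cmod_subl (f z) (g z); have t2 := cmodD (f z) (g z - f z).
rewrite addrC subrK in t2; rewrite cmodB in t1.
have glo : cmod (f z) / 2 <= cmod (g z) by lra.
have g0 : 0 < cmod (g z) by lra.
split; first by rewrite -cmod_gt0.
apply/andP; split.
  apply: le_trans (_ : ln (cmod (f z)) - 1 <= _); first by lra.
  rewrite -ler_expR lnK ?posrE // expRD -fE expRN ler_pdivrMr ?expR_gt0 //.
  have := half_e; nra.
rewrite -ler_expR lnK ?posrE // expRD.
apply: le_trans (_ : cmod (f z) * 2 <= _); first by lra.
by apply: ler_pM => //; rewrite ?cmod_ge0 // half_e.
Qed.

Lemma step_inner z : cmod z <= expR (a * (1 - d)) -> cmod (g z) <= expR (next_inner a d * (1 - d / 4)).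
Proof.
move=> hz; have [e0 e1 e2] := adm_loss ad; rewrite -/e in e0 e1 e2.
have [Ta gra Fa0 dFa] := adm_F ad (lexx a); case: (ad) => a1 ab d01 Kad.
have a0 : 0 < a by apply: lt_le_trans Ta; exact: lt_le_trans T11.
have [R1 R2 _ _ R5] := ring_room a0 ab d01.
pose p := a * (1 - d).
have Tp : T1 <= p by rewrite -(ler_pM2l (ltr0n R 2)); exact: le_trans a1 R5.
have Fp : F p <= (1 - d) * F a.
  by apply: (cancel_factor a0); rewrite mulrA; exact: fratio Tp (ltW (lt_trans R1 R2)).
apply: le_trans (le_max_modulus hg hz) _.
have [v ev <-] := max_modulus_attained hg (expR_ge0 p).
have h1 : cmod (f v) <= expR (F p).
  by rewrite lnK ?posrE ?fpos // -ev; exact: le_max_modulus_circle.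
have h2 : cmod (g v - f v) <= expR (F p).
  apply: le_trans (diff_le Tp ev) _; rewrite ler_expR; apply: ler_piMl.
    by apply: le_trans (fgrow Tp); rewrite mulr_ge0 // (le_trans _ Tp) // (le_trans _ T11).
  by apply: ltW; case/andP: al01.
have t2 := cmodD (f v) (g v - f v); rewrite addrC subrK in t2.
apply: le_trans (_ : expR (F p) * 2 <= _).
  by apply: le_trans t2 _; rewrite mulr_natr mulr2n; exact: lerD.
apply: le_trans (_ : expR (F p + 1) <= _).
  by rewrite expRD ler_pM2l ?expR_gt0 // half_e.
rewrite ler_expR; apply: le_trans (_ : (1 - d) * F a + 1 <= _); first by rewrite lerD2r.
exact: zero_room.
Qed.

End one_step.

End comparison.

Section index_sequences.

Lemma increasing_choice (P : nat -> nat -> Prop) : (forall n N, exists2 i, (N <= i)%N & P n i) ->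
  exists2 k : nat -> nat, {homo k : i j / (i < j)%N} & forall n, P n (k n).
Proof.
move=> H; have /choice [h Hh] : forall q : nat * nat, exists i, (q.2 <= i)%N /\ P q.1 i.
  by move=> [n N]; case: (H n N) => i; exists i.
pose k := fix k n := if n is n'.+1 then h (n'.+1, (k n').+1) else h (0%N, 0%N).
exists k; last by case=> [|n]; [exact: (Hh (0%N, 0%N)).2|exact: (Hh (n.+1, (k n).+1)).2].
apply: homo_ltn; first by move=> ? ? ?; exact: ltn_trans.
by move=> n; exact: (Hh (n.+1, (k n).+1)).1.
Qed.

(** A sequence from the family of iterates may repeat exponents; normality is trivial along a
    constant subsequence, and uniform escape handles the other case. *)
Lemma constant_or_unbounded (m : nat -> nat) : exists2 k : nat -> nat, {homo k : i j / (i < j)%N} &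
  (exists c, forall i, m (k i) = c) \/ forall i, (i <= m (k i))%N.
Proof.
have [H|H] := pselect (forall n N, exists2 i, (N <= i)%N & (n <= m i)%N).
  by have [k hk Hk] := increasing_choice H; exists k; [|right].
have [b [N Hb]] : exists b N, forall i, (N <= i)%N -> (m i < b)%N.
  apply: contrapT => no; apply: H => n N; apply: contrapT => no'; apply: no; exists n, N => i Ni.
  by rewrite ltnNge; apply/negP => h; apply: no'; exists i.
have [c Hc] : exists c, forall (n : nat) N', exists2 i, (N' <= i)%N & m i = c.
  elim: b N Hb => [|b IH] N Hb; first by have := Hb N (leqnn _).
  have [[N' HN']|h] := pselect (exists N', forall i, (N' <= i)%N -> m i != b).
    apply: (IH (maxn N N')) => i; rewrite geq_max => /andP [iN iN'].
    by rewrite ltn_neqAle HN' //= -ltnS Hb.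
  exists b => _ N'; apply: contrapT => no; apply: h; exists N' => i iN; apply/eqP => e.
  by apply: no; exists i.
by have [k hk Hk] := increasing_choice Hc; exists k => //; left; exists c.
Qed.

End index_sequences.

(** * The orbit of the initial ring under the perturbed function *)

Section iteration.
Context {R : realType}.
Local Notation C := R[i].
Variables (f g : C -> C) (al T1 K : R).
Hypotheses (hf : hol f) (hg : hol g).
Hypotheses (npf : ~ exists p : {poly C}, forall z, f z = p.[z]) (npg : ~ exists p : {poly C}, forall z, g z = p.[z]).
Hypotheses (al01 : 0 < al < 1) (T11 : 1 <= T1) (K16 : 16 <= K) (Kal : 2 <= (1 - al) * K).
Hypothesis fpos : forall t, T1 <= t -> 0 < max_modulus (expR t) f.
Hypothesis fgrow : forall t, T1 <= t -> 34 * t <= lmm f t.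
Hypothesis fratio : forall s t, T1 <= s -> s <= t -> t * lmm f s <= s * lmm f t.
Hypothesis fclose : forall t, T1 <= t -> max_modulus (expR t) (g \- f) <= expR (al * lmm f t).
Variables (Us : nat -> set C) (a0 b0 d0 : R).
Hypotheses (stepUs : forall n z, Us n z -> Us n.+1 (f z)) (Us1 : forall n z, Us n z -> 1 < cmod z).
Hypotheses (adm0 : admissible T1 K a0 b0 d0) (ab0 : a0 < b0).
Hypothesis ring0 : forall z, z != 0 -> a0 * (1 - d0) < ln (cmod z) < b0 * (1 + d0) -> Us 0%N z.

Let F := lmm f.
Let nc := transcendental_nonconstant npf.
Let ncg := transcendental_nonconstant npg.

Let st n : R * R * R := iter n (fun s => (next_inner f s.1.1 s.2, next_outer f s.1.2, s.2 / 4)) (a0, b0, d0).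
Let A n := (st n).1.1.
Let B n := (st n).1.2.
Let D n := (st n).2.

Let adm n : admissible T1 K (A n) (B n) (D n).
Proof. by elim: n => [|n IH] //; exact: (step_admissible hf al01 T11 K16 Kal fpos fgrow IH). Qed.

Let big_of n : (forall z, z != 0 -> A n * (1 - D n) < ln (cmod z) < B n * (1 + D n) -> Us n z) ->
  forall z, z != 0 -> A n * (1 - D n) < ln (cmod z) < B n * (1 + D n) -> 1 < cmod (f z).
Proof. by move=> H z z0 hz; apply: (Us1 (n := n.+1)); apply: stepUs; exact: H. Qed.

Let ring_in n : forall z, z != 0 -> A n * (1 - D n) < ln (cmod z) < B n * (1 + D n) -> Us n z.
Proof.
elim: n => [|n IH]; first exact: ring0.
move=> w w0 hw.
have [z [z0 hz] <-] := step_cover hf nc al01 T11 K16 Kal fpos fgrow fratio (adm n) (big_of IH) w0 hw.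
by apply: stepUs; exact: IH.
Qed.

Let A_ge1 n : 1 <= A n.
Proof. by have [h _ _ _] := adm n; have := T11; lra. Qed.

Let loss n : [/\ 0 < harnack_loss (A n) (D n), 16 * harnack_loss (A n) (D n) <= D n & D n <= 2^-1].
Proof.
have [e0 e1 _] := adm_loss al01 T11 K16 Kal (adm n); have [_ _ /andP [_ d] _] := adm n.
by split.
Qed.

Let A_ge_n n : n%:R <= A n.
Proof.
elim: n => [|n IH]; first exact: le_trans (A_ge1 0).
have h := next_inner_large al01 T11 K16 Kal fgrow (adm n).
have h1 := A_ge1 n; rewrite -natr1; apply: le_trans (_ : 16 * A n <= A n.+1); [lra|exact: h].
Qed.

Let g_ring n z : z != 0 -> A n <= ln (cmod z) <= B n -> g z != 0 /\
  (1 - harnack_loss (A n) (D n)) * F (ln (cmod z)) - 1 <= ln (cmod (g z)) <= F (ln (cmod z)) + 1.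
Proof. by move=> z0 hz; exact: (step_g hf hg al01 T11 K16 Kal fpos fgrow fclose (adm n) (big_of (@ring_in n))). Qed.

Let T1A n : T1 <= A n.
Proof. by have [h _ _ _] := adm n; have := T11; lra. Qed.

Let orbit n z : z != 0 -> A 0 <= ln (cmod z) <= B 0 -> iter n g z != 0 /\ A n <= ln (cmod (iter n g z)) <= B n.
Proof.
move=> z0 hz; elim: n => [|n [IH0 IH]] //; have [g0 /andP [h1 h2]] := g_ring IH0 IH.
split=> //; rewrite iterS; move: IH => /andP [i1 i2]; apply/andP; split.
  apply: le_trans h1; rewrite lerD2r; apply: ler_wpM2l; first by have [_ e1 e2] := loss n; lra.
  by apply: lmm_mono => //; exact/fpos/T1A.
apply: le_trans h2 _; rewrite lerD2r; apply: lmm_mono => //; apply: fpos; exact: le_trans (T1A n) i1.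
Qed.

Let orbit_zero n : cmod (iter n g 0) <= expR (A n * (1 - D n)).
Proof.
elim: n => [|n IH]; first by rewrite cmod0 expR_ge0.
exact: (step_inner hf hg al01 T11 K16 Kal fpos fgrow fratio fclose (adm n) IH).
Qed.

(** The initial ring without its margins: the orbit of [g] is controlled there, whereas the ring
    with margins is used for [f] only. *)
Let Rg : set C := [set z | expR a0 < cmod z < expR b0].

Let Rg_orbit n z : Rg z -> iter n g z != 0 /\ A n <= ln (cmod (iter n g z)) <= B n.
Proof.
move=> /= /andP [h1 h2]; have z0 : 0 < cmod z := lt_trans (expR_gt0 _) h1.
apply: orbit; first by rewrite -cmod_gt0.
by rewrite -[A 0]expRK -[B 0]expRK !ler_ln ?posrE ?expR_gt0 // (ltW h1) (ltW h2).
Qed.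

Let Rg_large (M : R) : exists N, forall n, (N <= n)%N -> forall z, Rg z -> M < cmod (iter n g z).
Proof.
exists (Num.bound `|M|) => n Nn z /(Rg_orbit n) [w0 /andP [h _]].
have c0 : 0 < cmod (iter n g z) by rewrite cmod_gt0.
apply: le_lt_trans (ler_norm M) (lt_le_trans (archi_boundP (normr_ge0 M)) _).
apply: le_trans (_ : n%:R <= _); first by rewrite ler_nat.
apply: le_trans (A_ge_n n) (le_trans h _).
by have := expR_ge1Dx (ln (cmod (iter n g z))); rewrite lnK ?posrE //; lra.
Qed.

Let Rg_fatou : Rg `<=` fatou_set g.
Proof.
move=> z Rz; have [r r0 Hr] : exists2 r, 0 < r & forall w, cmod (w - z) < r -> Rg w.
  move: Rz => /= /andP [h1 h2]; exists (Num.min (cmod z - expR a0) (expR b0 - cmod z)).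
    by rewrite lt_min !subr_gt0 h1 h2.
  move=> w; rewrite lt_min => /andP [k1 k2].
  have A1 := cmod_subl z w; have A2 := cmod_subl w z; rewrite [cmod (z - w)]cmodB in A1.
  by apply/andP; split; lra.
apply: (tame_fatou r0) => m; have [k hk [[c Hc]|Hk]] := constant_or_unbounded m; exists k => //.
  by left=> e e0; exists 0%N => i j _ _ w _; rewrite !Hc subrr cmod0.
right=> M; have [N HN] := Rg_large M; exists N => i Ni w /Hr Rw; apply: HN => //.
exact: leq_trans Ni (Hk i).
Qed.

Let s0 := (a0 + b0) / 2.
Let z0 : C := (expR s0)%:C.

Let Rg_circle z : cmod z = expR s0 -> Rg z.
Proof. by move=> e; rewrite /Rg /= e !ltr_expR /s0; have := ab0; lra. Qed.

Let Rz0 : Rg z0.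
Proof. by apply: Rg_circle; rewrite cmodR ger0_norm // expR_ge0. Qed.

Let iter_fatou n z : fatou_set g z -> fatou_set g (iter n g z).
Proof. by move=> Fz; elim: n => // n IH; rewrite iterS; exact: fatou_forward. Qed.

Let Vs n := connected_component (fatou_set g) (iter n g z0).

Let comp n : fatou_component g (Vs n).
Proof. by exists (iter n g z0) => //; apply/iter_fatou/Rg_fatou. Qed.

Let in_comp n : Vs n (iter n g z0).
Proof. by apply: connected_component_refl; apply/iter_fatou/Rg_fatou. Qed.

Let image_comp n m : iter n g @` Vs m `<=` Vs (n + m)%N.
Proof.
have [_ con _ VF _] := fatou_componentP (comp m); have [_ _ _ _ mx] := fatou_componentP (comp (n + m)%N).
apply: mx.
- apply: connected_continuous_connected => //; apply: continuous_subspaceT => w.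
  by apply/ccont_continuous/holo_ccont; exact: holo_iter.
- by move=> _ [w Vw <-]; apply/iter_fatou/VF.
by exists (iter (n + m) g z0); [exists (iter m g z0); rewrite -?iterD|].
Qed.

Let RgV : Rg `<=` Vs 0.
Proof.
have [_ _ _ _ mx] := fatou_componentP (comp 0); apply: mx => //; last by exists z0.
exact: ring_connected (expR_gt0 a0).
Qed.

Let not_simply_connected : ~ simply_connected (Vs 0).
Proof.
move=> sc; have r0 : 0 < expR s0 := expR_gt0 s0.
have lc : loop_in (Vs 0) (circle_loop (expR s0)).
  by apply: circle_loop_in (ltW r0) _ => z /Rg_circle /RgV.
have sub : [set z : C | cmod (z - 0) <= expR s0] `<=` Vs 0.
  move=> z /=; rewrite subr0 le_eqVlt => /orP [/eqP /Rg_circle /RgV //|].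
  exact: (circle_contracts_disc r0 (sc _ lc)).
have [_ con _ VF _] := fatou_componentP (comp 0).
have inf (M : R) : exists N, forall i, (N <= i)%N -> M < cmod (iter (id i) g z0).
  by have [N HN] := Rg_large M; exists N => i Ni; exact: HN.
have [N HN] := infty_connected con VF (in_comp 0) inf (@compact_closed_cdisc R 0 (expR s0)) sub 1.
have := @minimum_principle_disc R (iter N g) 0 (expR s0) (expR (A N)) _ (expR_gt0 _) _ _ 0.
rewrite subrr cmod0 => h.
have {}h : expR (A N) <= cmod (iter N g 0).
  apply: h; [by move=> z; exact: holo_iter| | |exact: ltW].
  - by move=> z zr; rewrite -cmod_gt0; apply: lt_trans ltr01 (HN N (leqnn _) z zr).
  - move=> z; rewrite subr0 => /Rg_circle /(Rg_orbit N) [w0 /andP [h1 _]].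
    by rewrite -[leRHS]lnK ?posrE ?cmod_gt0 // ler_expR.
have := le_trans h (orbit_zero N); rewrite ler_expR => h2.
have [e0 e1 e2] := loss N; have A1 := A_ge1 N.
have : 0 < A N * D N by apply: mulr_gt0; lra.
lra.
Qed.

Let fast (k : R) : 1 <= k -> exists N, forall n, (N <= n)%N -> forall p, (0 < p)%N ->
  0 < ln (cmod (iter n g z0)) /\ k * ln (cmod (iter n g z0)) <= ln (cmod (iter (p + n) g z0)).
Proof.
(* Of the factor [4 * k] the loss and the additive 1 leave at least [k], since [k * s >= 1]. *)
move=> k1; have [t0 _ Ht] := lmm_superlinear hf npf (4 * k).
pose N := Num.bound `|t0|; exists N => n Nn.
have step m : (N <= m)%N -> 1 <= ln (cmod (iter m g z0)) /\
    k * ln (cmod (iter m g z0)) <= ln (cmod (iter m.+1 g z0)).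
  move=> Nm; have [w0 hw] := Rg_orbit m Rz0; have [_ /andP [lo _]] := g_ring w0 hw.
  have [e0 e1 e2] := loss m; have A1 := A_ge1 m.
  move: lo; rewrite -iterS; move: hw => /andP [hw _] lo.
  have s1 : 1 <= ln (cmod (iter m g z0)) by exact: le_trans hw.
  split=> //; have ts : t0 <= ln (cmod (iter m g z0)).
    apply: le_trans (ler_norm _) (le_trans (ltW (archi_boundP (normr_ge0 t0))) _).
    apply: le_trans (_ : m%:R <= _); first by rewrite ler_nat.
    exact: le_trans (A_ge_n m) hw.
  have [_ gr] := Ht _ ts; apply: le_trans lo.
  move: (ln (cmod (iter m g z0))) s1 gr {ts hw} => s s1; rewrite -/F.
  move: (F s) (harnack_loss _ _) e0 e1 e2 => x e e0 e1 e2 gr.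
  have ks : 1 <= k * s by rewrite -[1]mulr1; apply: ler_pM.
  have : 16 * e * x <= 2^-1 * x by rewrite ler_pM2r; lra.
  lra.
elim=> // p IH _; have [l1 l2] := step n Nn; split; first by lra.
case: p IH => [_|p /(_ isT) [_ IH]]; first exact: l2.
apply: le_trans IH _; have [h1 h2] := step (p.+1 + n)%N (leq_trans Nn (leq_addl _ _)).
by apply: le_trans h2; rewrite ler_peMl //; lra.
Qed.

(** With period [p] the point [x] and its image under [g^p] lie in one component. Harnack's
    inequality then compares [ln |g^(jp)|] at both points with a constant independent of [j],
    whereas [fast] makes the ratio exceed any constant. *)
Let not_periodic : ~ eventually_periodic Vs.
Proof.
case=> N [p [p0 per]].
pose m j := (j * p)%N; pose x := iter N g z0.
have perj j : Vs (m j + N)%N = Vs N.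
  elim: j => // j IH; rewrite /m mulSn -addnA addnC per //; exact: leq_addl.
have [oW con _ WF _] := fatou_componentP (comp N).
have Wx : Vs N x by exact: in_comp.
have Wy : Vs N (iter p g x) by rewrite -(perj 1%N) /m mul1n; apply: image_comp; exists x.
have inf (M : R) : exists J, forall j, (J <= j)%N -> M < cmod (iter (m j) g x).
  have [J HJ] := Rg_large M; exists J => j Jj; rewrite /x -iterD; apply: HJ => //.
  by apply: leq_trans Jj _; rewrite /m; apply: leq_trans (leq_addr _ _); exact: leq_pmulr.
(* The constant is carried from [x] through discs of the component; each disc multiplies it by
   [5 / 3], the Harnack constant for [t = 1 / 4]. *)
have [c [J HJ]] : exists c J, forall j, (J <= j)%N -> ln (cmod (iter (m j) g (iter p g x))) <= c * ln (cmod (iter (m j) g x)).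
  apply: (connected_induct (P := fun z => exists c J, forall j, (J <= j)%N ->
    ln (cmod (iter (m j) g z)) <= c * ln (cmod (iter (m j) g x))) con Wx _ _ Wy).
    by exists 1, 0%N => j _; rewrite mul1r.
  move=> z Wz; have [r r0 H] := fatou_tame (WF z Wz); exists (r / 16); first by rewrite divr_gt0.
  have cz : [set z] `<=` Vs N by move=> _ ->.
  have kz : compact [set z] by exact: compact_set1.
  have infz (M : R) : exists J, forall j, (J <= j)%N -> M < cmod (iter (m j) g z).
    have [J HJ] := infty_connected con WF Wx inf kz cz M; exists J => j Jj; exact: HJ.
  have [J1 H1] := tame_infty H (cdisc_center z r0) infz 1.
  move=> w w' _ _ wz w'z [c [J HJ]]; exists (5 / 3 * c), (maxn J J1) => j; rewrite geq_max => /andP [Jj J1j].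
  have r2 : 0 < r / 2 by rewrite divr_gt0.
  have [||||h _] := @harnack R (iter (m j) g) w (r / 2) (1 / 4) w' r2.
  - by move=> v _; exact: holo_iter.
  - move=> v vw; apply: (H1 j J1j); apply: le_lt_trans (cmod_distD w _ _) _.
    by move: vw; rewrite /cdisc /=; lra.
  - lra.
  - by apply: le_trans (cmod_distD z _ _) _; rewrite [cmod (z - w)]cmodB; lra.
  by have := HJ j Jj; rewrite -mulrA; lra.
have k1 : 1 <= `|c| + 1 by rewrite lerDr.
have [N1 H1] := fast k1; pose j := (J + N1)%N.
have jn : (N1 <= m j + N)%N.
  apply: leq_trans (leq_addl J N1) (leq_trans _ (leq_addr _ _)); exact: leq_pmulr.
have [l0 hl] := H1 _ jn _ p0.
have := HJ j (leq_addr _ _); rewrite /x -!iterD => h.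
have e : (m j + p + N = p + (m j + N))%N by rewrite [RHS]addnCA addnA.
rewrite e in h; have := le_trans hl h; rewrite ler_pM2r // => h3.
by have := ler_norm c; lra.
Qed.

Lemma iteration_wandering : has_multiply_connected_wandering_domain g.
Proof.
have [oV con ne _ _] := fatou_componentP (comp 0).
exists (Vs 0); last by split.
split; first exact: comp.
exists Vs; last exact: not_periodic.
split=> // n; split; first exact: comp.
by have := @image_comp n 0; rewrite addn0.
Qed.

End iteration.

(** Half of the relative width [eta] goes to the interval from [a] to [b], the rest to the margins
    [eta / 4]. As [a >= L / 2], the term in [(4 / eta) ^+ 2] gives the bound on [a * d ^+ 2]. *)
Lemma admissible_start (R : realType) (T1 K L eta : R) : 1 <= T1 -> 0 <= K -> 0 < eta < 1 ->
  4 * T1 + 2 * (16 * K) * (4 / eta) ^+ 2 <= L ->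
  [/\ admissible T1 K (L * (1 - eta / 2)) (L * (1 + eta / 2)) (eta / 4),
      L * (1 - eta / 2) < L * (1 + eta / 2),
      L - eta * L <= L * (1 - eta / 2) * (1 - eta / 4) &
      L * (1 + eta / 2) * (1 + eta / 4) <= L + eta * L].
Proof.
move=> T11 K0 /andP [eta0 eta1] hL; have s0 : 0 < (eta / 4) ^+ 2 by rewrite exprn_gt0 // divr_gt0.
have q0 : 0 <= 2 * (16 * K) * (4 / eta) ^+ 2 by rewrite mulr_ge0 ?sqr_ge0 // !mulr_ge0.
have [L1 q1] : 4 * T1 <= L /\ 2 * (16 * K) * (4 / eta) ^+ 2 <= L.
  by split; apply: le_trans hL; rewrite ?lerDl ?lerDr // mulr_ge0 // (le_trans ler01).
have L0 : 0 < L by apply: lt_le_trans L1; rewrite mulr_gt0 // (lt_le_trans ltr01).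
have Le0 : 0 < L * eta by exact: mulr_gt0.
have Le : L * eta < L by rewrite gtr_pMr.
have Lee0 : 0 < L * eta * eta by exact: mulr_gt0.
have Lee : L * eta * eta <= L * eta by rewrite ler_piMr ?ltW.
have a2 : L / 2 <= L * (1 - eta / 2) by move: Le; clear; lra.
split; last 3 first.
- by move: Le0; clear; lra.
- by move: Lee0 Le0; clear; lra.
- by move: Lee0 Le0 Lee; clear; lra.
split.
- by apply: le_trans a2; move: L1; clear; lra.
- by move: Le0; clear; lra.
- by move: eta0 eta1; clear; lra.
apply: le_trans (_ : L / 2 * (eta / 4) ^+ 2 <= _); last by rewrite ler_pM2r.
have e : (4 / eta) ^+ 2 * (eta / 4) ^+ 2 = 1.
  by rewrite -exprMn mulf_div [eta * 4]mulrC divff ?expr1n // mulf_neq0 // gt_eqF.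
have := ler_wpM2r (ltW s0) q1; rewrite -[X in X <= _]mulrA e mulr1.
by clear; lra.
Qed.

Theorem theorem1p9 (R : realType) (f g : R[i] -> R[i])
    (hf : transcendental_entire f) (hg : transcendental_entire g)
    (hfg : exists alpha : R, 0 < alpha < 1 /\
       \forall r \near +oo,
         max_modulus r (g \- f) <= max_modulus r f `^ alpha) :
  has_multiply_connected_wandering_domain f ->
  has_multiply_connected_wandering_domain g.
Proof.
move=> Wf; have [ef npf] := hf; have [eg npg] := hg.
have holf : hol f by move=> z; exact: entire_holo.
have holg : hol g by move=> z; exact: entire_holo.
have [al [al01 [M [_ HM]]]] := hfg.
have [Us [oU stU esc [eta eta01 ann]]] := wandering_annuli holf npf Wf.
have [t1 t1_1 H1] := lmm_superlinear holf npf 34.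
have [t2 t2_1 H2] := lmm_ratio_mono holf npf.
(* The sum dominates every threshold, and the two terms of [K] answer its two requirements. *)
pose T1 := t1 + t2 + `|M|; pose K := 16 + 2 / (1 - al).
have al1 : 0 < 1 - al by rewrite subr_gt0; case/andP: al01.
have [T1t1 T1t2 T1M T11] : [/\ t1 <= T1, t2 <= T1, M <= T1 & 1 <= T1].
  by have := normr_ge0 M; have := ler_norm M; move: t1_1 t2_1; rewrite /T1; clear; split; lra.
have K16 : 16 <= K by rewrite /K lerDl divr_ge0 // ltW.
have Kal : 2 <= (1 - al) * K by rewrite /K mulrDr mulrCA divff ?gt_eqF // mulr1 lerDr mulr_ge0 // ltW.
clearbody T1 K; have [N1 HN1] := esc 1.
(* The orbit is started at an index [n] from which all components avoid the closed unit disc, so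
   that the logarithms in Harnack's inequality are positive. *)
have [n [L [nN TL HL]]] := ann (4 * T1 + 2 * (16 * K) * (4 / eta) ^+ 2) N1.
have [ad ab lo hi] := admissible_start T11 (le_trans (ler0n _ 16) K16) eta01 TL.
apply: (@iteration_wandering R f g al T1 K holf holg npf npg al01 T11 K16 Kal _ _ _ _
  (fun i => Us (i + n)%N) _ _ _ _ _ ad ab) => //.
- by move=> t tT; exact: (proj1 (H1 t (le_trans T1t1 tT))).
- by move=> t tT; exact: (proj2 (H1 t (le_trans T1t1 tT))).
- by move=> s t sT st; apply: H2 => //; exact: le_trans sT.
- move=> t tT; have pos := proj1 (H1 t (le_trans T1t1 tT)).
  apply: le_trans (HM (expR t) _) _; last by rewrite /powR gt_eqF.
  by apply: le_lt_trans (le_trans T1M tT) (lt_le_trans _ (expR_ge1Dx t)); rewrite ltrDr.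
- by move=> i z; exact: stU.
- by move=> i z; apply: HN1; exact: leq_trans nN (leq_addl _ _).
- move=> z z0 /andP [h1 h2]; apply: HL => //.
  by rewrite ler_distl (le_trans lo (ltW h1)) (le_trans (ltW h2) hi).
Qed.
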